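(* Assume that $t^2\delta_t^d\to c\in[0,\infty)$ as $t\to\infty$. Let $(X_j)_{j\in\mathbb{N}}$ be an i.i.d. family of random variables uniformly distributed in $[0,c]$, and let $N$ be a Poisson random variable with mean $\kappa_dV(W)c/2$, independent of $(X_j)_{j\in\mathbb{N}}$. Then, for all $m\in\mathbb{N}$ and $\tau_1,\dots,\tau_m\in\mathbb{R}$, $$\Big(t^{2\tau_1/d}L_t^{(\tau_1)},\dots,t^{2\tau_m/d}L_t^{(\tau_m)}\Big)\overset{d}{\longrightarrow}\Big(\sum_{j=1}^NX_j^{\tau_1/d},\dots,\sum_{j=1}^NX_j^{\tau_m/d}\Big)\qquad\text{as }t\to\infty.$$
   Context: Fix an integer $d\ge 1$. $W\subset\mathbb{R}^d$ is a compact convex set with volume (Lebesgue measure) $V(W)>0$. For $t>0$, $\eta_t$ is a homogeneous Poisson point process in $W$ with intensity $t$ (identified with the random finite set of its points), and $(\delta_t:t>0)$ is a family of positive real numbers with $\delta_t\to0$ as $t\to\infty$. $\eta^2_{t,\neq}$ is the set of ordered pairs of distinct points of $\eta_t$, and $$L^{(\tau)}_t:=\frac12\sum_{(x,y)\in\eta^2_{t,\neq}}\mathbf{1}(\|x-y\|\le\delta_t)\,\|x-y\|^\tau .$$ $\kappa_d$ is the volume of the $d$-dimensional unit ball, and $\overset{d}{\longrightarrow}$ denotes convergence in distribution. (For $c=0$, $N=0$ almost surely and the sums are empty, hence $0$.) *)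

(* Defs.v *)
From HB Require Import structures.
From mathcomp Require Import all_boot all_order all_algebra.
From mathcomp Require Import finmap.
From mathcomp Require Import all_classical all_reals all_analysis.
Set Implicit Arguments.
Unset Strict Implicit.
Unset Printing Implicit Defensive.
Import Order.TTheory GRing.Theory Num.Theory.
Import numFieldNormedType.Exports.
Local Open Scope classical_set_scope.
Local Open Scope ring_scope.

Notation borelRV R d := (g_sigma_algebraType (@open 'rV[R]_d)).

(* The norm `|x| that the library puts on 'rV[R]_d is the sup norm. *)
Definition enorm (R : realType) (d : nat) (x : 'rV[R]_d) : R :=
  Num.sqrt (\sum_(i < d) x ord0 i ^+ 2).

(* Lebesgue measure of Borel subsets of R^d, as the d-fold product of the
   one-dimensional one: the recursive clause is the formula by which the library
   defines [lebesgue_measure \x vol d'], along R^d'.+1 = R * R^d'.  On sets that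
   are not Borel the value is meaningless. *)
Fixpoint vol (R : realType) (d : nat) : set 'rV[R]_d -> \bar R :=
  match d return set 'rV[R]_d -> \bar R with
  | 0 => fun A => (\1_A (0 : 'rV[R]_0))%:E
  | d'.+1 => fun A =>
      (\int[@lebesgue_measure R]_x
         vol [set y : 'rV[R]_d' | A (row_mx (x%:M : 'rV[R]_1) y)])%E
  end.

Definition kappa (R : realType) (d : nat) : R :=
  fine (vol [set x : 'rV[R]_d | enorm x <= 1]).

Section Independence.
Context (R : realType) (dT : measure_display) (T : measurableType dT).
Variable P : probability T R.

Definition mutually_independent (I : choiceType) (G : I -> set (set T)) : Prop :=
  forall (J : {fset I}) (A : I -> set T),
    (forall i, i \in J -> G i (A i)) ->
    P (\bigcap_(i in [set` J]) A i) = (\prod_(i <- J) P (A i))%E.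

Definition independent (G H : set (set T)) : Prop :=
  forall A B, G A -> H B -> P (A `&` B) = (P A * P B)%E.

End Independence.

(* The second argument of [poisson_prob] is a dummy; for rate 0 it is \d_0. *)
Definition poisson_law (R : realType) (r : R) : set nat -> \bar R :=
  poisson_prob r 0%N.

Definition count_in (R : realType) (d : nat) (T : Type)
    (eta : T -> {fset 'rV[R]_d}) (A : set 'rV[R]_d) (w : T) : nat :=
  #|` [fset x in eta w | x \in A]%fset|.

Record poisson_process (R : realType) (d : nat) (dT : measure_display)
    (T : measurableType dT) (P : probability T R) (W : set 'rV[R]_d) (t : R)
    (eta : T -> {fset 'rV[R]_d}) : Prop := PoissonProcess {
  pp_support : forall w x, x \in eta w -> W x ;
  pp_measurable : forall A : set (borelRV R d), measurable A -> A `<=` W ->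
    measurable_fun setT (count_in eta A) ;
  pp_poisson : forall A : set (borelRV R d), measurable A -> A `<=` W ->
    forall B : set nat,
      P (count_in eta A @^-1` B) = poisson_law (t * fine (vol A)) B ;
  pp_independent : forall (n : nat) (A : 'I_n -> set (borelRV R d)),
    (forall i, measurable (A i)) -> (forall i, A i `<=` W) ->
    trivIset setT A ->
    mutually_independent P
      (fun i => g_sigma_algebra_preimage (count_in eta (A i)))
}.

Definition edge_power_sum (R : realType) (d : nat) (delta tau : R)
    (eta : {fset 'rV[R]_d}) : R :=
  2^-1 * \sum_(x <- eta) \sum_(y <- eta | (x != y) && (enorm (x - y) <= delta))
    enorm (x - y) `^ tau.

(* Convergence in distribution, along the filter F, of the random vectors X i to
   Y.  Each X i may live on its own probability space. *)
Definition cvg_in_distribution (R : realType) (m : nat) (I : Type)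
    (F : set_system I) (dT : I -> measure_display)
    (T : forall i, measurableType (dT i)) (P : forall i, probability (T i) R)
    (X : forall i, T i -> 'rV[R]_m) (dT' : measure_display)
    (T' : measurableType dT') (Q : probability T' R) (Y : T' -> 'rV[R]_m) : Prop :=
  [/\ (\forall i \near F, measurable_fun setT (X i : T i -> borelRV R m)),
      measurable_fun setT (Y : T' -> borelRV R m) &
      forall f : 'rV[R]_m -> R, continuous f -> bounded_fun f ->
        ('E_(P i)[f \o X i])%E @[i --> F] --> ('E_Q[f \o Y])%E].

(* Main.v *)
Require Import Defs.
From HB Require Import structures.
From mathcomp Require Import all_boot all_order all_algebra.
From mathcomp Require Import finmap.
From mathcomp Require Import all_classical all_reals all_analysis.
From mathcomp Require Import measurable_realfun ring lra zify.
Set Implicit Arguments.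
Unset Strict Implicit.
Unset Printing Implicit Defensive.
Import Order.TTheory GRing.Theory Num.Theory.
Import numFieldNormedType.Exports.
Local Open Scope classical_set_scope.
Local Open Scope ring_scope.

(** Call two distinct points of the process near if their distance is at most
    delta_t, and let Z_t be the vector of rescaled edge power sums. A near pair
    (x, y) contributes to Z_t the vector g (t^2 |x - y|^d), where the coordinates
    of g u are the powers u^(tau_i / d). Write M_t for the number of ordered near
    pairs, and Y for the limit vector, the sum of the g (X_j) for j < N. The number
    2N plays for Y the role that M_t plays for Z_t.

    For a measurable test function f with values in [0, 1] let
      p_k (f) = E [f (Z_t); M_t = k]    and    q_k (f) = E [f (Y); 2N = k].
    The Mecke equation, applied to two points, turns a sum over ordered near pairs
    into an integral over W x W in which two points x and y are added to the
    process. Unless one of them is near a third point, the addition raises M_t by 2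
    and Z_t by g (t^2 |x - y|^d). Hence (lemma recursion)
      k p_k (f) = t^2 int int 1(|x - y| <= delta_t)
                        p_(k-2) (f (. + g (t^2 |x - y|^d))) dx dy + O(error),
    where the error, the mean number of configurations of two near points with a
    third point near one of them, is of order t^3 delta_t^(2d), which tends to 0.
    Because the volume of a ball is proportional to the d-th power of its radius,
    the map y -> t^2 |x - y|^d sends volume to a multiple of the uniform measure on
    the half line (radial_measure). Up to the points y that fall outside of W, which
    lie in a shrinking neighbourhood of the compact set W, t^2 times the double
    integral is kappa_d V(W) times the integral over u in [0, t^2 delta_t^d] of
    p_(k-2) (f (. + g u)) (pair_intensity_le and pair_intensity_ge). The limit
    satisfies the same recursion exactly (limit_recursion):
      k q_k (f) = kappa_d V(W) int_0^c q_(k-2) (f (. + g u)) du.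

    The two recursions have proportional initial values, p_0 (f) = r q_0 (f) with
    a ratio r that does not depend on f, as the vectors vanish when there are no
    pairs; and p_1 and q_1 are negligible. By induction p_k - r q_k is small,
    uniformly in f, for each k (compare_laws). The mean of M_t is bounded, so only
    finitely many k matter; taking f = 1 and summing over k shows that r is close
    to 1, and summing for a general f gives E f(Z_t) - E f(Y) -> 0, uniformly in f
    (compare_expectations, uniform_convergence). A bounded continuous function is an
    affine function of a test function.

    The Mecke equation itself is derived from the definition of a Poisson process
    through the numbers of points in dyadic cells: on the events which fix these
    numbers it reduces to the identity (k + 1) pi_r (k + 1) = r pi_r (k) between
    Poisson weights (prob_profile_cons), and such events form a generating
    pi-system (campbell_product, mecke_poisson). *)

(** * Dyadic cells and Borel measurability in R^d *)

Section DyadicCells.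
Context (R : realType) (d : nat).
Implicit Types (x : 'rV[R]_d) (n : nat) (a : 'rV[int]_d).

(** The index of the cell of the dyadic grid of mesh 2^-n that contains x. *)
Definition code n x : 'rV[int]_d := \row_i Num.floor (2 ^+ n * x ord0 i).

Definition cell n a : set 'rV[R]_d := [set x | code n x = a].

Lemma floor_half (y : R) : Num.floor y = (Num.floor (2 * y) %/ 2)%Z.
Proof.
apply: floor_def.
have /andP[h1 h2] := floor_itv (2 * y).
set z := Num.floor (2 * y) in h1 h2 *.
have e := divz_eq z 2; have r0 : 0 <= (z %% 2)%Z by apply: modz_ge0.
have r1 : (z %% 2)%Z < 2 by apply: ltz_pmod.
set q := (z %/ 2)%Z in e *.
have l1 : q * 2 <= z by rewrite e lerDl.
have l2 : z + 1 <= (q + 1) * 2 by lia.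
move: l1 l2; rewrite -2!(ler_int R) !rmorphM /= => l1 l2.
by apply/andP; split; lra.
Qed.

Lemma codeS n x : code n x = map_mx (fun z => (z %/ 2)%Z) (code n.+1 x).
Proof. by apply/rowP => i; rewrite !mxE floor_half exprS mulrA. Qed.

(** Each dyadic grid refines the previous one, so a coarse code is a function of
    any finer code. *)
Lemma code_coarsen n n' : (n <= n')%N ->
  exists g : 'rV[int]_d -> 'rV[int]_d, forall x, code n x = g (code n' x).
Proof.
elim: n' => [|k IH]; first by rewrite leqn0 => /eqP ->; exists id.
rewrite leq_eqVlt => /orP[/eqP->|]; first by exists id.
rewrite ltnS => /IH[g gE]; exists (g \o map_mx (fun z => (z %/ 2)%Z)) => x /=.
by rewrite -codeS.
Qed.

Lemma cell_ball n x y e : 2 ^- n <= e -> 0 < e -> code n y = code n x -> ball x e y.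
Proof.
move=> ne e0 /rowP yx; split => // i j; rewrite ord1.
rewrite /ball /=; have := yx j; rewrite !mxE => exy.
have /andP[x1 x2] := floor_itv (2 ^+ n * x ord0 j).
have /andP[y1 y2] := floor_itv (2 ^+ n * y ord0 j).
rewrite exy in y1 y2; rewrite intrD in x2 y2.
have p0 : 0 < (2 : R) ^+ n by rewrite exprn_gt0.
suff : `|x ord0 j - y ord0 j| < 2 ^- n by move/lt_le_trans; apply.
rewrite -(ltr_pM2l p0) divff ?gt_eqF// -{1}(ger0_norm (ltW p0)) -normrM mulrBr.
by rewrite ltr_norml; apply/andP; split; lra.
Qed.

Lemma open_bigcup_cell (U : set 'rV[R]_d) : open U ->
  U = \bigcup_(p in [set p : nat * 'rV[int]_d | cell p.1 p.2 `<=` U])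
        cell p.1 p.2.
Proof.
move=> oU; apply/seteqP; split => [x Ux|x [p /= + xp]]; last exact.
have [e /= e0 eU] : nbhs_ball x U by apply/nbhs_ballP; apply: open_nbhs_nbhs.
have [n _ ne] : \forall n \near \oo, 2 ^- n < e :> R.
  have := @cvg_expr R 2^-1; rewrite ger0_norm ?invr_ge0// invf_lt1// => /(_ _).
  rewrite ltr1n => /(_ isT) h.
  have /cvgrPdist_lt /(_ _ e0) := h.
  by apply: filterS => n; rewrite sub0r normrN ger0_norm ?exprn_ge0 ?invr_ge0// exprVn.
exists (n, code n x) => //= y cy; apply: eU; apply: (@cell_ball n) => //.
exact/ltW/ne/leqnn.
Qed.

End DyadicCells.

Section MeasurabilityRV.
Context (R : realType) (d : nat) (dT : measure_display) (T : measurableType dT).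

(** A countable family of cells generates the Borel sets of R^d: it suffices to
    control the preimages of cells. *)
Lemma measurable_fun_cells (f : T -> borelRV R d) :
  (forall n a, measurable (f @^-1` cell n a)) -> measurable_fun setT f.
Proof.
move=> mf; apply: (@measurability _ _ _ _ setT f (@open 'rV[R]_d)) => //.
move=> _ [U oU <-]; rewrite setTI (open_bigcup_cell oU) preimage_bigcup.
rewrite bigcup_mkcond; apply: countable_bigcupT_measurable => // p.
by case: ifP.
Qed.

Lemma measurable_preimage_cell (f : T -> borelRV R d) n a :
  (forall i, measurable_fun setT (fun w => (f w : 'rV_d) ord0 i)) ->
  measurable (f @^-1` cell n a).
Proof.
move=> mf; rewrite [X in measurable X](_ : _ = \bigcap_(i in [set: 'I_d])
   ((fun w => (f w : 'rV_d) ord0 i) @^-1`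
     [set y | (a ord0 i)%:~R <= 2 ^+ n * y < (a ord0 i + 1)%:~R])).
  apply: fin_bigcap_measurable => // i _.
  rewrite -[X in measurable X]setTI; apply: mf => //.
  rewrite (_ : [set _ | _] = `[2 ^- n * (a ord0 i)%:~R, 2 ^- n * (a ord0 i + 1)%:~R[%classic).
    exact: measurable_itv.
  apply/seteqP; split => y /=; rewrite in_itv /= ler_pdivrMl ?ltr_pdivlMl ?exprn_gt0//.
apply/seteqP; split => w /=.
  by move=> /rowP fa i _ /=; rewrite -floor_eq -(fa i) mxE.
by move=> h; apply/rowP => i; rewrite mxE; apply/eqP; rewrite floor_eq; apply: h.
Qed.

Lemma measurable_fun_row (f : T -> borelRV R d) :
  (forall i, measurable_fun setT (fun w => (f w : 'rV_d) ord0 i)) ->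
  measurable_fun setT f.
Proof.
by move=> mf; apply: measurable_fun_cells => n a; exact: measurable_preimage_cell.
Qed.

End MeasurabilityRV.

Lemma continuous_measurable_rV (R : realType) (d : nat) (f : 'rV[R]_d -> R) :
  continuous f -> measurable_fun setT (f : borelRV R d -> R).
Proof.
move=> /continuousP cf; apply: (measurability _ (RGenOpens.measurableE R)).
move=> _ [_ [a [b ->]] <-]; rewrite setTI; apply: sub_sigma_algebra.
by apply: cf; apply: interval_open.
Qed.

Lemma measurable_coord (R : realType) (d : nat) (i : 'I_d) :
  measurable_fun setT (fun x : borelRV R d => (x : 'rV[R]_d) ord0 i).
Proof. by apply: continuous_measurable_rV => x; exact: coord_continuous. Qed.

Lemma measurable_cell (R : realType) (d : nat) n a :
  measurable (cell n a : set (borelRV R d)).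
Proof. exact: (measurable_preimage_cell (f := id) _ _ (@measurable_coord R d)). Qed.

(** * Volume as a measure *)

(** The image measure, with the measurability proof as an explicit argument. *)
Definition image_measure d d' (T1 : measurableType d) (T2 : measurableType d')
    (R : realType) (m : {measure set T1 -> \bar R}) (f : T1 -> T2)
    (mf : measurable_fun setT f) : {measure set T2 -> \bar R}.
Proof. by refine (pushforward m f : {measure set T2 -> \bar R}). Defined.

Section AffineLine.
Context (R : realType).
Local Notation mu := (@lebesgue_measure R).

Lemma measurable_affine (r a : R) :
  measurable_fun setT (fun x : measurableTypeR R => r * x + a : measurableTypeR R).
Proof. by apply: measurable_funD => //; apply: measurable_funM. Qed.

(** Both sides are measures in A that agree on half-open intervals. *)
Lemma lebesgue_affine (r a : R) (A : set (measurableTypeR R)) :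
  0 < r -> measurable A ->
  (r%:E * mu [set x | A (r * x + a)%R] = mu A)%E.
Proof.
move=> r0 mA; apply/esym.
pose m' := mscale (NngNum (ltW r0)) (image_measure mu (measurable_affine r a)).
apply: (@lebesgue_measure_unique R m') => // _ [[x y] _ <-] /=.
rewrite /m' /mscale /= /pushforward /=.
rewrite (_ : _ @^-1` _ = `](x - a) / r, (y - a) / r]%classic); last first.
  apply/seteqP; split => z /=; rewrite !in_itv /= ltr_pdivrMr// ler_pdivlMr//;
  by rewrite (mulrC z) ltrBlDr lerBrDr.
rewrite !lebesgue_measure_itv /= !lte_fin ltr_pdivrMr// divfK ?gt_eqF//.
rewrite ltrD2r; case: ifPn => _; last by rewrite mule0.
by rewrite -EFinM -mulrBl; congr EFin; rewrite mulrC mulfVK ?gt_eqF//; lra.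
Qed.

Lemma integral_affine (r a : R) (F : R -> \bar R) :
  0 < r -> measurable_fun setT F -> (forall x, 0 <= F x)%E ->
  (r%:E * \int[mu]_x F (r * x + a)%R = \int[mu]_x F x)%E.
Proof.
move=> r0 mF F0.
pose m' := mscale (NngNum (ltW r0)) (image_measure mu (measurable_affine r a)).
transitivity (\int[m']_x F x)%E; last first.
  apply: eq_measure_integral => A mA _.
  exact: lebesgue_affine.
rewrite ge0_integral_mscale //= ge0_integral_pushforward //=.
exact: measurable_affine.
Qed.

End AffineLine.

Section VolumeBox.
Context (R : realType).

Definition box (d : nat) (M : R) : set 'rV[R]_d :=
  [set x | forall i, `|x ord0 i| <= M].

Lemma box_row_mx d M (x : R) (y : 'rV[R]_d) :
  box M (row_mx (x%:M : 'rV_1) y) <-> `|x| <= M /\ box M y.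
Proof.
split=> [b|[xM yM] i].
  split=> [|i]; first by have := b (lshift d ord0); rewrite row_mxEl mxE eqxx mulr1n.
  by have := b (rshift 1 i); rewrite row_mxEr.
rewrite mxE; case: fintype.split => j; last exact: yM.
by rewrite (ord1 j) mxE eqxx mulr1n.
Qed.

Lemma vol_box d (M : R) : 0 <= M -> vol (box M : set 'rV[R]_d) = ((2 * M) ^+ d)%:E.
Proof.
move=> M0; elim: d => [|d IH] /=.
  by rewrite indicE expr0 mem_set // => -[].
transitivity (\int[@lebesgue_measure R]_x (((2 * M) ^+ d)%:E * (\1_`[- M, M] x)%:E))%E.
  apply: eq_integral => x _; rewrite indicE.
  have [xM|xM] := boolP (x \in _); rewrite /= ?mule1 ?mule0.
    rewrite -IH; congr vol; apply/seteqP; split => y /=.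
      by move/box_row_mx => [].
    by move=> ?; apply/box_row_mx; split => //; move: xM; rewrite inE /= in_itv /= ler_norml.
  have -> : [set y | box M (row_mx (x%:M : 'rV_1) y)] = set0 :> set 'rV_d.
    apply/seteqP; split => y //= /box_row_mx[+ _].
    by rewrite ler_norml => xM'; move: xM; rewrite notin_setE /= in_itv /= xM'.
  elim: (d) => [|k IHk] /=; first by rewrite indicE in_set0.
  by under eq_integral do rewrite IHk; rewrite integral0.
rewrite ge0_integralZl_EFin //; last first.
- by rewrite exprn_ge0// mulr_ge0.
- exact/measurable_EFinP.
rewrite integral_indic // setIT /= lebesgue_measure_itv /= lte_fin.
case: ltP => h; first by rewrite -EFinM; congr EFin; rewrite exprSr; congr *%R; lra.
have -> : M = 0 by lra.
by rewrite mule0 mulr0 expr0n.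
Qed.

Lemma measurable_box d M : measurable (box M : set (borelRV R d)).
Proof.
rewrite (_ : box M = \bigcap_(i in [set: 'I_d])
  ((fun x : borelRV R d => (x : 'rV_d) ord0 i) @^-1` `[- M, M])).
  apply: fin_bigcap_measurable => // i _.
  by rewrite -[X in measurable X]setTI; apply: measurable_coord.
apply/seteqP; split => x /= h i; last by have := h i I; rewrite /= in_itv /= ler_norml.
by move=> _ /=; rewrite in_itv /= -ler_norml.
Qed.

Lemma box_cover d : \bigcup_n (box n%:R : set 'rV[R]_d) = setT.
Proof.
apply/seteqP; split => // x _.
exists (Num.truncn `|x|).+1 => // i; apply/ltW/(le_lt_trans _ (truncnS_gt _)).
rewrite [leRHS]mx_normrE; apply: (le_trans _ (le_bigmax _ _ (ord0, i))) => //=.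
Qed.

End VolumeBox.

Section VolumeMeasure.
Context (R : realType).

Lemma measurable_row_mx d : measurable_fun setT
  (fun p : measurableTypeR R * borelRV R d =>
    row_mx (p.1%:M : 'rV[R]_1) (p.2 : 'rV[R]_d) : borelRV R d.+1).
Proof.
apply: (@measurable_fun_row R d.+1) => i.
rewrite -(@splitK 1 d i); case: (fintype.split _) => j /=.
  apply: (eq_measurable_fun fst) => [p _|//].
  by rewrite [RHS](@row_mxEl _ 1 1 d) mxE (ord1 j) eqxx mulr1n.
apply: (eq_measurable_fun (fun p : measurableTypeR R * borelRV R d => (p.2 : 'rV[R]_d) ord0 j)) => [p _|].
  by rewrite [RHS](@row_mxEr _ 1 1 d).
by apply: (measurableT_comp (measurable_coord _)).
Qed.

(** The recursive clause of [vol] is the definition of a product measure, carried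
    over to row vectors by concatenation; boxes witness sigma-finiteness. *)
Lemma volume_measure_subdef d :
  {m : {sigma_finite_measure set (borelRV R d) -> \bar R} | forall A, m A = vol A}.
Proof.
apply: cid; elim: d => [|d [m mE]].
  by exists (dirac (0 : borelRV R 0)).
pose m' := image_measure (@lebesgue_measure R \x m)%E (@measurable_row_mx d).
have m'E A : m' A = vol A.
  rewrite /m' /= /pushforward /= /product_measure1; apply: eq_integral => x _ /=.
  by rewrite mE; congr vol; apply/funext => y; rewrite /xsection /= propeqE; split; rewrite inE.
have sm' : sigma_finite setT m'.
  exists (fun n => box n%:R) => [|n]; first by rewrite box_cover.
  split; first exact: measurable_box.
  by rewrite m'E vol_box// ltry.
pose sM := Measure_isSigmaFinite.Build _ _ _ m' sm'.
pose m'' : {sigma_finite_measure set (borelRV R d.+1) -> \bar R} := HB.pack (Measure.sort m') (Measure.class m') sM.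
by exists m'' => A; rewrite -m'E.
Qed.

Definition volm d := sval (volume_measure_subdef d).

Lemma volmE d A : volm d A = vol A.
Proof. exact: (svalP (volume_measure_subdef d)). Qed.

Lemma measurable_preimage_row_mx d (A : set (borelRV R d.+1)) : measurable A ->
  measurable ((fun p : measurableTypeR R * borelRV R d =>
    row_mx (p.1%:M : 'rV[R]_1) (p.2 : 'rV[R]_d) : borelRV R d.+1) @^-1` A).
Proof. by move=> mA; rewrite -[X in measurable X]setTI; apply: measurable_row_mx. Qed.

Lemma measurable_section d (A : set (borelRV R d.+1)) (x : R) : measurable A ->
  measurable [set y : borelRV R d | A (row_mx (x%:M : 'rV_1) (y : 'rV_d))].
Proof.
move=> /measurable_preimage_row_mx /(measurable_xsection x); congr (measurable _).
by apply/funext => y; rewrite /xsection /= propeqE; split; rewrite inE.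
Qed.

Lemma measurable_vol_section d (A : set (borelRV R d.+1)) : measurable A ->
  measurable_fun setT
    (fun x : R => vol [set y : 'rV[R]_d | A (row_mx (x%:M : 'rV_1) y)]).
Proof.
move=> /measurable_preimage_row_mx mA.
have := measurable_fun_xsection (volm d) mA.
apply: eq_measurable_fun => x _ /=; rewrite volmE; congr vol.
by apply/funext => y; rewrite /xsection /= propeqE; split; rewrite inE.
Qed.

Lemma measurable_affine_rV d (r : R) (v : 'rV[R]_d) :
  measurable_fun setT (fun y : borelRV R d => (r *: (y : 'rV_d) + v) : borelRV R d).
Proof.
apply: measurable_fun_row => i.
apply: (eq_measurable_fun (fun y : borelRV R d => r * (y : 'rV_d) ord0 i + v ord0 i)).
  by move=> y _; rewrite !mxE.
apply: measurable_funD => //; apply: measurable_funM => //; exact: measurable_coord.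
Qed.

Lemma affine_row_mx d (r x : R) (y : 'rV[R]_d) (v : 'rV[R]_d.+1) :
  r *: (row_mx (x%:M : 'rV_1) y : 'rV_d.+1) + v =
  row_mx ((r * x + v ord0 ord0)%:M : 'rV_1) (r *: y + @rsubmx _ 1 1 d v).
Proof.
rewrite -[v in LHS](@hsubmxK _ 1 1 d) [X in X + _](@scale_row_mx _ 1 1 d).
rewrite [LHS](@add_row_mx _ 1 1 d); congr (@row_mx _ 1 1 d _ _).
apply/rowP => i; rewrite (ord1 i) !mxE /= !mulr1n; congr (_ + v _ _).
exact/val_inj.
Qed.

(** Peeling off the first coordinate turns the affine invariance of Lebesgue
    measure on the line into that of volume. *)
Lemma vol_affine d (r : R) (v : 'rV[R]_d) (A : set (borelRV R d)) :
  0 < r -> measurable A ->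
  ((r ^+ d)%:E * vol [set y : 'rV[R]_d | A (r *: y + v)%R] = vol A)%E.
Proof.
move=> r0; elim: d v A => [|d IH] v A mA /=.
  rewrite expr0 mul1e (_ : [set y | _] = A) //.
  by apply/funext => y /=; congr (A _); rewrite [LHS]thinmx0 [RHS]thinmx0.
pose F (x : R) := vol [set y : 'rV[R]_d | A (row_mx (x%:M : 'rV_1) y)].
have mF : measurable_fun setT F by exact: measurable_vol_section.
have F0 x : (0 <= F x)%E by rewrite /F -volmE measure_ge0.
rewrite -/(F _) -[RHS](integral_affine (v ord0 ord0) r0 mF F0).
rewrite exprS EFinM -muleA; congr (_ * _)%E.
rewrite -ge0_integralZl_EFin ?exprn_ge0 ?ltW//.
- apply: eq_integral => x _ /=.
  have mS : measurable [set y : borelRV R d |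
      A (row_mx ((r * x + v ord0 ord0)%:M : 'rV_1) y)].
    exact: measurable_section.
  rewrite /F -(IH (@rsubmx _ 1 1 d v) _ mS); congr (_ * vol _)%E.
  by apply/funext => y /=; rewrite affine_row_mx.
- by move=> x _; rewrite -volmE measure_ge0.
- pose A' := (fun z : borelRV R d.+1 => (r *: (z : 'rV_d.+1) + v) : borelRV R d.+1) @^-1` A.
  apply: (@measurable_vol_section d A').
  by rewrite -[X in measurable X]setTI; apply: measurable_affine_rV.
Qed.

End VolumeMeasure.

(** * Volumes of Euclidean balls and radial integration *)

Lemma ge0_integral_mrestr d (T : measurableType d) (R : realType)
    (mu : {measure set T -> \bar R}) (D : set T) (mD : measurable D)
    (f : T -> \bar R) :
  measurable_fun setT f -> (forall x, 0 <= f x)%E ->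
  (\int[mrestr mu mD]_x f x = \int[mu]_(x in D) f x)%E.
Proof.
move=> mf f0.
rewrite [LHS](@ge0_negligible_integral _ _ _ _ _ (~` D)) //.
- rewrite setDE setCK setTI; apply: eq_measure_integral => A mA AD.
  by rewrite /mrestr; congr (mu _); apply/setIidPl.
- exact: measurableC.
- by rewrite /= /mrestr setICl measure0.
Qed.

Section EuclideanNorm.
Context (R : realType) (d : nat).
Implicit Types x y : 'rV[R]_d.

Lemma enorm_ge0 x : 0 <= enorm x. Proof. exact: sqrtr_ge0. Qed.

Lemma enormZ r x : 0 <= r -> enorm (r *: x) = r * enorm x.
Proof.
move=> r0; rewrite /enorm; under eq_bigr do rewrite mxE exprMn.
by rewrite -mulr_sumr sqrtrM ?sqr_ge0// sqrtr_sqr ger0_norm.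
Qed.

Lemma enormC x y : enorm (x - y) = enorm (y - x).
Proof. by rewrite /enorm; under eq_bigr do rewrite !mxE -sqrrN opprB; under [in RHS]eq_bigr do rewrite !mxE. Qed.

Lemma coord_le_enorm x i : `|x ord0 i| <= enorm x.
Proof.
rewrite -sqrtr_sqr ler_wsqrtr// (bigD1 i)//= lerDl sumr_ge0// => j _.
exact: sqr_ge0.
Qed.

Lemma measurable_enorm : measurable_fun setT (fun x : borelRV R d => enorm (x : 'rV[R]_d)).
Proof.
have mS : measurable_fun setT
    (fun x : borelRV R d => \sum_(i < d) (x : 'rV[R]_d) ord0 i ^+ 2).
  by apply: measurable_sum => i; apply: measurable_funX; exact: measurable_coord.
exact: (measurableT_comp (continuous_measurable_fun (@sqrt_continuous R)) mS).
Qed.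

Lemma measurable_fun_subrV (dT : measure_display) (T : measurableType dT) (f g : T -> borelRV R d) :
  measurable_fun setT f -> measurable_fun setT g ->
  measurable_fun setT (fun w => ((f w : 'rV[R]_d) - (g w : 'rV[R]_d)) : borelRV R d).
Proof.
move=> mf mg; apply: measurable_fun_row => i.
apply: (eq_measurable_fun (fun w => (f w : 'rV_d) ord0 i - (g w : 'rV_d) ord0 i)).
  by move=> w _; rewrite !mxE.
by apply: measurable_funB; apply: (measurableT_comp (measurable_coord _)).
Qed.

End EuclideanNorm.

Section BallVolume.
Context (R : realType) (d : nat).
Hypothesis d0 : (0 < d)%N.

Definition eball (r : R) : set 'rV[R]_d := [set x | enorm x <= r].

Lemma measurable_eball r : measurable (eball r : set (borelRV R d)).
Proof.
rewrite (_ : eball r = (fun x : borelRV R d => enorm (x : 'rV_d)) @^-1` `]-oo, r]).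
  by rewrite -[X in measurable X]setTI; apply: measurable_enorm.
by apply/seteqP; split => x /=; rewrite in_itv.
Qed.

Lemma eball_box r : eball r `<=` box r.
Proof. by move=> x xr i; apply: (le_trans (coord_le_enorm _ _)). Qed.

Lemma le_vol (A B : set (borelRV R d)) : measurable A -> measurable B ->
  A `<=` B -> (vol A <= vol B)%E.
Proof. by move=> mA mB AB; rewrite -!volmE le_measure// inE. Qed.

Lemma vol_ge0 (A : set (borelRV R d)) : (0 <= vol A)%E.
Proof. by rewrite -volmE measure_ge0. Qed.

Lemma kappaE : vol (eball 1) = (kappa R d)%:E.
Proof.
rewrite /kappa fineK // ge0_fin_numE ?vol_ge0//.
apply: (@le_lt_trans _ _ (vol (box 1 : set 'rV[R]_d))); last by rewrite vol_box// ltry.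
apply: le_vol; [exact: measurable_eball|exact: measurable_box|exact: eball_box].
Qed.

Lemma kappa_ge0 : 0 <= kappa R d.
Proof. by rewrite -lee_fin -kappaE vol_ge0. Qed.

Lemma vol_eball r : 0 <= r -> vol (eball r) = (kappa R d * r ^+ d)%:E.
Proof.
rewrite le_eqVlt => /orP[/eqP<-|r0].
  rewrite expr0n eqn0Ngt d0 mulr0; apply/eqP; rewrite eq_le vol_ge0 andbT.
  apply: (@le_trans _ _ (vol (box 0 : set 'rV[R]_d))).
    apply: le_vol; [exact: measurable_eball|exact: measurable_box|exact: eball_box].
  by rewrite vol_box// mulr0 expr0n eqn0Ngt d0.
have E : [set y | eball r (r *: y + 0)] = eball 1.
  apply/seteqP; split => x; rewrite /eball /= addr0 (enormZ _ (ltW r0)).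
    by move=> h; rewrite -(ler_pM2l r0) mulr1.
  by move=> h; rewrite -[X in _ <= X](mulr1 r) (ler_pM2l r0).
by rewrite -(vol_affine 0 r0 (measurable_eball r)) E kappaE -EFinM mulrC.
Qed.

(** The image of volume under [v |-> s * |v| ^ d] is uniform on the half line,
    because the volume of a ball is proportional to the d-th power of its radius. *)
Lemma vol_power_norm (s x : R) : 0 < s ->
  vol [set v : 'rV[R]_d | s * enorm v ^+ d <= x] =
  (kappa R d * (Num.max x 0 / s))%:E.
Proof.
move=> s0; case: (leP 0 x) => x0; last first.
  rewrite mul0r mulr0 (_ : [set v | _] = set0) -?volmE ?measure0//.
  apply/seteqP; split => v //= h2.
  have h1 : 0 <= s * enorm v ^+ d by rewrite mulr_ge0 ?exprn_ge0 ?enorm_ge0 ?ltW.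
  by have := le_lt_trans h2 x0; rewrite ltNge h1.
have xs : 0 <= x / s by rewrite divr_ge0// ltW.
have rK : ((x / s) `^ d%:R^-1) ^+ d = x / s.
  by rewrite -powR_mulrn ?powR_ge0// -powRrM mulVf ?powRr1// pnatr_eq0 -lt0n.
rewrite -[in RHS]rK -vol_eball ?powR_ge0//; congr vol; apply/funext => v.
rewrite /eball /= -[in RHS](@ler_pXn2r _ d) ?nnegrE ?powR_ge0 ?enorm_ge0// rK.
by rewrite ler_pdivlMr// mulrC.
Qed.

Lemma measurable_power_norm (s : R) :
  measurable_fun setT (fun v : borelRV R d => s * enorm (v : 'rV[R]_d) ^+ d : measurableTypeR R).
Proof. by apply: measurable_funM => //; apply: measurable_funX; exact: measurable_enorm. Qed.

(** [vol_power_norm] gives the equality on half-open intervals, which determine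
    the two measures. *)
Lemma radial_measure (s : R) (A : set (measurableTypeR R)) : 0 < s -> measurable A ->
  (s%:E * vol [set v : 'rV[R]_d | A (s * enorm v ^+ d)%R] =
   (kappa R d)%:E * lebesgue_measure (A `&` `[0%R, +oo[))%E.
Proof.
move=> s0 mA.
pose m1 : {measure set (measurableTypeR R) -> \bar R} := mscale (NngNum (ltW s0)) (image_measure (volm R d) (measurable_power_norm s)).
pose m2 : {measure set (measurableTypeR R) -> \bar R} := mscale (NngNum kappa_ge0)
  (mrestr (@lebesgue_measure R) (measurable_itv `[0, +oo[)).
have m1E B : m1 B = (s%:E * vol [set v : 'rV[R]_d | B (s * enorm v ^+ d)%R])%E.
  by rewrite -volmE.
have m2E B : m2 B = ((kappa R d)%:E * lebesgue_measure (B `&` `[0%R, +oo[))%E by [].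
rewrite -m1E -m2E.
have E x y : x <= y -> m1 `]x, y]%classic = (kappa R d * (Num.max y 0 - Num.max x 0))%:E.
  move=> xy; rewrite m1E.
  rewrite (_ : [set v | _] = [set v : 'rV[R]_d | s * enorm v ^+ d <= y] `\`
     [set v : 'rV[R]_d | s * enorm v ^+ d <= x]); last first.
    apply/seteqP; split => v /=; rewrite in_itv /= ltNge; first by move=> /andP[/negP ? ?].
    by move=> [-> /negP ->].
  have mS z : measurable [set v : borelRV R d | s * enorm (v : 'rV_d) ^+ d <= z].
    rewrite (_ : [set v | _] = (fun v : borelRV R d => s * enorm (v : 'rV[R]_d) ^+ d) @^-1` `]-oo, z]).
      by rewrite -[X in measurable X]setTI; apply: measurable_power_norm.
    by apply/seteqP; split => v /=; rewrite in_itv.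
  have Vfin z : (volm R d [set v : borelRV R d | s * enorm (v : 'rV_d) ^+ d <= z]%R < +oo)%E.
    by rewrite volmE vol_power_norm// ltry.
  have := measureD (mS y) (mS x) (Vfin y); rewrite setIidr; last first.
    by move=> v /= /le_trans; apply.
  rewrite /= !volmE !vol_power_norm// => ->; rewrite -EFinB -EFinM; congr EFin.
  by field; rewrite gt_eqF.
apply: (@measure_unique _ _ (measurableTypeR R) (@ocitv R) (fun n => `]-n%:R, n%:R]%classic)) => //.
- exact: ocitvI.
- by move=> i; exists (-i%:R, i%:R).
- apply/seteqP; split => // x _; exists (Num.truncn `|x|).+1 => //=.
  have := truncnS_gt `|x|; rewrite in_itv /= ltr_norml => /andP[-> /ltW].
  exact.
- move=> _ [[x y] _ <-] /=.
  case: (leP y x) => yx.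
    by rewrite set_itv_ge ?measure0//= bnd_simp -leNgt.
  rewrite E ?ltW// m2E EFinM; congr (_ * _)%E.
  case: (ltP x 0) => x0.
    case: (ltP y 0) => y0.
      rewrite subrr (_ : _ `&` _ = set0) ?measure0//.
      apply/seteqP; split => z //=; rewrite !in_itv /= andbT => -[/andP[_ zy] /le_trans /(_ zy)].
      by rewrite leNgt y0.
    rewrite (_ : _ `&` _ = `[0, y]%classic); last first.
      apply/seteqP; split => z /=; rewrite !in_itv /= ?andbT; first by move=> [/andP[_ ->] ->].
      by move=> /andP[z0 ->]; rewrite (lt_le_trans x0)// z0.
    rewrite lebesgue_measure_itv /= lte_fin; case: ltP => // h.
    by have -> : y = 0 by [apply/eqP; rewrite eq_le h y0]; rewrite subrr.
  rewrite (_ : _ `&` _ = `]x, y]%classic); last first.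
    apply/seteqP; split => z /=; rewrite !in_itv /= ?andbT; first by case.
    by move=> /andP[xz ->]; rewrite xz (le_trans x0)// ltW.
  by rewrite max_l ?(le_trans x0 (ltW yx))// lebesgue_measure_itv /= lte_fin yx.
- by move=> k; rewrite E ?ltry// lerNl (le_trans _ (ler0n _ _))// oppr_le0.
Qed.

Lemma radial_integral (s dl : R) (G : R -> \bar R) : 0 < s -> 0 <= dl ->
  measurable_fun setT G -> (forall u, 0 <= G u)%E ->
  (s%:E * \int[volm R d]_(v in eball dl) G (s * enorm (v : 'rV_d) ^+ d)%R =
   (kappa R d)%:E * \int[lebesgue_measure]_(u in `[0%R, (s * dl ^+ d)%R]) G u)%E.
Proof.
move=> s0 dl0 mG G0.
pose m1 : {measure set (measurableTypeR R) -> \bar R} := mscale (NngNum (ltW s0)) (image_measure (volm R d) (measurable_power_norm s)).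
pose m2 : {measure set (measurableTypeR R) -> \bar R} := mscale (NngNum kappa_ge0) (@lebesgue_measure R).
transitivity (\int[m1]_(u in `[0%R, (s * dl ^+ d)%R]) G u)%E.
  rewrite ge0_integral_mscale //=; last exact: measurable_funTS.
  rewrite ge0_integral_pushforward //; last 2 first.
  - exact: measurable_power_norm.
  - exact: measurable_funTS.
  congr (_ * integral _ _ _)%E; apply/funext => v; rewrite /= in_itv /=.
  rewrite (mulr_ge0 (ltW s0) (exprn_ge0 _ (enorm_ge0 _))) (ler_pM2l s0) /=.
  by rewrite (@ler_pXn2r _ d) ?nnegrE ?enorm_ge0.
transitivity (\int[m2]_(u in `[0%R, (s * dl ^+ d)%R]) G u)%E; last first.
  by rewrite ge0_integral_mscale //=; exact: measurable_funTS.
apply: eq_measure_integral => A mA AD.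
rewrite [LHS](_ : _ = (s%:E * vol [set v : 'rV[R]_d | A (s * enorm v ^+ d)%R])%E).
  rewrite radial_measure//= /mscale /=; congr (_ * lebesgue_measure _)%E.
  apply/setIidPl => u /AD /=; rewrite !in_itv /= andbT; by case/andP.
by rewrite -volmE.
Qed.

End BallVolume.

(** * Mean number of near pairs in a compact window *)

Section CompactWindow.
Context (R : realType) (d : nat) (W : set 'rV[R]_d).
Hypothesis Wcompact : compact W.

Lemma window_measurable : measurable (W : set (borelRV R d)).
Proof.
have cW : closed W by apply: compact_closed => //; exact: norm_hausdorff.
rewrite -[W]setCK; apply: measurableC; apply: sub_sigma_algebra.
exact: closed_openC.
Qed.

Lemma window_box : exists M : R, 0 <= M /\ W `<=` box M.
Proof.
have [M [_ hM]] := compact_bounded Wcompact.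
have M1 : M < `|M| + 1 by rewrite (le_lt_trans (ler_norm _))// ltrDl.
exists (`|M| + 1); split; first by rewrite addr_ge0.
move=> x Wx i; apply: le_trans (hM _ M1 _ Wx).
rewrite [leRHS]mx_normrE; exact: (le_trans _ (le_bigmax _ _ (ord0, i))).
Qed.

Lemma window_finite : (vol W < +oo)%E.
Proof.
have [M [M0 WM]] := window_box.
apply: (@le_lt_trans _ _ (vol (box M : set 'rV[R]_d))); last by rewrite vol_box// ltry.
apply: le_vol => //; [exact: window_measurable|exact: measurable_box].
Qed.

Definition neighborhood (r : R) : set 'rV[R]_d := \bigcup_(y in W) ball y r.

Lemma measurable_neighborhood r :
  measurable (neighborhood r : set (borelRV R d)).
Proof. by apply: sub_sigma_algebra; apply: bigcup_open => x _; exact: (@ball_open _ 'rV[R]_d). Qed.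

(** Being closed, W is the intersection of its neighbourhoods, which have finite
    volume. *)
Lemma neighborhood_excess (e : R) : 0 < e ->
  exists2 r, 0 < r & (vol (neighborhood r `\` W) <= e%:E)%E.
Proof.
move=> e0; have [M [M0 WM]] := window_box.
pose F n := neighborhood n.+1%:R^-1 `\` W.
have mF n : measurable (F n : set (borelRV R d)).
  by apply: measurableD; [exact: measurable_neighborhood|exact: window_measurable].
have F0 : \bigcap_n F n = set0.
  apply/seteqP; split => // x Fx; have [_ nWx] := Fx 0 I.
  have cW : closed W by apply: compact_closed => //; exact: norm_hausdorff.
  have [r /= r0 rW] : nbhs_ball x (~` W).
    by apply/nbhs_ballP; apply: open_nbhs_nbhs; split => //; exact: closed_openC.
  have [n _ nr] : \forall n \near \oo, n.+1%:R^-1 < r.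
    by apply: near_infty_natSinv_lt (PosNum r0).
  have [[y Wy yx] _] := Fx n I.
  apply: (rW y) => //; apply: ball_sym; apply: (le_ball _ yx).
  exact/ltW/nr/leqnn.
have ndF : {homo F : n m / (n <= m)%N >-> (m <= n)%O}.
  move=> n m nm; apply/subsetPset => x [[y Wy yx] nWx]; split => //.
  exists y => //; apply: le_ball yx.
  by rewrite lef_pV2 ?posrE// ler_nat ltnS.
have F0fin : (volm R d (F 0%N) < +oo)%E.
  rewrite volmE; apply: (@le_lt_trans _ _ (vol (box (M + 1) : set 'rV[R]_d))); last first.
    by rewrite vol_box ?ltry// addr_ge0.
  apply: le_vol; [exact: mF|exact: measurable_box|].
  move=> x [[y Wy [_ yx]] _] i.
  have := yx ord0 i; rewrite /ball /= invr1 => h.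
  rewrite -(subKr (y ord0 i) (x ord0 i)); apply: (le_trans (ler_normB _ _)).
  by rewrite lerD ?(WM _ Wy)// ltW.
have := @nonincreasing_cvg_mu _ _ _ (volm R d) F F0fin mF.
rewrite F0 measure0 => /(_ measurable0 ndF) /fine_cvgP[] [N _ Nfin].
move=> /cvgrPdist_le /(_ _ e0) [N' _ Ne].
exists (maxn N N').+1%:R^-1; first by rewrite invr_gt0.
have := Ne _ (leq_maxr N N'); rewrite /= sub0r normrN => h.
have := Nfin _ (leq_maxl N N'); rewrite /= => /fineK.
rewrite -volmE => <-; rewrite lee_fin; exact: le_trans (ler_norm _) h.
Qed.

End CompactWindow.

Section MeanNearPairs.
Context (R : realType) (d : nat).
Hypothesis d0 : (0 < d)%N.

Definition near (dl : R) (x y : 'rV[R]_d) : bool := enorm (x - y) <= dl.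

Lemma nearC dl x y : near dl x y = near dl y x.
Proof. by rewrite /near enormC. Qed.

Lemma measurable_dist :
  measurable_fun setT (fun p : borelRV R d * borelRV R d =>
    enorm ((p.1 : 'rV[R]_d) - (p.2 : 'rV[R]_d))).
Proof.
exact: (measurableT_comp (@measurable_enorm R d)
  (measurable_fun_subrV measurable_fst measurable_snd)).
Qed.

Lemma measurable_near dl :
  measurable_fun setT (fun p : borelRV R d * borelRV R d => near dl p.1 p.2).
Proof. by apply: measurable_fun_ler => //; exact: measurable_dist. Qed.

Lemma measurable_bool_EFin (dT : measure_display) (T : measurableType dT) (b : T -> bool) :
  measurable_fun setT b -> measurable_fun setT (fun w => (b w)%:R%:E : \bar R).
Proof.
move=> mb; apply/measurable_EFinP.
by apply: (measurableT_comp (f := fun c : bool => c%:R : R)).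
Qed.

(** The case of scale 1 of [vol_affine]. *)
Lemma integral_translate (v : 'rV[R]_d) (F : borelRV R d -> \bar R) :
  measurable_fun setT F -> (forall x, 0 <= F x)%E ->
  (\int[volm R d]_y F ((y : 'rV_d) - v)%R = \int[volm R d]_y F y)%E.
Proof.
move=> mF F0.
have E A : measurable A -> image_measure (volm R d) (measurable_affine_rV 1 (- v)) A = volm R d A.
  move=> mA; rewrite [LHS]volmE volmE -(vol_affine (- v) ltr01 mA) expr1n mul1e.
  by [].
transitivity (\int[image_measure (volm R d) (measurable_affine_rV 1 (- v))]_y F y)%E; last first.
  by apply: eq_measure_integral => A mA _; exact: E.
rewrite ge0_integral_pushforward //=; last exact: measurable_affine_rV.
by apply: eq_integral => y _ /=; rewrite scale1r.
Qed.

Definition radial_pairs (s dl : R) (G : R -> \bar R) (x y : 'rV[R]_d) : \bar R :=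
  ((near dl x y)%:R%:E * G (s * enorm (x - y) ^+ d)%R)%E.

Context (s dl : R) (G : R -> \bar R).
Hypotheses (s0 : 0 < s) (dl0 : 0 <= dl) (mG : measurable_fun setT G).
Hypothesis G0 : forall u, (0 <= G u)%E.
Local Notation K := (radial_pairs s dl G).

Lemma measurable_radial_pairs :
  measurable_fun setT (fun p : borelRV R d * borelRV R d => K p.1 p.2).
Proof.
apply: emeasurable_funM; first exact: (measurable_bool_EFin (measurable_near dl)).
have mN : measurable_fun setT (fun p : borelRV R d * borelRV R d =>
    s * enorm ((p.1 : 'rV[R]_d) - (p.2 : 'rV[R]_d)) ^+ d).
  by apply: measurable_funM => //; apply: measurable_funX; exact: measurable_dist.
exact: (measurableT_comp mG mN).
Qed.

Lemma radial_pairs_ge0 x y : (0 <= K x y)%E.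
Proof. by apply: mule_ge0 => //; rewrite lee_fin. Qed.

(** Centring at x, the integral depends on the second point only through its
    distance, to which the radial formula applies. *)
Lemma integral_radial_pairs x :
  (s%:E * \int[volm R d]_y K x y =
   (kappa R d)%:E * \int[lebesgue_measure]_(u in `[0%R, (s * dl ^+ d)%R]) G u)%E.
Proof.
rewrite -(radial_integral d0 s0 dl0 mG G0); congr (_ * _)%E.
pose F (v : borelRV R d) := ((enorm (v : 'rV_d) <= dl)%R%:R%:E * G (s * enorm (v : 'rV_d) ^+ d)%R)%E.
have mF : measurable_fun setT F.
  apply: emeasurable_funM.
    apply: measurable_bool_EFin; apply: measurable_fun_ler => //; exact: measurable_enorm.
  have mN : measurable_fun setT (fun v : borelRV R d => s * enorm (v : 'rV[R]_d) ^+ d).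
    exact: measurable_power_norm.
  exact: (measurableT_comp mG mN).
transitivity (\int[volm R d]_y F ((y : 'rV_d) - x)%R)%E.
  by apply: eq_integral => y _; rewrite /K /F /near enormC.
rewrite integral_translate //; last first.
  by move=> v; apply: mule_ge0 => //; rewrite lee_fin.
rewrite [RHS]integral_mkcond; apply: eq_integral => v _; rewrite patchE /F.
rewrite (_ : (v \in eball dl) = (enorm (v : 'rV_d) <= dl)); last by apply/idP/idP; rewrite inE.
by case: ifP => _; rewrite ?mul1e ?mul0e.
Qed.

End MeanNearPairs.

Section PairIntensity.
Context (R : realType) (d : nat) (W : set 'rV[R]_d).
Hypothesis d0 : (0 < d)%N.
Hypothesis mW : measurable (W : set (borelRV R d)).
Hypothesis Wfin : (vol W < +oo)%E.

(** Restricting the measure, rather than the domain of integration, to W makes it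
    finite, so that Fubini applies to its products. *)
Lemma window_measure_subdef : {nu : {finite_measure set (borelRV R d) -> \bar R} |
  forall A, nu A = vol (A `&` W)}.
Proof.
apply: cid; pose m : {measure set (borelRV R d) -> \bar R} := mrestr (volm R d) mW.
have mE A : m A = vol (A `&` W) by rewrite -volmE.
have fm : fin_num_fun m.
  move=> A mA; rewrite mE ge0_fin_numE ?vol_ge0//.
  apply: le_lt_trans Wfin; apply: le_vol => //.
  exact: measurableI.
pose fM := Measure_isFinite.Build _ _ _ m fm.
pose m' : {finite_measure set (borelRV R d) -> \bar R} :=
  HB.pack (Measure.sort m) (Measure.class m) fM.
by exists m' => A; rewrite -mE.
Qed.

Definition window_measure := sval window_measure_subdef.

Lemma window_measureE A : window_measure A = vol (A `&` W).
Proof. exact: (svalP window_measure_subdef). Qed.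

Lemma window_measureT : window_measure setT = (fine (vol W))%:E.
Proof. by rewrite window_measureE setTI fineK// ge0_fin_numE ?vol_ge0. Qed.

Lemma integral_window (f : borelRV R d -> \bar R) :
  measurable_fun setT f -> (forall x, 0 <= f x)%E ->
  (\int[window_measure]_x f x = \int[volm R d]_(x in W) f x)%E.
Proof.
move=> mf f0; rewrite -(ge0_integral_mrestr (volm R d) mW mf f0).
by apply: eq_measure_integral => A mA _; rewrite /= window_measureE -volmE.
Qed.

Lemma integral_near (dl : R) x : 0 <= dl ->
  (\int[volm R d]_y (near dl x y)%:R%:E = (kappa R d * dl ^+ d)%:E)%E.
Proof.
move=> dl0.
transitivity (1%:E * \int[volm R d]_y radial_pairs 1 dl (cst 1%E) x y)%E.
  by rewrite mul1e; apply: eq_integral => y _; rewrite /radial_pairs mule1.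
rewrite integral_radial_pairs // integral_cst //= lebesgue_measure_itv /= mul1r mul1e lte_fin.
case: ltP => h; first by rewrite sube0 EFinM.
have -> : dl ^+ d = 0 by apply/eqP; rewrite eq_le h exprn_ge0.
by rewrite mulr0 mule0.
Qed.

Lemma measurable_near1 (dl : R) x :
  measurable_fun setT (fun y : borelRV R d => (near dl x (y : 'rV_d))%:R%:E : \bar R).
Proof.
exact: (measurableT_comp (measurable_bool_EFin (measurable_near dl))
  (pair1_measurable (x : borelRV R d))).
Qed.

Lemma window_near_le (dl : R) x : 0 <= dl ->
  (\int[window_measure]_y (near dl x y)%:R%:E <= (kappa R d * dl ^+ d)%:E)%E.
Proof.
move=> dl0; rewrite -(integral_near x dl0).
have mN : measurable_fun setT (fun y : borelRV R d => (near dl x (y : 'rV_d))%:R%:E : \bar R).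
  exact: measurable_near1.
rewrite integral_window //; apply: ge0_subset_integral => //.
Qed.

Context (s dl : R) (G : R -> \bar R).
Hypotheses (s0 : 0 < s) (dl0 : 0 <= dl) (mG : measurable_fun setT G).
Hypothesis G0 : forall u, (0 <= G u)%E.
Local Notation K := (radial_pairs s dl G).
Local Notation nu := window_measure.
Let KI := ((kappa R d)%:E * \int[lebesgue_measure]_(u in `[0%R, (s * dl ^+ d)%R]) G u)%E.

Let sge0 : 0 <= s. Proof. exact: ltW. Qed.

Let mK : measurable_fun setT (fun p : borelRV R d * borelRV R d => K p.1 p.2).
Proof. exact: measurable_radial_pairs. Qed.

Let mKx x : measurable_fun setT (fun y : borelRV R d => K x y).
Proof. exact: (measurableT_comp mK (pair1_measurable (x : borelRV R d))). Qed.

Let K0 (x y : 'rV[R]_d) : (0 <= K x y)%E. Proof. exact: radial_pairs_ge0. Qed.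

Let mnuK : measurable_fun setT (fun x : borelRV R d => (\int[nu]_y K x y)%E).
Proof. by apply: (measurable_fun_fubini_tonelli_F _ mK) => -[x y]. Qed.

(** For each first point in W, the second point ranges over a subset of its ball. *)
Lemma pair_intensity_le :
  (s%:E * \int[nu]_x \int[nu]_y K x y <= (fine (vol W))%:E * KI)%E.
Proof.
have -> : ((fine (vol W))%:E * KI = \int[nu]_x KI)%E.
  by rewrite integral_cst //= window_measureT muleC.
rewrite -ge0_integralZl_EFin //; last first.
  by move=> x _; apply: integral_ge0.
apply: ge0_le_integral => //.
- by move=> x _; rewrite mule_ge0 ?lee_fin// integral_ge0.
- exact: measurable_funeM.
move=> x _; rewrite /KI -(integral_radial_pairs d0 s0 dl0 mG G0 x).
rewrite lee_pmul2l ?fin_numE ?lte_fin// integral_window //.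
exact: ge0_subset_integral.
Qed.

Hypothesis G1 : forall u, (G u <= 1)%E.

(** Only pairs with one point outside of W are lost when the second point is
    restricted to W. *)
Lemma pair_intensity_ge (U : set (borelRV R d)) : measurable U ->
  (forall x y, W x -> near dl x y -> U y) ->
  ((fine (vol W))%:E * KI <= s%:E * \int[nu]_x \int[nu]_y K x y +
     (s * (kappa R d * dl ^+ d))%:E * vol (U `\` W))%E.
Proof.
move=> mU WU; pose D := U `\` W.
have mD : measurable D by apply: measurableD.
pose N (x y : 'rV[R]_d) : \bar R := ((near dl x y)%:R%:E * (\1_D y)%:E)%E.
have mN : measurable_fun setT (fun p : borelRV R d * borelRV R d => N p.1 p.2).
  apply: emeasurable_funM; first exact: (measurable_bool_EFin (measurable_near dl)).
  have m1 : measurable_fun setT (\1_D : borelRV R d -> R) by exact: measurable_indic.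
  by apply/measurable_EFinP; exact: (measurableT_comp m1 measurable_snd).
have N0 x y : (0 <= N x y)%E by rewrite mule_ge0// lee_fin.
have mNx x : measurable_fun setT (fun y : borelRV R d => N x y).
  exact: (measurableT_comp mN (pair1_measurable (x : borelRV R d))).
have mIN : measurable_fun setT (fun x : borelRV R d => (\int[volm R d]_y N x y)%E).
  by apply: (measurable_fun_fubini_tonelli_F _ mN) => -[x y].
have stepx x : W x -> (KI <= s%:E * \int[nu]_y K x y + s%:E * \int[volm R d]_y N x y)%E.
  move=> Wx; rewrite /KI -(integral_radial_pairs d0 s0 dl0 mG G0 x).
  rewrite -muleDr ?lee_pmul2l ?fin_numE ?lte_fin//; last first.
    by rewrite ge0_adde_def// inE integral_ge0.
  have -> : (\int[volm R d]_y K x y =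
      \int[nu]_y K x y + \int[volm R d]_(y in ~` W) K x y)%E.
    rewrite integral_window // -(ge0_integral_setU _ mW (measurableC mW)) ?setUv //.
    by rewrite disj_set2E setICr eqxx.
  rewrite leeD2l// integral_mkcond.
  apply: ge0_le_integral => //.
  - by move=> y _; apply: erestrict_ge0 => ? _.
  - by apply/(measurable_restrictT _ _).1; [exact: measurableC|exact: measurable_funTS].
  move=> y _; rewrite patchE; case: ifPn => [|_]; last exact: N0.
  rewrite inE /= => nWy; rewrite /K /radial_pairs /N.
  case nr: (near dl x y); rewrite ?mul0e// !mul1e.
  by rewrite indicE mem_set ?G1//; split => //; exact: WU nr.
have VKI : ((fine (vol W))%:E * KI = \int[volm R d]_(x in W) KI)%E.
  by rewrite integral_cst//= volmE fineK 1?muleC// ge0_fin_numE ?vol_ge0.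
have KI0 : (0 <= KI)%E.
  by apply: mule_ge0; [rewrite lee_fin kappa_ge0|apply: integral_ge0].
rewrite VKI; apply: (@le_trans _ _ (\int[volm R d]_(x in W)
    (s%:E * \int[nu]_y K x y + s%:E * \int[volm R d]_y N x y))%E).
  apply: ge0_le_integral => //.
  - by apply: emeasurable_funD; apply: measurable_funTS; apply: measurable_funeM.
rewrite ge0_integralD //; last 4 first.
- by move=> x _; rewrite mule_ge0 ?lee_fin// integral_ge0.
- by apply: measurable_funTS; apply: measurable_funeM.
- by move=> x _; rewrite mule_ge0 ?lee_fin// integral_ge0.
- by apply: measurable_funTS; apply: measurable_funeM.
rewrite !ge0_integralZl_EFin //; last 4 first.
- by move=> x _; apply: integral_ge0.
- exact: measurable_funTS.
- by move=> x _; apply: integral_ge0.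
- exact: measurable_funTS.
rewrite -integral_window //; last by move=> x; apply: integral_ge0.
rewrite leeD2l// EFinM -muleA lee_pmul2l ?fin_numE ?lte_fin//.
apply: (@le_trans _ _ (\int[volm R d]_x \int[volm R d]_y N x y)%E).
  by apply: ge0_subset_integral => // x _; apply: integral_ge0.
rewrite (fubini_tonelli (fun p : borelRV R d * borelRV R d => N p.1 p.2)) //=.
have kd0 : 0 <= kappa R d * dl ^+ d by rewrite mulr_ge0 ?kappa_ge0 ?exprn_ge0.
have m1 : measurable_fun setT (fun y : borelRV R d => (\1_D y)%:E : \bar R).
  exact/measurable_EFinP.
have -> : ((kappa R d * dl ^+ d)%:E * vol D =
    \int[volm R d]_y ((kappa R d * dl ^+ d)%:E * (\1_D y)%:E))%E.
  by rewrite ge0_integralZl_EFin // integral_indic //= setIT volmE.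
apply: ge0_le_integral => //.
- by move=> y _; apply: integral_ge0.
- by apply: (measurable_fun_fubini_tonelli_G (fun p : borelRV R d * borelRV R d => N p.1 p.2)).
- exact: measurable_funeM.
move=> y _; under eq_integral do rewrite /N nearC.
rewrite ge0_integralZr //; last exact: measurable_near1.
by rewrite integral_near.
Qed.

End PairIntensity.

(** * The space of finite configurations *)

(** An alias of the type of finite sets, to carry the sigma-algebra below. *)
Definition config (R : realType) (d : nat) : Type := {fset 'rV[R]_d}.
HB.instance Definition _ R d := Choice.on (config R d).
HB.instance Definition _ R d := isPointed.Build (config R d) fset0.

Section ConfigSpace.
Context (R : realType) (d : nat).
Implicit Types (eta : config R d) (s : seq 'rV[int]_d).

(** The cells of mesh 2^-n of the points, with multiplicity. They are listed in the
    enumeration order of the finite set, hence the permutation equivalence below. *)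
Definition profile n eta : seq 'rV[int]_d :=
  [seq code n x | x <- (eta : {fset 'rV[R]_d})].

Definition profile_event n s : set (config R d) :=
  [set eta | perm_eq (profile n eta) s].

Definition profile_events : set (set (config R d)) :=
  [set A | exists n s, A = profile_event n s].

End ConfigSpace.

(** The sigma-algebra generated by the cell counts of all dyadic grids. *)
Notation configSpace R d := (g_sigma_algebraType (@profile_events R d)).

Section PointRemoval.
Context (R : realType) (d : nat).
Implicit Types (eta : configSpace R d) (s : seq 'rV[int]_d).
Local Notation E := (borelRV R d * configSpace R d)%type.

Lemma measurable_profile_event n s :
  measurable (profile_event n s : set (configSpace R d)).
Proof. by apply: sub_sigma_algebra; exists n, s. Qed.

Definition pointed_event n a s : set E :=
  [set p | code n (p.1 : 'rV_d) = a /\ profile_event n s (p.2 : config R d)].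

(** The empty set makes this family closed under intersection. *)
Definition pointed_events : set (set E) :=
  [set A | A = set0 \/ exists n a s, A = pointed_event n a s].

Lemma measurable_pointed_event n a s : measurable (pointed_event n a s).
Proof.
rewrite (_ : pointed_event _ _ _ = cell n a `*` profile_event n s) //.
by apply: measurableX; [exact: measurable_cell|exact: measurable_profile_event].
Qed.

(** A coarse code or profile is a function of a finer one, so a finer event lies in
    the coarse one or is disjoint from it. *)
Lemma pointed_eventI n n' a a' s s' : (n <= n')%N ->
  pointed_events (pointed_event n a s `&` pointed_event n' a' s').
Proof.
move=> /(@code_coarsen R d)[g gE].
have gP eta : profile n eta = map g (profile n' eta).
  by rewrite /profile -map_comp; apply: eq_map => x /=.
have [/andP[/eqP ga gs]|h] := boolP ((g a' == a) && perm_eq (map g s') s).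
  right; exists n', a', s'; apply/seteqP; split => [p [_ //]|p [pa ps]].
  do 2!split => //; first by rewrite gE pa.
  by rewrite /profile_event /= gP (perm_trans _ gs)// perm_map.
left; apply/seteqP; split => // p [[pa ps] [pa' ps']].
move/negP: h; apply; rewrite -pa' -gE pa eqxx /= perm_sym.
by rewrite (perm_trans _ (perm_map g ps'))// -gP perm_sym.
Qed.

Lemma setI_closed_pointed_events : setI_closed pointed_events.
Proof.
move=> A B [->|[n [a [s ->]]]] [->|[n' [a' [s' ->]]]]; rewrite ?set0I ?setI0;
  try by left.
have [nn|/ltnW nn] := leqP n n'; first exact: pointed_eventI.
by rewrite setIC; exact: pointed_eventI.
Qed.

Lemma pointed_events_generate : @measurable _ E = <<s pointed_events >>.
Proof.
apply/seteqP; split; last first.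
  apply: smallest_sub; first exact: sigma_algebra_measurable.
  by move=> A [->|[n [a [s ->]]]]; [exact: measurable0|exact: measurable_pointed_event].
pose T := g_sigma_algebraType pointed_events.
have mgen n a s : measurable (pointed_event n a s : set T).
  by apply: sub_sigma_algebra; right; exists n, a, s.
have m1 : measurable_fun setT (fst : T -> borelRV R d).
  apply: measurable_fun_cells => n a.
  rewrite (_ : _ @^-1` _ = \bigcup_s pointed_event n a s).
    exact: countable_bigcupT_measurable.
  apply/seteqP; split => [p pa|p [s _ [pa _]] //].
  by exists (profile n p.2) => //; split => //; exact: perm_refl.
have m2 : measurable_fun setT (snd : T -> configSpace R d).
  apply: (@measurability _ _ T (configSpace R d) setT snd (@profile_events R d)) => //.
  move=> _ [_ [n [s ->]] <-]; rewrite setTI.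
  rewrite (_ : _ @^-1` _ = \bigcup_a pointed_event n a s).
    exact: countable_bigcupT_measurable.
  apply/seteqP; split => [p ps|p [a _ [_ ps]] //].
  by exists (code n (p.1 : 'rV_d)).
move=> A mA; have := measurable_fun_pair m1 m2 measurableT mA.
by rewrite setTI (_ : _ @^-1` _ = A) //; apply/funext => -[x y].
Qed.

Lemma profileD1 n (eta : {fset 'rV[R]_d}) y : y \in eta ->
  perm_eq (profile n eta) (code n y :: profile n (eta `\ y)%fset).
Proof.
move=> yeta; rewrite /profile -map_cons; apply: perm_map.
apply: uniq_perm; [exact: fset_uniq| |].
  by rewrite /= fset_uniq !inE eqxx.
by move=> z; rewrite in_cons !inE; case: eqVneq => // ->.
Qed.

(** The point measure on pairs (deleted point, remaining configuration). *)
Definition removal eta : {measure set E -> \bar R} :=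
  msum (fun i => dirac ((nth 0 (eta : {fset 'rV[R]_d}) i,
      ((eta : {fset 'rV[R]_d}) `\ nth 0 (eta : {fset 'rV[R]_d}) i)%fset) : E))
    (size (eta : {fset 'rV[R]_d})).

Lemma removalE eta (S : set E) :
  removal eta S = (\sum_(y <- (eta : {fset 'rV[R]_d}))
    (\1_S ((y, ((eta : {fset 'rV[R]_d}) `\ y)%fset) : E))%:E)%E.
Proof. by rewrite /removal /= /msum (big_nth 0) big_mkord. Qed.

Lemma integral_removal eta (f : E -> \bar R) :
  measurable_fun setT f -> (forall p, 0 <= f p)%E ->
  (\int[removal eta]_p f p = \sum_(y <- (eta : {fset 'rV[R]_d}))
     f (y, ((eta : {fset 'rV[R]_d}) `\ y)%fset))%E.
Proof.
move=> mf f0; rewrite ge0_integral_measure_sum // (big_nth 0) big_mkord.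
by apply: eq_bigr => i _; rewrite integral_dirac// diracT mul1e.
Qed.

Lemma removalT eta : removal eta setT = (size (eta : {fset 'rV[R]_d}))%:R%:E.
Proof.
rewrite removalE; under eq_bigr do rewrite indicT.
by rewrite sumEFin big_const_seq count_predT; congr EFin; elim: (size _) => //= n ->; rewrite mulrS.
Qed.

(** If the configuration has profile a :: s then each of its points in the cell a
    leaves the profile s behind; otherwise no point does. *)
Lemma removal_pointed_event eta n a s :
  removal eta (pointed_event n a s) =
  ((count_mem a (a :: s))%:R * (\1_(profile_event n (a :: s)) eta))%:E.
Proof.
rewrite removalE sumEFin; congr EFin.
have [h|h] := boolP (perm_eq (profile n eta) (a :: s)); last first.
  rewrite indicE memNset ?mulr0; last by apply/negP.
  rewrite big_seq big1 // => y yeta; rewrite indicE memNset // => -[/= ya ys].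
  move/negP: h; apply; apply: (perm_trans (profileD1 n yeta)).
  by rewrite ya perm_cons.
rewrite [in RHS]indicE mem_set // mulr1 -(permP h) /profile count_map -sum1_count.
rewrite natr_sum [in RHS]big_mkcond /= big_seq [in RHS]big_seq.
apply: eq_bigr => y yeta; rewrite indicE.
case: eqVneq => [ya|ya]; last by rewrite memNset // => -[/= /eqP]; rewrite (negbTE ya).
rewrite mem_set //; split => //=; rewrite /profile_event /=.
have := profileD1 n yeta; rewrite ya perm_sym => h'.
by rewrite -(perm_cons a) (perm_trans h').
Qed.

Lemma measurable_config_size :
  measurable_fun setT (fun eta => size (eta : {fset 'rV[R]_d})).
Proof.
move=> _ B _; rewrite setTI.
rewrite (_ : _ @^-1` B = \bigcup_s (if size s \in B then profile_event 0 s else set0)).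
  apply: countable_bigcupT_measurable => // s.
  by case: ifP => _ //; exact: measurable_profile_event.
apply/seteqP; split => [eta /= Beta|eta [s _]].
  exists (profile 0 eta) => //; rewrite size_map mem_set//; exact: perm_refl.
case: ifPn => //; rewrite inE => Bs /perm_size.
by rewrite size_map /= => ->.
Qed.

(** On pointed events this is [removal_pointed_event]; the sets with this property
    form a Dynkin system. *)
Lemma measurable_removal (S : set E) : measurable S ->
  measurable_fun setT (fun eta => removal eta S).
Proof.
move=> mS; rewrite pointed_events_generate in mS.
have mT : measurable_fun setT (fun eta => removal eta setT).
  under eq_fun do rewrite removalT.
  apply/measurable_EFinP; apply: (measurableT_comp (f := fun n : nat => n%:R : R)) => //.
  exact: measurable_config_size.
have rfin eta A : measurable A -> removal eta A \is a fin_num.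
  by move=> mA; rewrite removalE sumEFin.
apply: (dynkin_induction pointed_events_generate setI_closed_pointed_events
   (P := fun S => measurable_fun setT (fun eta => removal eta S))) mS => //.
- move=> A [->|[n [a [s ->]]]].
    by under eq_fun do rewrite measure0; exact: measurable_cst.
  under eq_fun do rewrite removal_pointed_event.
  apply/measurable_EFinP; apply: measurable_funM => //.
  by apply: measurable_indic; exact: measurable_profile_event.
- move=> A mA pA; rewrite (_ : (fun eta => _) = (fun eta => removal eta setT - removal eta A)%E).
    exact: emeasurable_funB.
  by apply/funext => eta; rewrite -setTD measureD ?setTI// ltey_eq rfin.
- move=> F mF tF pF.
  rewrite (_ : (fun eta => _) = (fun eta => \sum_(0 <= k <oo) removal eta (F k))%E).
    by apply: ge0_emeasurable_sum => // k eta _ _; exact: measure_ge0.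
  apply/funext => eta; rewrite measure_bigcup//.
  by apply: eq_eseriesl => k; rewrite mem_set.
Qed.

End PointRemoval.

(** Splitting according to the number of points exhibits [removal] as an s-finite
    kernel, so that sums over the points of a configuration depend measurably on
    the configuration. *)
Section RemovalKernel.
Context (R : realType) (d : nat) (dZ : measure_display) (Z : measurableType dZ)
  (g : Z -> configSpace R d).
Local Notation E := (borelRV R d * configSpace R d)%type.

Definition removal_slice (mg : measurable_fun setT g) n (z : Z) :
    {measure set E -> \bar R} :=
  if size (g z : {fset 'rV[R]_d}) == n then removal (g z) else mzero.

Let measurable_removal_slice mg n (U : set E) : measurable U ->
  measurable_fun setT (removal_slice mg n ^~ U).
Proof.
move=> mU; rewrite (_ : (fun z => _) = fun z =>
  if size (g z : {fset 'rV[R]_d}) == n then removal (g z) U else 0%E); last first.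
  by apply/funext => z; rewrite /removal_slice; case: ifP.
apply: measurable_fun_ifT => //.
  apply: (measurableT_comp (f := fun k : nat => k == n)) => //.
  exact: (measurableT_comp (@measurable_config_size R d) mg).
exact: (measurableT_comp (measurable_removal mU) mg).
Qed.

HB.instance Definition _ mg n :=
  isKernel.Build _ _ _ _ _ (removal_slice mg n) (@measurable_removal_slice mg n).

Lemma removal_slice_uub mg n : measure_fam_uub (removal_slice mg n).
Proof.
exists n.+1%:R => z; rewrite /removal_slice; case: ifP => [/eqP zn|_].
  by rewrite removalT zn lte_fin ltr_nat.
by rewrite /= /mzero.
Qed.

Definition removal_kernel (mg : measurable_fun setT g) (z : Z) :
  {measure set E -> \bar R} := removal (g z).

Let measurable_removal_kernel mg (U : set E) : measurable U ->
  measurable_fun setT (removal_kernel mg ^~ U).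
Proof. by move=> mU; exact: (measurableT_comp (measurable_removal mU) mg). Qed.

HB.instance Definition _ mg :=
  isKernel.Build _ _ _ _ _ (removal_kernel mg) (@measurable_removal_kernel mg).

Let removal_kernel_sfinite mg : exists2 s : (R.-ker Z ~> E)^nat,
  forall n, measure_fam_uub (s n) &
  forall z U, measurable U -> removal_kernel mg z U = kseries s z U.
Proof.
exists (fun n => removal_slice mg n : R.-ker Z ~> E) => [n|z U mU].
  exact: removal_slice_uub.
rewrite /kseries /= /mseries.
set n := size (g z : {fset 'rV[R]_d}).
rewrite (nneseries_split _ n.+1)// big_mkord big_ord_recr /= big1 ?add0e; last first.
  move=> i _; rewrite /removal_slice -/n; case: eqP => //= ni.
  by have := ltn_ord i; rewrite -ni ltnn.
rewrite {1}/removal_slice -/n eqxx eseries0 ?adde0// => k nk _.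
by rewrite /removal_slice -/n; case: eqP => // nk'; rewrite nk' add0n ltnn in nk.
Qed.

HB.instance Definition _ mg :=
  @isSFiniteKernel_subdef.Build _ _ _ _ _ (removal_kernel mg) (@removal_kernel_sfinite mg).

Lemma measurable_sum_removal (u : Z * E -> \bar R) : measurable_fun setT g ->
  measurable_fun setT u -> (forall p, 0 <= u p)%E ->
  measurable_fun setT (fun z => \sum_(y <- (g z : {fset 'rV[R]_d}))
    u (z, (y, ((g z : {fset 'rV[R]_d}) `\ y)%fset)))%E.
Proof.
move=> mg mu u0.
have := measurable_fun_integral_sfinite_kernel u (removal_kernel mg) u0 mu.
apply: eq_measurable_fun => z _; rewrite /removal_kernel integral_removal //.
exact: (measurableT_comp mu (pair1_measurable z)).
Qed.

End RemovalKernel.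

(** * The Mecke equation *)

Lemma poisson_law_set1 (R : realType) (r : R) (k : nat) : 0 <= r ->
  poisson_law r [set k] = (r ^+ k / k`!%:R * expR (- r))%:E.
Proof.
rewrite /poisson_law /poisson_prob le_eqVlt => /orP[/eqP<-|r0].
  rewrite ltxx diracE oppr0 expR0 mulr1; case: k => [|k].
    by rewrite mem_set// expr0 fact0 divr1.
  by rewrite memNset// expr0n mul0r.
by rewrite r0 esum_set1 ?lee_fin ?poisson_pmf_ge0// /poisson_pmf r0.
Qed.

(** This makes the profile of a configuration in W a finite vector of cell counts. *)
Lemma window_codes_finite (R : realType) (d : nat) (W : set 'rV[R]_d) (M : R) n :
  W `<=` box M -> finite_set (code n @` W).
Proof.
move=> WM; pose K := (Num.truncn (2 ^+ n * M)).+1.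
pose h (f : {ffun 'I_d -> 'I_(K + K).+1}) : 'rV[int]_d :=
  \row_i ((f i : nat)%:Z - K%:Z).
apply: (@sub_finite_set _ _ (h @` setT)); last exact/finite_image/finite_finset.
move=> _ [x Wx <-].
have xK i : - K%:Z <= code n x ord0 i <= K%:Z.
  have p0 : 0 < (2 : R) ^+ n by rewrite exprn_gt0.
  have := WM _ Wx i; rewrite -(ler_pM2l p0) -{1}(ger0_norm (ltW p0)) -normrM.
  have KM : 2 ^+ n * M < K%:R by exact: truncnS_gt.
  rewrite ler_norml => /andP[h1 h2]; rewrite mxE; apply/andP; split.
    by rewrite floor_ge_int rmorphN /= -pmulrn; lra.
  by apply/ltW; rewrite floor_lt_int -pmulrn; lra.
exists [ffun i => inord (`|(code n x ord0 i + K%:Z)%R|%N)] => //.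
apply/rowP => i; rewrite mxE ffunE inordK; last first.
  have := xK i; set z := code n x ord0 i; lia.
have := xK i; set z := code n x ord0 i; lia.
Qed.

Section PoissonConfig.
Context (R : realType) (d : nat) (W : set 'rV[R]_d).
Hypothesis mW : measurable (W : set (borelRV R d)).
Context (M : R) (WM : W `<=` box M).
Context (dT : measure_display) (T : measurableType dT) (P : probability T R)
  (t : R) (eta : T -> {fset 'rV[R]_d}).
Hypotheses (t0 : 0 < t) (Peta : poisson_process P W t eta).
Implicit Types (a : 'rV[int]_d) (s : seq 'rV[int]_d).

Let cells n : {fset 'rV[int]_d} := fset_set (code n @` W).

Let mem_cells n x : W x -> code n x \in cells n.
Proof.
move=> Wx; rewrite in_fset_set ?inE; first by exists x.
exact: window_codes_finite WM.
Qed.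

Let wcell n a : set (borelRV R d) := cell n a `&` W.

Let measurable_wcell n a : measurable (wcell n a).
Proof. by apply: measurableI => //; exact: measurable_cell. Qed.

Let wcell_sub n a : wcell n a `<=` W. Proof. by move=> x []. Qed.

Let volume n a : R := fine (vol (wcell n a)).

Let volume_ge0 n a : 0 <= volume n a.
Proof. by apply: fine_ge0; exact: vol_ge0. Qed.

Lemma count_in_cell n a w :
  count_in eta (wcell n a) w = count_mem a (profile n (eta w)).
Proof.
rewrite /count_in count_map -sum1_count -[RHS]big_filter card_fset_sum1.
apply: perm_big; apply: uniq_perm; [exact: fset_uniq|exact/filter_uniq/fset_uniq|].
move=> x; rewrite mem_filter !inE /= andbC; case xw: (x \in eta w); rewrite ?andbF//= !andbT.
apply/idP/eqP; first by rewrite inE => -[].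
by move=> xa; rewrite inE; split => //; exact: (pp_support Peta xw).
Qed.

Lemma profile_event_count n s : {subset s <= cells n} ->
  eta @^-1` (profile_event n s : set {fset 'rV[R]_d}) =
  \bigcap_(a in [set` cells n]) (count_in eta (wcell n a) @^-1` [set count_mem a s]).
Proof.
move=> sW; apply/seteqP; split => w /=.
  by move=> /permP ws a _ /=; rewrite count_in_cell ws.
move=> h; apply/allP => a /=; rewrite mem_cat => ha.
rewrite -count_in_cell; apply/eqP; apply: h => /=.
case/orP: ha; last exact: sW.
by case/mapP => x xw ->; apply: mem_cells; exact: (pp_support Peta xw).
Qed.

Lemma profile_event_out n s : ~ {subset s <= cells n} ->
  eta @^-1` (profile_event n s : set {fset 'rV[R]_d}) = set0.
Proof.
move=> sW; apply/seteqP; split => w //= /perm_mem ws; apply: sW => a.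
rewrite -ws => /mapP[x xw ->]; apply: mem_cells; exact: (pp_support Peta xw).
Qed.

Lemma measurable_eta : measurable_fun setT (eta : T -> configSpace R d).
Proof.
apply: (@measurability _ _ T (configSpace R d) setT eta (@profile_events R d)) => //.
move=> _ [_ [n [s ->]] <-]; rewrite setTI.
have [sW|sW] := pselect {subset s <= cells n}; last by rewrite profile_event_out.
rewrite profile_event_count//; apply: fin_bigcap_measurable => [|a _].
  exact: finite_fset.
rewrite -[X in measurable X]setTI.
exact: (pp_measurable Peta (measurable_wcell _ _) (@wcell_sub n a)).
Qed.

Let pi r k : R := r ^+ k / k`!%:R * expR (- r).

(** Distinct cells meet W in disjoint sets, whose counts are independent Poisson
    variables. *)
Lemma prob_profile_event n s : {subset s <= cells n} ->
  P (eta @^-1` (profile_event n s : set {fset 'rV[R]_d})) =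
  (\prod_(a <- cells n) pi (t * volume n a) (count_mem a s))%:E.
Proof.
move=> sW; rewrite profile_event_count//.
pose c0 : 'rV[int]_d := 0.
pose A (i : 'I_(size (cells n))) := wcell n (nth c0 (cells n) i).
have triv : trivIset setT A.
  move=> i j _ _ [x [[xi _] [xj _]]]; apply/val_inj/eqP.
  rewrite -(nth_uniq c0 (ltn_ord i) (ltn_ord j) (fset_uniq (cells n))); apply/eqP.
  exact: etrans (esym xi) xj.
pose B i := count_in eta (A i) @^-1` [set count_mem (nth c0 (cells n) i) s].
pose J : {fset 'I_(size (cells n))} := [fset i | i in 'I_(size (cells n))]%fset.
have memJ : forall k, k \in J by move=> k; apply/imfsetP; exists k.
have := @pp_independent _ _ _ _ _ _ _ _ Peta (size (cells n)) A
  (fun i => measurable_wcell _ _) (fun i => @wcell_sub _ _) triv J B.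
rewrite (_ : \bigcap_(i in [set` J]) B i = \bigcap_(a in [set` cells n])
   (count_in eta (wcell n a) @^-1` [set count_mem a s])); last first.
  apply/seteqP; split => w /= h; last by move=> i _; apply: h; exact: mem_nth.
  move=> a /= /(nthP c0)[i ic <-]; exact: (h (Ordinal ic) (memJ _)).
move=> -> => [|i _]; last first.
  by exists [set count_mem (nth c0 (cells n) i) s] => //; rewrite setTI.
rewrite -prodEFin [RHS](big_nth c0) big_mkord.
rewrite (perm_big (index_enum 'I_(size (cells n)))) /=; last first.
  apply: uniq_perm; [exact: fset_uniq|exact: index_enum_uniq|].
  by move=> i; rewrite memJ mem_index_enum.
apply: eq_bigr => i _.
rewrite (pp_poisson Peta (measurable_wcell _ _) (@wcell_sub _ _)).
by rewrite poisson_law_set1// mulr_ge0 ?(ltW t0)//; exact: volume_ge0.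
Qed.

(** The identity [(k + 1) pi_r (k + 1) = r pi_r k] of Poisson weights, cell by
    cell, is the Mecke equation on pointed events. *)
Lemma prob_profile_cons n a s :
  ((count_mem a (a :: s))%:R%:E * P (eta @^-1` (profile_event n (a :: s) : set {fset 'rV[R]_d})) =
   (t * volume n a)%:E * P (eta @^-1` (profile_event n s : set {fset 'rV[R]_d})))%E.
Proof.
have [aW|aW] := boolP (a \in cells n); last first.
  rewrite profile_event_out ?measure0 ?mule0; last first.
    by move=> /(_ a); rewrite mem_head (negbTE aW) => /(_ isT).
  rewrite (_ : volume n a = 0) ?mulr0 ?mul0e//.
  rewrite /volume (_ : wcell n a = set0) -?volmE ?measure0//.
  apply/seteqP; split => x // [xa Wx]; move/negP: aW; apply.
  by rewrite -xa; exact: mem_cells.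
have [sW|sW] := pselect {subset s <= cells n}; last first.
  rewrite !profile_event_out ?measure0 ?mule0// => h; apply: sW => b bs.
  by apply: h; rewrite in_cons bs orbT.
have asW : {subset a :: s <= cells n}.
  by move=> b; rewrite in_cons => /orP[/eqP->//|]; exact: sW.
rewrite !prob_profile_event// -!EFinM; congr EFin.
rewrite !(bigD1_seq a) ?fset_uniq//= eqxx /= add1n.
rewrite [in LHS](eq_bigr (fun b => pi (t * volume n b) (count_mem b s))); last first.
  by move=> b ba; rewrite eq_sym (negbTE ba).
rewrite !mulrA; congr (_ * _); rewrite /pi exprS factS natrM.
set c := count_mem a s.
have c1 : c.+1%:R != 0 :> R by rewrite pnatr_eq0.
have cf : c`!%:R != 0 :> R by rewrite pnatr_eq0 -lt0n fact_gt0.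
by move: c1 cf; move: (c.+1%:R : R) (c`!%:R : R) => u v u0 v0; field; rewrite u0 v0.
Qed.

Definition config_law : {measure set (configSpace R d) -> \bar R} :=
  image_measure P measurable_eta.

Lemma config_lawT : config_law setT = 1%E.
Proof. by rewrite /config_law /= /pushforward preimage_setT probability_setT. Qed.

Let lawM := Measure_isProbability.Build _ _ _ config_law config_lawT.

Definition config_prob : probability (configSpace R d) R :=
  HB.pack (Measure.sort config_law) (Measure.class config_law) lawM.

End PoissonConfig.

(** The equation that characterizes the law of a Poisson process of intensity
    t nu. *)
Definition mecke_equation (R : realType) (d : nat)
    (Pi : probability (configSpace R d) R)
    (nu : {finite_measure set (borelRV R d) -> \bar R}) (t : R) : Prop :=
  forall u : borelRV R d * configSpace R d -> \bar R,
    measurable_fun setT u -> (forall p, 0 <= u p)%E ->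
    (\int[Pi]_eta \sum_(y <- (eta : {fset 'rV[R]_d}))
        u (y, ((eta : {fset 'rV[R]_d}) `\ y)%fset) =
     t%:E * \int[nu]_x \int[Pi]_eta u (x, eta))%E.

Section RemovalComposition.
Context (R : realType) (d : nat) (Pi : probability (configSpace R d) R).
Local Notation C := (configSpace R d).
Local Notation E := (borelRV R d * C)%type.

Let Pi' : unit -> pprobability C R := fun=> Pi.
Let mPi' : measurable_fun setT Pi'. Proof. exact: measurable_cst. Qed.

(** The Campbell measure: the mean of [removal]. *)
Definition campbell : {measure set E -> \bar R} :=
  kcomp (kprobability mPi' : R.-ker unit ~> C)
    (removal_kernel (@measurable_snd _ _ unit C) : R.-ker (unit * C) ~> E) tt.

Lemma campbellE A : campbell A = (\int[Pi]_eta removal eta A)%E.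
Proof. by []. Qed.

Lemma integral_campbell (u : E -> \bar R) :
  measurable_fun setT u -> (forall p, 0 <= u p)%E ->
  (\int[campbell]_p u p = \int[Pi]_eta \sum_(y <- (eta : {fset 'rV[R]_d}))
        u (y, ((eta : {fset 'rV[R]_d}) `\ y)%fset))%E.
Proof.
move=> mu u0; rewrite /campbell integral_kcomp //.
by apply: eq_integral => eta _; rewrite /removal_kernel integral_removal.
Qed.

End RemovalComposition.

Section Mecke.
Context (R : realType) (d : nat) (W : set 'rV[R]_d).
Hypothesis mW : measurable (W : set (borelRV R d)).
Context (M : R) (WM : W `<=` box M) (Wfin : (vol W < +oo)%E).
Context (dT : measure_display) (T : measurableType dT) (P : probability T R)
  (t : R) (eta : T -> {fset 'rV[R]_d}).
Hypotheses (t0 : 0 < t) (Peta : poisson_process P W t eta).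
Local Notation C := (configSpace R d).
Local Notation E := (borelRV R d * C)%type.
Local Notation Pi := (config_prob mW WM Peta).
Local Notation nu := (window_measure mW Wfin).

Let M2 : {measure set E -> \bar R} := mscale (NngNum (ltW t0)) (nu \x Pi)%E.

Let campbell_pointed n a s :
  campbell Pi (pointed_event n a s) =
  ((t * fine (vol (cell n a `&` W)))%:E * Pi (profile_event n s))%E.
Proof.
rewrite campbellE; under eq_integral do rewrite removal_pointed_event EFinM.
have mG : measurable (profile_event n (a :: s) : set C) by exact: measurable_profile_event.
rewrite ge0_integralZl_EFin //; last by apply/measurable_EFinP; exact: measurable_indic.
rewrite integral_indic // setIT.
exact: (prob_profile_cons mW WM t0 Peta).
Qed.

Let product_pointed n a s :
  M2 (pointed_event n a s) =
  ((t * fine (vol (cell n a `&` W)))%:E * Pi (profile_event n s))%E.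
Proof.
rewrite (_ : pointed_event n a s = cell n a `*` profile_event n s) //.
rewrite [LHS](_ : _ = t%:E * (nu \x Pi) (cell n a `*` profile_event n s))%E //.
rewrite product_measure1E; [|exact: measurable_cell|exact: measurable_profile_event].
rewrite EFinM -muleA; congr (_ * (_ * _))%E.
rewrite /= window_measureE fineK // ge0_fin_numE ?vol_ge0//.
by apply: le_lt_trans Wfin; apply: le_vol => //; apply: measurableI => //; exact: measurable_cell.
Qed.

(** The Mecke equation for indicators: both measures agree on the pi-system of
    pointed events, by [prob_profile_cons]. *)
Lemma campbell_product A : measurable A -> campbell Pi A = M2 A.
Proof.
pose cover (k : nat) : set E := if (choice.unpickle k : option ('rV[int]_d * seq 'rV[int]_d)) is Some (a, s)
  then pointed_event 0 a s else set0.
apply: (measure_unique (@pointed_events R d) cover).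
- exact: pointed_events_generate.
- exact: setI_closed_pointed_events.
- by move=> k; rewrite /cover; case: choice.unpickle => [[a s]|]; [right; exists 0%N, a, s|left].
- apply/seteqP; split => // -[x eta'] _.
  exists (choice.pickle (code 0 (x : 'rV_d), profile 0 (eta' : config R d))) => //.
  by rewrite /cover choice.pickleK; split => //; exact: perm_refl.
- by move=> B [->|[n [a [s ->]]]]; rewrite ?measure0// campbell_pointed product_pointed.
- move=> k; rewrite /cover; case: choice.unpickle => [[a s]|]; last by rewrite measure0.
  rewrite campbell_pointed lte_mul_pinfty ?lee_fin//.
    by rewrite mulr_ge0 ?(ltW t0)// fine_ge0// vol_ge0.
  by apply: (le_lt_trans (probability_le1 _ _)); [exact: measurable_profile_event|rewrite ltry].
Qed.

Lemma mecke_poisson : mecke_equation Pi nu t.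
Proof.
move=> u mu u0; rewrite -integral_campbell //.
transitivity (\int[M2]_p u p)%E.
  by apply: eq_measure_integral => A mA _; exact: campbell_product.
rewrite ge0_integral_mscale //; congr (_ * _)%E.
by rewrite (fubini_tonelli1 u).
Qed.

End Mecke.

Section IteratedRemoval.
Context (R : realType) (d : nat).
Local Notation C := (configSpace R d).
Local Notation rV := (borelRV R d).
Context (u : rV * (rV * C) -> \bar R).
Hypotheses (mu : measurable_fun setT u) (u0 : forall p, (0 <= u p)%E).

Lemma measurable_second_removal :
  measurable_fun setT (fun p : rV * C => \sum_(y <- (p.2 : {fset 'rV[R]_d}))
   u (p.1, (y, ((p.2 : {fset 'rV[R]_d}) `\ y)%fset)))%E.
Proof.
pose u' (q : (rV * C) * (rV * C)) := u (q.1.1, q.2).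
have mu' : measurable_fun setT u'.
  apply: (measurableT_comp mu); apply: measurable_fun_pair => //.
  exact: measurableT_comp.
exact: (measurable_sum_removal measurable_snd mu' (fun q => u0 _)).
Qed.

Lemma measurable_sum_removal2 :
  measurable_fun setT (fun eta : C => \sum_(x <- (eta : {fset 'rV[R]_d}))
      \sum_(y <- ((eta : {fset 'rV[R]_d}) `\ x)%fset)
        u (x, (y, ((eta : {fset 'rV[R]_d}) `\ x `\ y)%fset)))%E.
Proof.
have mU := measurableT_comp measurable_second_removal
  (@measurable_snd _ _ C (rV * C)%type).
by apply: (measurable_sum_removal (@measurable_id _ C setT) mU) => q; apply: sume_ge0.
Qed.

Context (Pi : probability C R) (nu : {finite_measure set rV -> \bar R}).

Lemma measurable_integral_config :
  measurable_fun setT (fun q : rV * rV => (\int[Pi]_eta u (q.1, (q.2, eta)))%E).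
Proof.
pose u'' (q : (rV * rV) * C) := u (q.1.1, (q.1.2, q.2)).
have mu'' : measurable_fun setT u''.
  apply: (measurableT_comp mu); apply: measurable_fun_pair.
    exact: measurableT_comp.
  by apply: measurable_fun_pair => //; apply: measurableT_comp.
by apply: (measurable_fun_fubini_tonelli_F u'' mu'') => q; exact: u0.
Qed.

Lemma measurable_integral_config2 :
  measurable_fun setT (fun x : rV => (\int[nu]_y \int[Pi]_eta u (x, (y, eta)))%E).
Proof.
by apply: (measurable_fun_fubini_tonelli_F _ measurable_integral_config) => q; apply: integral_ge0.
Qed.

(** Two-point form: apply the equation to the point that is left over after the
    removal of the first. *)
Lemma mecke2 t : 0 <= t -> mecke_equation Pi nu t ->
  (\int[Pi]_eta \sum_(x <- (eta : {fset 'rV[R]_d}))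
      \sum_(y <- ((eta : {fset 'rV[R]_d}) `\ x)%fset)
        u (x, (y, ((eta : {fset 'rV[R]_d}) `\ x `\ y)%fset)) =
   (t ^+ 2)%:E * \int[nu]_x \int[nu]_y \int[Pi]_eta u (x, (y, eta)))%E.
Proof.
move=> t0 mecke.
have U0 (p : rV * C) : (0 <= \sum_(y <- (p.2 : {fset 'rV[R]_d}))
   u (p.1, (y, ((p.2 : {fset 'rV[R]_d}) `\ y)%fset)))%E by apply: sume_ge0.
have := mecke _ measurable_second_removal U0; rewrite /= => ->.
rewrite expr2 EFinM -muleA; congr (_ * _)%E.
rewrite -ge0_integralZl_EFin //; last 2 first.
- by move=> x _; do 2 (apply: integral_ge0 => ? _).
- exact: measurable_integral_config2.
apply: eq_integral => x _.
by have := mecke _ (measurableT_comp mu (pair1_measurable x)) (fun p => u0 _).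
Qed.

End IteratedRemoval.

(** * Near pairs in a configuration *)

Section PairSum.
Context (K : choiceType) (V : nmodType).
Implicit Types (A : {fset K}) (g : K -> K -> V).

Definition pair_sum g A : V := \sum_(x <- A) \sum_(y <- (A `\ x)%fset) g x y.

Lemma pair_sumD1 g A x : x \in A ->
  pair_sum g A = pair_sum g (A `\ x)%fset + \sum_(z <- (A `\ x)%fset) (g x z + g z x).
Proof.
move=> xA; rewrite /pair_sum (big_fsetD1 x) //= big_split /= addrCA; congr (_ + _).
rewrite -big_split /= big_seq [RHS]big_seq; apply: eq_bigr => z.
rewrite in_fsetD1 => /andP[zx zA].
rewrite (big_fsetD1 x) /=; last by rewrite in_fsetD1 xA eq_sym zx.
by rewrite addrC fsetDDl fsetUC -fsetDDl.
Qed.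

(** Removing two points whose only possible neighbours are each other removes just
    their own contribution. *)
Lemma pair_sum_isolated g A x y : x \in A -> y \in (A `\ x)%fset ->
  (forall z, z \in (A `\ x `\ y)%fset ->
    [/\ g x z = 0, g z x = 0, g y z = 0 & g z y = 0]) ->
  pair_sum g A = pair_sum g (A `\ x `\ y)%fset + (g x y + g y x).
Proof.
move=> xA yA iso; rewrite (pair_sumD1 g xA) (pair_sumD1 g yA).
rewrite [X in _ + _ + X](big_fsetD1 y yA) /=.
rewrite [X in _ + X + _]big_seq big1 ?addr0; last first.
  by move=> z /iso[_ _ -> ->]; rewrite addr0.
rewrite [X in _ + (_ + X)]big_seq big1 ?addr0 // => z /iso[-> -> _ _].
by rewrite addr0.
Qed.

End PairSum.

Section MeasurablePairSums.
Context (R : realType) (d : nat).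
Local Notation C := (configSpace R d).
Local Notation rV := (borelRV R d).

Lemma measurable_neighbour_sum (v : rV * rV -> \bar R) :
  measurable_fun setT v -> (forall p, 0 <= v p)%E ->
  measurable_fun setT (fun p : rV * C => \sum_(y <- (p.2 : {fset 'rV[R]_d})) v (p.1, y))%E.
Proof.
move=> mv v0; pose u (q : (rV * C) * (rV * C)) := v (q.1.1, q.2.1).
have mu : measurable_fun setT u.
  by apply: (measurableT_comp mv); apply: measurable_fun_pair; apply: measurableT_comp.
exact: (measurable_sum_removal measurable_snd mu (fun q => v0 _)).
Qed.

Lemma measurable_pair_sum (v : rV * rV -> \bar R) :
  measurable_fun setT v -> (forall p, 0 <= v p)%E ->
  measurable_fun setT (fun eta : C => \sum_(x <- (eta : {fset 'rV[R]_d}))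
    \sum_(y <- ((eta : {fset 'rV[R]_d}) `\ x)%fset) v (x, y))%E.
Proof.
move=> mv v0; pose u (q : C * (rV * C)) :=
  (\sum_(y <- (q.2.2 : {fset 'rV[R]_d})) v (q.2.1, y))%E.
have mu : measurable_fun setT u.
  exact: (measurableT_comp (measurable_neighbour_sum mv v0) measurable_snd).
by apply: (measurable_sum_removal (@measurable_id _ C setT) mu) => q; apply: sume_ge0.
Qed.

End MeasurablePairSums.

Section NearPairs.
Context (R : realType) (d m : nat) (dl : R).
Local Notation C := (configSpace R d).
Local Notation rV := (borelRV R d).
Context (h : 'rV[R]_d -> 'rV[R]_d -> 'rV[R]_m).
Hypothesis mh : measurable_fun setT (fun p : rV * rV => h p.1 p.2 : borelRV R m).
Hypothesis hC : forall x y, h x y = h y x.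
Hypothesis h0 : forall x y i, 0 <= h x y ord0 i.
Implicit Types (eta : C) (f : 'rV[R]_m -> R).

(** Pairs are ordered, so each edge counts twice here, and the sum of the marks of
    the edges carries a factor 1/2. *)
Definition near_pairs eta : R :=
  pair_sum (fun x y => (near dl x y)%:R) (eta : {fset 'rV[R]_d}).

Definition near_marks eta : 'rV[R]_m :=
  2^-1 *: pair_sum (fun x y => (near dl x y)%:R *: h x y) (eta : {fset 'rV[R]_d}).

Lemma near_pairs_nat eta : exists n : nat, near_pairs eta = n%:R.
Proof.
exists (\sum_(x <- (eta : {fset 'rV[R]_d}))
  \sum_(y <- ((eta : {fset 'rV[R]_d}) `\ x)%fset) near dl x y)%N.
by rewrite natr_sum; apply: eq_bigr => x _; rewrite natr_sum.
Qed.

Lemma near_pairs_ge0 eta : 0 <= near_pairs eta.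
Proof. by have [n ->] := near_pairs_nat eta. Qed.

Lemma measurable_near_pairs : measurable_fun setT near_pairs.
Proof.
apply/measurable_EFinP.
have := measurable_pair_sum (measurable_bool_EFin (@measurable_near R d dl)) (fun p => lee0n _).
apply: eq_measurable_fun => eta _ /=; rewrite /near_pairs /pair_sum -sumEFin.
by apply: eq_bigr => x _; rewrite -sumEFin.
Qed.

Lemma measurable_near_marks : measurable_fun setT (near_marks : C -> borelRV R m).
Proof.
apply: measurable_fun_row => i.
pose v (p : rV * rV) : \bar R := ((near dl p.1 p.2)%:R%:E * (h p.1 p.2 ord0 i)%:E)%E.
have mv : measurable_fun setT v.
  apply: emeasurable_funM; first exact: (measurable_bool_EFin (@measurable_near R d dl)).
  by apply/measurable_EFinP; exact: (measurableT_comp (measurable_coord i) mh).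
have v0 p : (0 <= v p)%E by rewrite mule_ge0 ?lee_fin.
have mS : measurable_fun setT (fun eta : C =>
    pair_sum (fun x y => (near dl x y)%:R * h x y ord0 i) (eta : {fset 'rV[R]_d}) : R).
  apply/measurable_EFinP; have := measurable_pair_sum mv v0.
  apply: eq_measurable_fun => eta _ /=; rewrite /pair_sum -sumEFin.
  by apply: eq_bigr => x _; rewrite -sumEFin; apply: eq_bigr => y _; rewrite EFinM.
apply: (eq_measurable_fun (fun eta : C => 2^-1 *
    pair_sum (fun x y => (near dl x y)%:R * h x y ord0 i) (eta : {fset 'rV[R]_d}))).
  move=> eta _; rewrite mxE; congr (_ * _); rewrite /pair_sum summxE.
  by apply: eq_bigr => x _; rewrite summxE; apply: eq_bigr => y _; rewrite mxE.
exact: measurable_funM.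
Qed.

Definition neighbours (x : 'rV[R]_d) eta : R :=
  \sum_(z <- (eta : {fset 'rV[R]_d})) (near dl x z)%:R.

Lemma neighbours_ge0 x eta : 0 <= neighbours x eta.
Proof. exact: sumr_ge0. Qed.

Lemma measurable_neighbours :
  measurable_fun setT (fun p : rV * C => neighbours p.1 p.2).
Proof.
apply/measurable_EFinP.
have := measurable_neighbour_sum (measurable_bool_EFin (@measurable_near R d dl)) (fun p => lee0n _).
by apply: eq_measurable_fun => p _ /=; rewrite /neighbours -sumEFin.
Qed.

Lemma neighbours_eq0 x eta z : neighbours x eta = 0 ->
  z \in (eta : {fset 'rV[R]_d}) -> near dl x z = false.
Proof.
move=> n0 zeta; apply/negP => xz; move: n0; rewrite /neighbours (big_fsetD1 z) //= xz.
by move/eqP; rewrite paddr_eq0 ?oner_eq0// sumr_ge0.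
Qed.

Lemma neighbours_ge1 x eta : neighbours x eta != 0 -> 1 <= neighbours x eta.
Proof.
rewrite /neighbours -natr_sum pnatr_eq0 -lt0n => h1.
by rewrite (ler_nat _ 1%N).
Qed.

(** The only near pairs lost with x and y are (x, y) and (y, x). *)
Lemma near_removal (eta : {fset 'rV[R]_d}) x y : x \in eta -> y \in (eta `\ x)%fset ->
  near dl x y -> neighbours x (eta `\ x `\ y)%fset = 0 ->
  neighbours y (eta `\ x `\ y)%fset = 0 ->
  near_pairs eta = near_pairs (eta `\ x `\ y)%fset + 2 /\
  near_marks eta = near_marks (eta `\ x `\ y)%fset + h x y.
Proof.
move=> xeta yeta xy nx ny; split.
  rewrite /near_pairs (pair_sum_isolated xeta yeta).
    by rewrite (nearC dl y x) xy.
  move=> z zeta; rewrite (nearC dl z x) (nearC dl z y).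
  by rewrite (neighbours_eq0 nx zeta) (neighbours_eq0 ny zeta).
rewrite /near_marks (pair_sum_isolated xeta yeta).
  rewrite (nearC dl y x) xy !scale1r (hC y x) -[h x y + h x y]mulr2n.
  by rewrite -[h x y *+ 2]scaler_nat scalerDr scalerA mulVf ?pnatr_eq0// scale1r.
move=> z zeta; rewrite (nearC dl z x) (nearC dl z y).
by rewrite (neighbours_eq0 nx zeta) (neighbours_eq0 ny zeta) !scale0r.
Qed.

End NearPairs.

Lemma near_marks_eq0 (R : realType) (d m : nat) (dl : R)
    (h : 'rV[R]_d -> 'rV[R]_d -> 'rV[R]_m) (eta : configSpace R d) :
  near_pairs dl eta = 0 -> near_marks dl h eta = 0.
Proof.
rewrite /near_pairs /near_marks /pair_sum => /eqP.
rewrite psumr_eq0; last by move=> x _; exact: sumr_ge0.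
move=> /allP eta0; rewrite big_seq big1 ?scaler0// => x /eta0 /=.
rewrite psumr_eq0 // => /allP x0; rewrite big_seq big1 // => y /x0 /= /eqP ->.
by rewrite scale0r.
Qed.

(** * The approximate recursion for the number of near pairs *)

Lemma measurable_fun_addrV (R : realType) (d : nat) (dT : measure_display)
    (T : measurableType dT) (f g : T -> borelRV R d) :
  measurable_fun setT f -> measurable_fun setT g ->
  measurable_fun setT (fun w => ((f w : 'rV[R]_d) + (g w : 'rV[R]_d)) : borelRV R d).
Proof.
move=> mf mg; apply: measurable_fun_row => i.
apply: (eq_measurable_fun (fun w => (f w : 'rV_d) ord0 i + (g w : 'rV_d) ord0 i)).
  by move=> w _; rewrite !mxE.
by apply: measurable_funD; apply: (measurableT_comp (measurable_coord _)).
Qed.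

Definition test_function (R : realType) (m : nat) (f : 'rV[R]_m -> R) : Prop :=
  measurable_fun setT (f : borelRV R m -> R) /\ forall z, 0 <= f z <= 1.

Section Recursion.
Context (R : realType) (d m : nat) (dl t b V : R).
Local Notation C := (configSpace R d).
Local Notation rV := (borelRV R d).
Context (h : 'rV[R]_d -> 'rV[R]_d -> 'rV[R]_m).
Hypothesis mh : measurable_fun setT (fun p : rV * rV => h p.1 p.2 : borelRV R m).
Hypothesis hC : forall x y, h x y = h y x.
Hypothesis h0 : forall x y i, 0 <= h x y ord0 i.
Context (Pi : probability C R) (nu : {finite_measure set rV -> \bar R}).
Hypotheses (t0 : 0 <= t) (b0 : 0 <= b) (V0 : 0 <= V).
Hypothesis mecke : mecke_equation Pi nu t.
Hypothesis nuT : nu setT = V%:E.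
Hypothesis near_le : forall x, (\int[nu]_y (near dl x y)%:R%:E <= b%:E)%E.
Implicit Types (k : nat) (eta : C) (f : 'rV[R]_m -> R) (x y : 'rV[R]_d).
Local Notation Z := (near_marks dl h).
Local Notation N := (@near_pairs R d dl).

Let mZ : measurable_fun setT (Z : C -> borelRV R m).
Proof. exact: measurable_near_marks. Qed.
Let mN : measurable_fun setT N. Proof. exact: measurable_near_pairs. Qed.

Lemma measurable_eq_cst (dT : measure_display) (T : measurableType dT) (g : T -> R) (a : R) :
  measurable_fun setT g -> measurable_fun setT (fun w => (g w == a)%:R : R).
Proof.
move=> mg; apply: (measurableT_comp (f := fun c : bool => c%:R : R)) => //.
exact: measurable_fun_eqr.
Qed.

(** The law of the mark sum on the event of a given number of near pairs; that
    number is a real so that subtracting 2 from it needs no truncation. *)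
Definition pair_law (a : R) f : \bar R :=
  (\int[Pi]_eta (f (Z eta) * (N eta == a)%:R)%:E)%E.

(** The mean of the same quantity with one near pair added by hand. *)
Definition added_pair (a : R) f : \bar R :=
  ((t ^+ 2)%:E * \int[nu]_x \int[nu]_y ((near dl x y)%:R%:E *
     pair_law a (fun z => f (z + h x y)%R)))%E.

(** A bound for the mean number of near pairs (x, y) together with a third point
    near x or near y: t^3 V b^2 for each of the two cases. *)
Definition recursion_error : R := 2 * t ^+ 3 * V * b ^+ 2.

(* For points x and y and the rest of the configuration: u1 is the contribution of
   a pair if x and y have no other neighbour, and u2 bounds the error made by
   using u1 also when they have. *)
Let u1 (a : R) f (p : rV * (rV * C)) : R :=
  (near dl p.1 p.2.1)%:R * (f (Z p.2.2 + h p.1 p.2.1) * (N p.2.2 == a)%:R).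

Let u2 (p : rV * (rV * C)) : R :=
  (near dl p.1 p.2.1)%:R * (neighbours dl p.1 p.2.2 + neighbours dl p.2.1 p.2.2).

Let m13 : measurable_fun setT (fun p : rV * (rV * C) => (p.1, p.2.1)).
Proof. by apply: measurable_fun_pair => //; apply: measurableT_comp. Qed.

Let mnear : measurable_fun setT (fun p : rV * (rV * C) => (near dl p.1 p.2.1)%:R : R).
Proof.
apply: (measurableT_comp (f := fun c : bool => c%:R : R)) => //.
exact: (measurableT_comp (@measurable_near R d dl) m13).
Qed.

Let mcfg : measurable_fun setT (fun p : rV * (rV * C) => p.2.2).
Proof. by apply: measurableT_comp. Qed.

Let mu1 a f : test_function f -> measurable_fun setT (u1 a f).
Proof.
move=> [mf _]; apply: measurable_funM => //; apply: measurable_funM.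
  apply: (measurableT_comp mf); apply: measurable_fun_addrV.
    exact: (measurableT_comp mZ mcfg).
  exact: (measurableT_comp mh m13).
exact: (measurableT_comp (measurable_eq_cst a mN) mcfg).
Qed.

Let mu2 : measurable_fun setT u2.
Proof.
apply: measurable_funM => //; apply: measurable_funD.
  have m1 : measurable_fun setT (fun p : rV * (rV * C) => (p.1, p.2.2)).
    by apply: measurable_fun_pair => //; apply: measurableT_comp.
  exact: (measurableT_comp (@measurable_neighbours R d dl) m1).
exact: (measurableT_comp (@measurable_neighbours R d dl) measurable_snd).
Qed.

Let u1_ge0 a f p : test_function f -> 0 <= u1 a f p.
Proof. by move=> [_ f01]; rewrite !mulr_ge0//; case/andP: (f01 (Z p.2.2 + h p.1 p.2.1)). Qed.

Let u2_ge0 p : 0 <= u2 p.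
Proof. by rewrite mulr_ge0// addr_ge0// neighbours_ge0. Qed.

Lemma mean_neighbours x :
  (\int[Pi]_eta (neighbours dl x eta)%:E <= (t * b)%:E)%E.
Proof.
have mn : measurable_fun setT (fun p : rV * C => (near dl x (p.1 : 'rV_d))%:R%:E : \bar R).
  exact: (measurableT_comp (measurable_near1 dl x) measurable_fst).
have n0 (p : rV * C) : (0 <= (near dl x (p.1 : 'rV_d))%:R%:E :> \bar R)%E by rewrite lee_fin.
have := mecke mn n0; rewrite /=.
under eq_integral do rewrite sumEFin.
move=> ->; rewrite EFinM lee_wpmul2l ?lee_fin//.
under eq_integral do rewrite integral_cst//= probability_setT mule1.
exact: near_le.
Qed.

Let integral_near2 (B : \bar R) : (0 <= B)%E ->
  (\int[nu]_x \int[nu]_y ((near dl x y)%:R%:E * B) <= (V * b)%:E * B)%E.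
Proof.
move=> B0; apply: (@le_trans _ _ (\int[nu]_x (b%:E * B))%E).
  apply: ge0_le_integral => //.
  - by move=> x _; apply: integral_ge0 => y _; rewrite mule_ge0// lee_fin.
  - have mB : measurable_fun setT (fun p : rV * rV => ((near dl p.1 p.2)%:R%:E * B)%E).
      by apply: emeasurable_funM => //; exact: (measurable_bool_EFin (@measurable_near R d dl)).
    by apply: (measurable_fun_fubini_tonelli_F _ mB) => q; rewrite mule_ge0// lee_fin.
  move=> x _; rewrite ge0_integralZr //; last exact: measurable_near1.
  by rewrite lee_wpmul2r.
by rewrite integral_cst //= nuT EFinM muleC muleA.
Qed.

Let mean_u2 : ((t ^+ 2)%:E * \int[nu]_x \int[nu]_y \int[Pi]_eta (u2 (x, (y, eta)))%:E
   <= recursion_error%:E)%E.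
Proof.
have -> : recursion_error = t ^+ 2 * ((V * b) * (2 * (t * b))) by rewrite /recursion_error; ring.
rewrite [X in (_ <= X)%E]EFinM lee_wpmul2l ?lee_fin ?exprn_ge0//.
have tb0 : (0 <= (2 * (t * b))%:E)%E by rewrite lee_fin !mulr_ge0.
have mEu2 : measurable_fun setT (fun p => (u2 p)%:E) by exact/measurable_EFinP.
have Eu20 p : (0 <= (u2 p)%:E)%E by rewrite lee_fin.
have mB : measurable_fun setT (fun p : rV * rV => ((near dl p.1 p.2)%:R%:E * (2 * (t * b))%:E)%E).
  by apply: emeasurable_funM => //; exact: (measurable_bool_EFin (@measurable_near R d dl)).
have nn0 x y : (0 <= (near dl x y)%:R%:E * (2 * (t * b))%:E)%E.
  by rewrite mule_ge0 // lee_fin.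
rewrite [X in (_ <= X)%E]EFinM; apply: le_trans (integral_near2 tb0).
apply: ge0_le_integral => //.
- by move=> x _; do 2 (apply: integral_ge0 => ? _).
- exact: (measurable_integral_config2 mEu2 Eu20).
- by apply: (measurable_fun_fubini_tonelli_F _ mB) => q.
move=> x _; apply: ge0_le_integral => //.
- by move=> y _; apply: integral_ge0.
- exact: (measurableT_comp (measurable_integral_config mEu2 Eu20 Pi) (pair1_measurable x)).
- exact: (measurableT_comp mB (pair1_measurable (x : rV))).
move=> y _; rewrite /u2 /=; under eq_integral do rewrite EFinM.
have mnb z : measurable_fun setT (fun eta : C => (neighbours dl z eta)%:E).
  apply/measurable_EFinP.
  exact: (measurableT_comp (@measurable_neighbours R d dl) (pair1_measurable (z : rV))).
have nb0 z eta : (0 <= (neighbours dl z eta)%:E)%E by rewrite lee_fin neighbours_ge0.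
under eq_integral do rewrite EFinD.
rewrite ge0_integralZl_EFin //; last 2 first.
- by move=> eta _; rewrite adde_ge0.
- exact: emeasurable_funD.
rewrite lee_wpmul2l ?lee_fin// ge0_integralD //.
by rewrite mulrDl !mul1r EFinD leeD // mean_neighbours.
Qed.

Let integral_u1 a f x y : test_function f ->
  (\int[Pi]_eta (u1 a f (x, (y, eta)))%:E =
    (near dl x y)%:R%:E * pair_law a (fun z => f (z + h x y)%R))%E.
Proof.
move=> [mf f01]; rewrite /pair_law -ge0_integralZl_EFin //.
- by move=> eta _; rewrite lee_fin mulr_ge0 //; case/andP: (f01 (Z eta + h x y)).
- apply/measurable_EFinP; apply: measurable_funM; last exact: measurable_eq_cst.
  apply: (measurableT_comp mf); exact: (@measurable_fun_addrV R m _ C Z (cst (h x y))).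
Qed.

Let mean_u1 a f : test_function f ->
  ((t ^+ 2)%:E * \int[nu]_x \int[nu]_y \int[Pi]_eta (u1 a f (x, (y, eta)))%:E =
   added_pair a f)%E.
Proof.
move=> tf; congr (_ * _)%E.
by apply: eq_integral => x _; apply: eq_integral => y _; exact: integral_u1.
Qed.

Lemma measurable_added_pair a f : test_function f ->
  measurable_fun setT (fun q : rV * rV => ((near dl q.1 q.2)%:R%:E *
     pair_law a (fun z => f (z + h q.1 q.2)%R))%E).
Proof.
move=> tf; have [mf f01] := tf.
have mEu1 : measurable_fun setT (fun p => (u1 a f p)%:E) by apply/measurable_EFinP; exact: mu1.
have Eu10 p : (0 <= (u1 a f p)%:E)%E by rewrite lee_fin u1_ge0.
apply: eq_measurable_fun (measurable_integral_config mEu1 Eu10 Pi) => -[x y] _.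
by rewrite integral_u1.
Qed.

(** If x and y have no neighbours among the other points then both terms agree;
    otherwise both lie in [0, 1] while the bound is at least 1. *)
Let removal_error (eta : {fset 'rV[R]_d}) (a : R) f x y : test_function f ->
  x \in eta -> y \in (eta `\ x)%fset ->
  `| (near dl x y)%:R * (f (Z eta) * (N eta == a + 2)%:R) -
     u1 a f (x, (y, (eta `\ x `\ y)%fset))| <= u2 (x, (y, (eta `\ x `\ y)%fset)).
Proof.
move=> [mf f01] xeta yeta; rewrite /u1 /u2 /=.
have [xy|] := boolP (near dl x y); last by rewrite !mul0r subrr normr0.
rewrite !mul1r; set eta' : {fset 'rV[R]_d} := (eta `\ x `\ y)%fset.
have [[nx ny]|nxy] := pselect (neighbours dl x eta' = 0 /\ neighbours dl y eta' = 0).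
  have [-> ->] := near_removal hC xeta yeta xy nx ny.
  by rewrite (inj_eq (addIr _)) subrr normr0 nx ny addr0.
have n1 : 1 <= neighbours dl x eta' + neighbours dl y eta'.
  have [nx|/neighbours_ge1 nx] := eqVneq (neighbours dl x eta') 0; last first.
    by rewrite (le_trans nx)// lerDl neighbours_ge0.
  have [ny|/neighbours_ge1 ny] := eqVneq (neighbours dl y eta') 0; first by case: nxy.
  by rewrite (le_trans ny)// lerDr neighbours_ge0.
apply: le_trans n1.
have [/andP[p0 p1] /andP[q0 q1]] := (f01 (Z eta), f01 (Z eta' + h x y)).
by case: (_ == _); case: (_ == _); rewrite ?mulr1 ?mulr0 ler_norml; lra.
Qed.

(** On the event of k near pairs the factor k is the number of ordered near pairs
    (x, y). Removing x and y is compared with [removal_error], and the two-point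
    Mecke equation computes the means. *)
Lemma recursion k f : test_function f ->
  (k%:R%:E * pair_law k%:R f <= added_pair (k%:R - 2) f + recursion_error%:E)%E /\
  (added_pair (k%:R - 2) f <= k%:R%:E * pair_law k%:R f + recursion_error%:E)%E.
Proof.
move=> tf; have [mf f01] := tf.
pose sum2 (v : rV * (rV * C) -> R) (eta : {fset 'rV[R]_d}) : R :=
  \sum_(x <- eta) \sum_(y <- (eta `\ x)%fset) v (x, (y, (eta `\ x `\ y)%fset)).
have sum2E (v : rV * (rV * C) -> R) : measurable_fun setT v -> (forall p, 0 <= v p) ->
    measurable_fun setT (fun eta : C => (sum2 v eta)%:E) /\
    (\int[Pi]_eta (sum2 v eta)%:E =
      (t ^+ 2)%:E * \int[nu]_x \int[nu]_y \int[Pi]_eta (v (x, (y, eta)))%:E)%E.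
  move=> mv v0.
  have mEv : measurable_fun setT (fun p => (v p)%:E) by exact/measurable_EFinP.
  have Ev0 p : (0 <= (v p)%:E)%E by rewrite lee_fin.
  have E eta : (sum2 v eta)%:E = (\sum_(x <- (eta : {fset 'rV[R]_d}))
      \sum_(y <- ((eta : {fset 'rV[R]_d}) `\ x)%fset)
        (v (x, (y, ((eta : {fset 'rV[R]_d}) `\ x `\ y)%fset)))%:E)%E.
    by rewrite -sumEFin; apply: eq_bigr => x _; rewrite -sumEFin.
  split; first by under eq_fun do rewrite E; exact: (measurable_sum_removal2 mEv Ev0).
  by under eq_integral do rewrite E; exact: (mecke2 mEv Ev0 t0 mecke).
pose A (eta : C) := k%:R * (f (Z eta) * (N eta == k%:R)%:R).
have mA : measurable_fun setT (fun eta : C => (A eta)%:E).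
  apply/measurable_EFinP; apply: measurable_funM => //; apply: measurable_funM.
    exact: (measurableT_comp mf mZ).
  exact: measurable_eq_cst.
have fN0 eta : 0 <= f (Z eta) * (N eta == k%:R)%:R.
  by rewrite mulr_ge0//; case/andP: (f01 (Z eta)).
have A0 eta : 0 <= A eta by rewrite mulr_ge0.
have intA : (\int[Pi]_eta (A eta)%:E = k%:R%:E * pair_law k%:R f)%E.
  rewrite /pair_law -ge0_integralZl_EFin //.
    by move=> eta _; rewrite lee_fin.
  apply/measurable_EFinP; apply: measurable_funM.
    exact: (measurableT_comp mf mZ).
  exact: measurable_eq_cst.
have [mB intB] := sum2E _ (mu1 (k%:R - 2) tf) (fun p => u1_ge0 _ p tf).
have [mU intU] := sum2E _ mu2 u2_ge0.
rewrite mean_u1// in intB; have := mean_u2; rewrite -intU => errU.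
have sum2_ge0 (v : rV * (rV * C) -> R) eta : (forall p, 0 <= v p) -> 0 <= sum2 v eta.
  by move=> v0; rewrite /sum2; do 2 (apply: sumr_ge0 => ? _).
have AB eta : `|A eta - sum2 (u1 (k%:R - 2) f) eta| <= sum2 u2 eta.
  have -> : A eta = pair_sum (fun x y => (near dl x y)%:R * (f (Z eta) * (N eta == k%:R)%:R))
      (eta : {fset 'rV[R]_d}).
    rewrite /A; have [Nk|] := eqVneq (N eta) k%:R; last first.
      by move=> _; rewrite !mulr0 /pair_sum !big1 // => x _; rewrite big1 // => y _; rewrite mulr0.
    rewrite -Nk /near_pairs /pair_sum mulr_suml; apply: eq_bigr => x _.
    by rewrite mulr_suml.
  rewrite /pair_sum /sum2 -sumrB big_seq [X in _ <= X]big_seq.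
  apply: (le_trans (ler_norm_sum _ _ _)); apply: ler_sum => x xeta.
  rewrite -sumrB big_seq [X in _ <= X]big_seq.
  apply: (le_trans (ler_norm_sum _ _ _)); apply: ler_sum => y yeta.
  by have := removal_error (k%:R - 2) tf xeta yeta; rewrite subrK.
rewrite -intA -intB; split.
  apply: (@le_trans _ _ (\int[Pi]_eta ((sum2 (u1 (k%:R - 2) f) eta)%:E + (sum2 u2 eta)%:E))%E).
    apply: ge0_le_integral => //.
    - by move=> eta _; rewrite lee_fin.
    - exact: emeasurable_funD.
    by move=> eta _; rewrite -EFinD lee_fin; have := AB eta; rewrite ler_norml => /andP[]; lra.
  rewrite ge0_integralD //; first by rewrite leeD2l.
    by move=> eta _; rewrite lee_fin; apply: sum2_ge0 => p; exact: u1_ge0.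
  by move=> eta _; rewrite lee_fin; apply: sum2_ge0 => p; exact: u2_ge0.
apply: (@le_trans _ _ (\int[Pi]_eta ((A eta)%:E + (sum2 u2 eta)%:E))%E).
  apply: ge0_le_integral => //.
  - by move=> eta _; rewrite lee_fin; apply: sum2_ge0 => p; exact: u1_ge0.
  - exact: emeasurable_funD.
  by move=> eta _; rewrite -EFinD lee_fin; have := AB eta; rewrite ler_norml => /andP[]; lra.
rewrite ge0_integralD //; first by rewrite leeD2l.
  by move=> eta _; rewrite lee_fin.
by move=> eta _; rewrite lee_fin; apply: sum2_ge0 => p; exact: u2_ge0.
Qed.

Lemma mean_near_pairs : (\int[Pi]_eta (N eta)%:E <= (t ^+ 2 * V * b)%:E)%E.
Proof.
have mE : measurable_fun setT (fun p : rV * (rV * C) => (near dl p.1 p.2.1)%:R%:E : \bar R).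
  exact/measurable_EFinP.
have E0 (p : rV * (rV * C)) : (0 <= (near dl p.1 p.2.1)%:R%:E :> \bar R)%E by rewrite lee_fin.
under eq_integral do
  (rewrite /near_pairs /pair_sum -sumEFin; under eq_bigr do rewrite -sumEFin).
rewrite (mecke2 mE E0 t0 mecke) /= -mulrA [X in (_ <= X)%E]EFinM lee_wpmul2l ?lee_fin ?exprn_ge0//.
have := integral_near2 (@lee01 R); rewrite mule1; apply: le_trans.
rewrite le_eqVlt; apply/orP; left; apply/eqP.
apply: eq_integral => x _; apply: eq_integral => y _.
by rewrite integral_cst //= probability_setT.
Qed.

End Recursion.

(** * The compound Poisson limit *)

Section CompoundPoisson.
Context (R : realType) (m : nat) (dT : measure_display) (T : measurableType dT)
  (Q : probability T R) (X : nat -> {RV Q >-> R}) (N : {RV Q >-> nat})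
  (h : R -> 'rV[R]_m) (c mass : R).
Hypothesis mh : measurable_fun setT (h : R -> borelRV R m).
Hypotheses (c0 : 0 <= c) (mass0 : 0 <= mass).
Hypothesis X_indep : mutually_independent Q (fun j => g_sigma_algebra_preimage (X j)).
Hypothesis X_unif : forall (c_gt0 : 0 < c) (j : nat) (B : set R), measurable B ->
  distribution Q (X j) B = uniform_prob c_gt0 B.
Hypothesis N_poisson : forall B : set nat,
  distribution Q N B = poisson_law (mass * c / 2) B.
Hypothesis NX_indep : independent Q (g_sigma_algebra_preimage N)
  <<s \bigcup_j g_sigma_algebra_preimage (X j) >>.
Local Notation rM := (borelRV R m).

Definition mark_sum n (w : T) : 'rV[R]_m := \sum_(j < n) h (X j w).

(** The domain is left free so as to apply this to T with the sigma-algebras that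
    are generated by the variables. *)
Lemma measurable_mark_sum_from (dU : measure_display) (U : measurableType dU)
    (Y : nat -> U -> R) n :
  (forall j, (j < n)%N -> measurable_fun setT (Y j)) ->
  measurable_fun setT (fun w : U => \sum_(j < n) h (Y j w) : rM).
Proof.
move=> mY; apply: measurable_fun_row => i.
apply: (eq_measurable_fun (fun w : U => \sum_(j < n) h (Y j w) ord0 i)).
  by move=> w _; rewrite summxE.
apply: measurable_sum => j; apply: (measurableT_comp (measurable_coord i)).
exact: (measurableT_comp mh (mY _ (ltn_ord j))).
Qed.

Lemma measurable_mark_sum n : measurable_fun setT (mark_sum n : T -> rM).
Proof. exact: (@measurable_mark_sum_from _ _ (fun j => X j : T -> R) n (fun j _ => measurable_funP (X j))). Qed.

Definition compound (w : T) : 'rV[R]_m := mark_sum (N w) w.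

Lemma measurable_compound : measurable_fun setT (compound : T -> rM).
Proof.
move=> _ B mB; rewrite setTI.
rewrite (_ : compound @^-1` B =
  \bigcup_n ((N @^-1` [set n]) `&` (mark_sum n @^-1` B))).
  apply: bigcupT_measurable => n; apply: measurableI.
    by rewrite -[X in measurable X]setTI; exact: measurable_funP.
  by rewrite -[X in measurable X]setTI; exact: measurable_mark_sum.
apply/seteqP; split => [w Bw|w [n _ [/= <-]]] //.
by exists (N w).
Qed.

Let marks n : {mfun T >-> rM} :=
  HB.pack (mark_sum n : T -> rM) (isMeasurableFun.Build _ _ _ _ _ (measurable_mark_sum n)).

Definition cylinders n : set (set T) :=
  [set A | exists B : nat -> set R, (forall j, measurable (B j)) /\
     A = \bigcap_(j in `I_n) (X j @^-1` B j)].

(** Cylinders in the first n variables form a pi-system on which independence is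
    the product rule, and the sum is measurable for the sigma-algebra that they
    generate. *)
Lemma next_independent n (A : set rM) (B : set R) :
  measurable A -> measurable B ->
  Q ((mark_sum n @^-1` A) `&` (X n @^-1` B)) =
  (Q (mark_sum n @^-1` A) * Q (X n @^-1` B))%E.
Proof.
move=> mA mB.
have mXB j C : measurable C -> measurable (X j @^-1` C).
  by move=> mC; rewrite -[X in measurable X]setTI; exact: measurable_funP.
pose U := g_sigma_algebraType (cylinders n).
have mcyl C : cylinders n C -> measurable C.
  by move=> [D [mD ->]]; apply: fin_bigcap_measurable => [|j _]; [exact: finite_II|exact: mXB].
have mid : measurable_fun setT (id : T -> U).
  apply: (@measurability _ _ T U setT id (cylinders n)) => //.
  by move=> _ [C cC <-]; rewrite setTI; exact: mcyl.
pose m1 : {measure set U -> \bar R} := image_measure (mrestr Q (mXB n _ mB)) mid.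
have q0 : 0 <= fine (Q (X n @^-1` B)) by apply: fine_ge0; exact: measure_ge0.
pose m2 : {measure set U -> \bar R} := mscale (NngNum q0) (image_measure Q mid).
have qE : (fine (Q (X n @^-1` B)))%:E = Q (X n @^-1` B).
  by rewrite fineK// fin_num_measure//; apply: (mXB n B mB).
have cylT : cylinders n setT.
  exists (fun=> setT); split => //; apply/seteqP; split => // w _ j _ //.
have m12 C : cylinders n C -> m1 C = m2 C.
  move=> [D [mD ->]].
  rewrite [LHS](_ : _ = Q ((\bigcap_(j in `I_n) (X j @^-1` D j)) `&` (X n @^-1` B))) //.
  rewrite [RHS](_ : _ = Q (X n @^-1` B) * Q (\bigcap_(j in `I_n) (X j @^-1` D j)))%E; last first.
    by rewrite -qE.
  pose D' j := if (j < n)%N then X j @^-1` D j else X n @^-1` B.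
  have D'P j : (j <= n)%N -> g_sigma_algebra_preimage (X j) (D' j).
    rewrite /D' => jn; case: ltnP => nj; first by exists (D j) => //; rewrite setTI.
    have -> : j = n by apply/eqP; rewrite eqn_leq jn nj.
    by exists B => //; rewrite setTI.
  pose J k : {fset nat} := seq_fset tt (iota 0 k).
  have memJ k j : (j \in J k) = (j < k)%N by rewrite seq_fsetE mem_iota add0n.
  have capJ k : (k <= n)%N ->
      Q (\bigcap_(j in `I_k) D' j) = (\prod_(0 <= j < k) Q (D' j))%E.
    move=> kn; have := X_indep (J := J k) (A := D').
    rewrite (_ : [set` J k] = `I_k); last first.
      by apply/seteqP; split => j /=; rewrite memJ.
    move=> -> => [|j]; last by rewrite memJ => jk; apply: D'P; exact: leq_trans (ltnW jk) kn.
    apply: perm_big; apply: uniq_perm; [exact: fset_uniq|exact: iota_uniq|].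
    by move=> j; rewrite memJ mem_index_iota.
  have capJS : Q (\bigcap_(j in `I_n.+1) D' j) = (\prod_(0 <= j < n.+1) Q (D' j))%E.
    have := X_indep (J := J n.+1) (A := D').
    rewrite (_ : [set` J n.+1] = `I_n.+1); last first.
      by apply/seteqP; split => j /=; rewrite memJ.
    move=> -> => [|j]; last by rewrite memJ ltnS => jk; apply: D'P.
    apply: perm_big; apply: uniq_perm; [exact: fset_uniq|exact: iota_uniq|].
    by move=> j; rewrite memJ mem_index_iota.
  have D'n : D' n = X n @^-1` B by rewrite /D' ltnn.
  have capE : \bigcap_(j in `I_n) D' j = \bigcap_(j in `I_n) (X j @^-1` D j).
    by apply: eq_bigcapr => j /= jn; rewrite /D' jn.
  have <- : \bigcap_(j in `I_n.+1) D' j =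
      (\bigcap_(j in `I_n) (X j @^-1` D j)) `&` (X n @^-1` B).
    rewrite -capE -D'n; apply/seteqP; split => w /= Dw.
      by split; [move=> j /= jn; apply: Dw => /=; rewrite ltnS ltnW|apply: Dw => /=; rewrite ltnSn].
    move=> j /=; rewrite ltnS leq_eqVlt => /orP[/eqP ->|jn]; first exact: Dw.2.
    exact: Dw.1.
  by rewrite capJS big_nat_recr //= D'n -capJ // capE muleC.
have m1E C : <<s cylinders n >> C -> m1 C = m2 C.
  apply: (@measure_unique _ _ U (cylinders n) (fun=> setT)) => //.
  - move=> _ _ [D [mD ->]] [D' [mD' ->]].
    exists (fun j => D j `&` D' j); split; first by move=> j; apply: measurableI.
    by rewrite -bigcapI.
  - by apply/seteqP; split => // w _; exists 0%N.
  - move=> k; have mI : measurable (setT `&` (X n @^-1` B)) by rewrite setTI; apply: (mXB n B mB).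
    by apply: (le_lt_trans (probability_le1 Q mI)); rewrite ltry.
have mS : <<s cylinders n >> (mark_sum n @^-1` A).
  have mX j : (j < n)%N -> measurable_fun setT (X j : U -> R).
    move=> jn _ C mC; rewrite setTI; apply: sub_sigma_algebra.
    exists (fun i => if i == j then C else setT); split; first by move=> i; case: ifP.
    apply/seteqP; split => [w Cw i /= _|w /(_ j jn) /=]; last by rewrite eqxx.
    by case: eqVneq => [->|].
  have := measurable_mark_sum_from mX measurableT mA.
  by rewrite setTI.
have := m1E _ mS; rewrite [LHS](_ : _ = Q ((mark_sum n @^-1` A) `&` (X n @^-1` B))) //.
by move=> ->; rewrite [LHS](_ : _ = (fine (Q (X n @^-1` B)))%:E * Q (mark_sum n @^-1` A))%E // qE muleC.
Qed.

Implicit Types f : 'rV[R]_m -> R.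

Lemma test_function_shift f v : test_function f -> test_function (fun z => f (z + v)).
Proof.
move=> [mf f01]; split => // ; apply: (measurableT_comp mf).
exact: (@measurable_fun_addrV R m _ rM id (cst v)).
Qed.

Definition sum_law n f : \bar R := (\int[Q]_w (f (mark_sum n w))%:E)%E.

Lemma sum_law_ge0 n f : test_function f -> (0 <= sum_law n f)%E.
Proof.
move=> [_ f01]; apply: integral_ge0 => w _; rewrite lee_fin.
by case/andP: (f01 (mark_sum n w)).
Qed.

Lemma measurable_sum_law_shift n f : test_function f ->
  measurable_fun setT (fun u : R => sum_law n (fun z => f (z + h u))).
Proof.
move=> [mf f01].
pose F (p : R * T) : \bar R := (f (mark_sum n p.2 + h p.1))%:E.
have mF : measurable_fun setT F.
  apply/measurable_EFinP; apply: (measurableT_comp mf).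
  apply: measurable_fun_addrV; last exact: (measurableT_comp mh measurable_fst).
  exact: (measurableT_comp (measurable_mark_sum n) measurable_snd).
apply: (measurable_fun_fubini_tonelli_F F mF) => p; rewrite lee_fin.
by case/andP: (f01 (mark_sum n p.2 + h p.1)).
Qed.

(** The last summand is uniform on [0, c] and independent of the others. *)
Lemma sum_lawS n f (c_gt0 : 0 < c) : test_function f ->
  (c%:E * sum_law n.+1 f =
   \int[lebesgue_measure]_(u in `[0%R, c]) sum_law n (fun z => f (z + h u)%R))%E.
Proof.
move=> tf; have [mf f01] := tf.
pose F (p : rM * R) : \bar R := (f ((p.1 : 'rV_m) + h p.2))%:E.
have mF : measurable_fun setT F.
  apply/measurable_EFinP; apply: (measurableT_comp mf).
  apply: measurable_fun_addrV => //; exact: (measurableT_comp mh measurable_snd).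
have F0 p : (0 <= F p)%E by rewrite lee_fin; case/andP: (f01 (p.1 + h p.2)).
have mSX : measurable_fun setT (fun w => (mark_sum n w, X n w) : rM * R).
  by apply: measurable_fun_pair => //; exact: measurable_mark_sum.
pose law : {measure set (rM * R) -> \bar R} := image_measure Q mSX.
pose prod : {measure set (rM * R) -> \bar R} :=
  (distribution Q (marks n) \x distribution Q (X n))%E.
have lawE A : measurable A -> prod A = law A.
  apply: product_measure_unique => A1 A2 mA1 mA2.
  exact: next_independent.
have mI : measurable_fun setT (fun u : R => (\int[distribution Q (marks n)]_z F (z, u))%E).
  exact: measurable_fun_fubini_tonelli_G.
have -> : sum_law n.+1 f = (\int[uniform_prob c_gt0]_u sum_law n (fun z => f (z + h u)%R))%E.
  transitivity (\int[law]_p F p)%E.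
    rewrite ge0_integral_pushforward //; apply: eq_integral => w _.
    by rewrite /F /= /mark_sum big_ord_recr.
  transitivity (\int[prod]_p F p)%E.
    by apply: eq_measure_integral => A mA _; apply/esym/lawE.
  pose I (u : R) := (\int[distribution Q (marks n)]_z F (z, u))%E.
  transitivity (\int[distribution Q (X n)]_u I u)%E; first exact: fubini_tonelli2.
  transitivity (\int[uniform_prob c_gt0]_u I u)%E.
    have mid : measurable_fun setT (id : R -> measurableTypeR R) by exact: measurable_id.
    transitivity (\int[image_measure (distribution Q (X n)) mid]_u I u)%E.
      by rewrite [RHS]ge0_integral_pushforward // => u _; apply: integral_ge0.
    by apply: eq_measure_integral => A mA _; exact: X_unif.
  apply: eq_integral => u _; rewrite /I ge0_integral_pushforward //.
  exact: (measurableT_comp mF (pair2_measurable u)).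
rewrite integral_uniform //.
- by rewrite subr0 muleA -EFinM mulfV ?mul1e// gt_eqF.
- exact: measurable_sum_law_shift.
- move=> u; apply: integral_ge0 => w _; rewrite lee_fin.
  by case/andP: (f01 (mark_sum n w + h u)).
Qed.

Definition limit_law k f : \bar R :=
  (\int[Q]_w (f (compound w) * ((N w).*2 == k)%:R)%:E)%E.

Let weight n : R := (mass * c / 2) ^+ n / n`!%:R * expR (- (mass * c / 2)).

Let weight_ge0 n : 0 <= weight n.
Proof.
by rewrite !mulr_ge0 ?expR_ge0 ?invr_ge0 ?exprn_ge0 ?mulr_ge0 ?invr_ge0.
Qed.

Let weightE n : Q (N @^-1` [set n]) = (weight n)%:E.
Proof.
rewrite [LHS](N_poisson [set n]) poisson_law_set1 //.
by rewrite divr_ge0// mulr_ge0.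
Qed.

Lemma limit_law_odd k f : odd k -> limit_law k f = 0%E.
Proof.
move=> ok; rewrite /limit_law integral0_eq // => w _.
by case: eqP => [E|]; rewrite ?mulr0 //; rewrite -E odd_double in ok.
Qed.

(** N is independent of the marks, so its weight factors out. *)
Lemma limit_law_double n f : test_function f ->
  limit_law n.*2 f = ((weight n)%:E * sum_law n f)%E.
Proof.
move=> [mf f01].
have mN : measurable (N @^-1` [set n] : set T).
  by rewrite -[X in measurable X]setTI; exact: measurable_funP.
have fS0 (z : rM) : (0 <= (f z)%:E)%E by rewrite lee_fin; case/andP: (f01 z).
have mEf : measurable_fun setT (fun z : rM => (f z)%:E) by exact/measurable_EFinP.
pose m1 : {measure set rM -> \bar R} := image_measure (mrestr Q mN) (measurable_mark_sum n).
have w0 : 0 <= weight n by rewrite -lee_fin -weightE measure_ge0.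
pose m2 : {measure set rM -> \bar R} :=
  mscale (NngNum w0) (image_measure Q (measurable_mark_sum n)).
have m12 A : measurable A -> m1 A = m2 A.
  move=> mA.
  rewrite [LHS](_ : _ = Q (mark_sum n @^-1` A `&` N @^-1` [set n])) //.
  rewrite [RHS](_ : _ = (weight n)%:E * Q (mark_sum n @^-1` A))%E //.
  rewrite -weightE setIC; apply: NX_indep; first by exists [set n] => //; rewrite setTI.
  pose U := g_sigma_algebraType (\bigcup_j g_sigma_algebra_preimage (X j)).
  have mX j : (j < n)%N -> measurable_fun setT (X j : U -> R).
    move=> _ _ B mB; apply: sub_sigma_algebra; exists j => //.
    by exists B.
  by have := measurable_mark_sum_from mX measurableT mA; rewrite setTI.
transitivity (\int[m1]_z (f z)%:E)%E.
  rewrite ge0_integral_pushforward //; last exact: measurable_mark_sum.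
  rewrite ge0_integral_mrestr //; last 2 first.
  - exact: (measurableT_comp mEf (measurable_mark_sum n)).
  - by move=> w; exact: fS0.
  rewrite [RHS]integral_mkcond; apply: eq_integral => w _; rewrite patchE.
  rewrite (inj_eq double_inj) [w \in _](_ : _ = (N w == n)).
    by case: eqVneq => [Nw|_]; rewrite ?mulr0// mulr1 /compound Nw.
  by apply/idP/eqP; rewrite inE.
transitivity (\int[m2]_z (f z)%:E)%E.
  by apply: eq_measure_integral => A mA _; exact: m12.
rewrite ge0_integral_mscale // ge0_integral_pushforward //.
exact: measurable_mark_sum.
Qed.

Lemma limit_law_bounds k f : test_function f -> (0 <= limit_law k f <= 1)%E.
Proof.
move=> [mf f01].
have B w : 0 <= f (compound w) * ((N w).*2 == k)%:R <= 1.
  case/andP: (f01 (compound w)) => h1 h2.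
  by case: (_ == _); rewrite ?mulr1 ?mulr0 ?h1 ?lexx ?ler01.
apply/andP; split; first by apply: integral_ge0 => w _; rewrite lee_fin; case/andP: (B w).
rewrite -(@probability_setT _ _ _ Q) -[leRHS]mul1e -integral_cst //.
apply: ge0_le_integral => //.
- by move=> w _; rewrite lee_fin; case/andP: (B w).
- apply/measurable_EFinP; apply: measurable_funM.
    exact: (measurableT_comp mf measurable_compound).
  have mN : measurable_fun setT (fun w => N w) by exact: measurable_funP.
  exact: (measurableT_comp (f := fun n : nat => (n.*2 == k)%:R : R) _ mN).
- by move=> w _; rewrite lee_fin; case/andP: (B w).
Qed.

Lemma measurable_limit_law_shift k f : test_function f ->
  measurable_fun setT (fun u : R => limit_law k (fun z => f (z + h u))).
Proof.
move=> tf; case ok: (odd k).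
  apply: (eq_measurable_fun (cst 0%E)) => [u _|]; last exact: measurable_cst.
  by rewrite limit_law_odd.
rewrite -(odd_double_half k) ok add0n.
apply: (eq_measurable_fun (fun u => (weight k./2)%:E *
    sum_law k./2 (fun z => f (z + h u)%R))%E) => [u _|].
  by rewrite limit_law_double //; exact: test_function_shift.
by apply: measurable_funeM; exact: measurable_sum_law_shift.
Qed.

(** The exact version, for the limit, of the approximate recursion for the number
    of near pairs: with k + 2 = 2(n + 1), the left side is 2(n + 1) times the weight
    of n + 1, that is [mass * c] times the weight of n, and by [sum_lawS] the factor
    c turns the last summand into an integral. *)
Lemma limit_recursion k f : test_function f ->
  (k.+2%:R%:E * limit_law k.+2 f =
   mass%:E * \int[lebesgue_measure]_(u in `[0%R, c])
     limit_law k (fun z => f (z + h u)%R))%E.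
Proof.
move=> tf; case ok: (odd k).
  rewrite limit_law_odd ?mule0; last by rewrite /= negbK.
  by under eq_integral do rewrite limit_law_odd //; rewrite integral0 mule0.
rewrite -(odd_double_half k) ok add0n -doubleS.
set n := k./2; rewrite limit_law_double //.
have E u : limit_law n.*2 (fun z => f (z + h u)) =
    ((weight n)%:E * sum_law n (fun z => f (z + h u)%R))%E.
  exact/limit_law_double/test_function_shift.
under eq_integral do rewrite E.
move: c0; rewrite le_eqVlt => /orP[/eqP c00|c_gt0].
  have -> : weight n.+1 = 0 by rewrite /weight -c00 mulr0 mul0r expr0n !mul0r.
  by rewrite mul0e mule0 -c00 set_itv1 integral_set1 mule0.
rewrite ge0_integralZl_EFin //; last 2 first.
- by move=> u _; apply: sum_law_ge0; exact: test_function_shift.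
- by apply: measurable_funTS; exact: measurable_sum_law_shift.
rewrite -sum_lawS // !muleA -!EFinM; congr (_%:E * _)%E.
rewrite /weight exprS factS natrM -muln2 natrM.
have n1 : n.+1%:R != 0 :> R by rewrite pnatr_eq0.
have nf : n`!%:R != 0 :> R by rewrite pnatr_eq0 -lt0n fact_gt0.
by move: n1 nf; move: (n.+1%:R : R) (n`!%:R : R) => a b a0 b0; field; rewrite a0 b0.
Qed.

End CompoundPoisson.

(** * Comparison of the two recursions *)

Lemma integral_prefix_le (R : realType) (G : R -> \bar R) (a c : R) :
  0 <= a -> 0 <= c -> measurable_fun setT G -> (forall u, 0 <= G u <= 1)%E ->
  (\int[@lebesgue_measure R]_(u in `[0%R, a]) G u <=
   \int[@lebesgue_measure R]_(u in `[0%R, c]) G u + `|a - c|%:E)%E.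
Proof.
move=> a0 c0 mG G01.
have G0 u : (0 <= G u)%E by case/andP: (G01 u).
have [ac|ca] := leP a c.
  apply: (@le_trans _ _ (\int[@lebesgue_measure R]_(u in `[0%R, c]) G u)%E).
    apply: ge0_subset_integral => //; first exact: measurable_funTS.
    by apply: subset_itvl; rewrite bnd_simp.
  by rewrite leeDl// lee_fin.
have -> : `[0%R, a]%classic = `[0%R, c] `|` `]c, a] :> set (measurableTypeR R).
  apply/seteqP; split => x /=; rewrite !in_itv /=.
    by move=> /andP[-> ->]; rewrite andbT /=; case: leP; [left|right].
  by case=> /andP[h1 h2]; apply/andP; split => //; apply: ltW;
    [exact: le_lt_trans ca|exact: le_lt_trans h1].
rewrite ge0_integral_setU //; last 2 first.
- exact: measurable_funTS.
- apply/disj_setPLR => x /=; rewrite !in_itv /= => /andP[_ xc] /andP[cx _].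
  by move: cx; rewrite ltNge xc.
rewrite leeD2l// (@le_trans _ _ (\int[@lebesgue_measure R]_(u in `]c, a]) 1)%E) //.
  apply: ge0_le_integral => //; first exact: measurable_funTS.
  by move=> u _; case/andP: (G01 u).
by rewrite integral_cst//= mul1e lebesgue_measure_itv /= lte_fin ca lee_fin ler_norm.
Qed.

(** Only finitely many values of a count can be compared one by one; the others go
    into the error. *)
Lemma expectation_by_count (R : realType) (dT : measure_display) (T : measurableType dT)
    (P : probability T R) (F M : T -> R) (K : nat) :
  measurable_fun setT F -> measurable_fun setT M -> (forall w, 0 <= F w <= 1) ->
  (forall w, exists n : nat, M w = n%:R) ->
  ((\sum_(k < K) \int[P]_w (F w * (M w == k%:R)%:R)%:E <= \int[P]_w (F w)%:E) /\
   (\int[P]_w (F w)%:E <= \sum_(k < K) \int[P]_w (F w * (M w == k%:R)%:R)%:E +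
      P [set w | (K%:R <= M w)%R]))%E.
Proof.
move=> mF mM F01 Mnat.
have F0 w : 0 <= F w by case/andP: (F01 w).
have F1 w : F w <= 1 by case/andP: (F01 w).
have mFk k : measurable_fun setT (fun w => F w * (M w == k%:R)%:R).
  by apply: measurable_funM => //; exact: measurable_eq_cst.
have Fk0 k w : 0 <= F w * (M w == k%:R)%:R by rewrite mulr_ge0.
have mMK : measurable [set w | K%:R <= M w].
  rewrite (_ : [set w | _] = M @^-1` `[K%:R, +oo[%classic).
    by rewrite -[X in measurable X]setTI; exact: mM.
  by apply/seteqP; split => w /=; rewrite in_itv /= andbT.
have sumE : (\sum_(k < K) \int[P]_w (F w * (M w == k%:R)%:R)%:E =
    \int[P]_w (\sum_(k < K) F w * (M w == k%:R)%:R)%:E)%E.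
  under [in RHS]eq_integral do rewrite -sumEFin.
  rewrite ge0_integral_sum //; last by move=> k w _; rewrite lee_fin.
  by move=> k; apply/measurable_EFinP.
have sumM w : \sum_(k < K) F w * (M w == k%:R)%:R = F w * (M w < K%:R)%R%:R.
  have [n ->] := Mnat w; rewrite -mulr_sumr ltr_nat; congr (_ * _).
  under eq_bigr do rewrite eqr_nat.
  case: ltnP => nK.
    rewrite (bigD1 (Ordinal nK)) //= eqxx big1 ?addr0// => i /eqP ni.
    by case: eqP => // E; case: ni; apply: val_inj.
  rewrite big1 // => i _; case: eqP => // E.
  by move: (ltn_ord i); rewrite -E ltnNge nK.
have mlt : measurable_fun setT (fun w => (M w < K%:R)%R%:R : R).
  apply: (measurableT_comp (f := fun c : bool => c%:R : R)) => //.
  exact: measurable_fun_ltr.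
rewrite sumE; under [X in (X <= _)%E /\ _]eq_integral do rewrite sumM.
under [X in _ /\ (_ <= X + _)%E]eq_integral do rewrite sumM.
have mFlt : measurable_fun setT (fun w => F w * (M w < K%:R)%R%:R).
  exact: measurable_funM.
split.
  apply: ge0_le_integral => //.
  - by move=> w _; rewrite lee_fin mulr_ge0.
  - exact/measurable_EFinP.
  - exact/measurable_EFinP.
  - by move=> w _; rewrite lee_fin ler_piMr// lern1 leq_b1.
have mind : measurable_fun setT (fun w => (\1_[set w | K%:R <= M w] w)%:E : \bar R).
  by apply/measurable_EFinP; exact: measurable_indic.
rewrite -[X in (_ <= _ + P X)%E]setIT -integral_indic //.
rewrite -ge0_integralD //; last 2 first.
- by move=> w _; rewrite lee_fin mulr_ge0.
- exact/measurable_EFinP.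
apply: ge0_le_integral => //.
- by move=> w _; rewrite lee_fin.
- exact/measurable_EFinP.
- by apply: emeasurable_funD => //; exact/measurable_EFinP.
move=> w _; rewrite -EFinD lee_fin; have [h|h] := ltP (M w) K%:R.
  by rewrite mulr1 lerDl.
by rewrite mulr0 add0r indicE mem_set.
Qed.

(** The accumulation of a unit error in a two-step recursion of rate A, started
    without error at 0 and with a unit error at 1. *)
Fixpoint error_growth (R : realType) (A : R) (k : nat) : R :=
  match k with 0%N => 0 | 1%N => 1 | k'.+2 => A * error_growth A k' + 1 end.

Lemma error_growth_ge0 (R : realType) (A : R) k : 0 <= A -> 0 <= error_growth A k.
Proof.
move=> A0; suff: 0 <= error_growth A k /\ 0 <= error_growth A k.+1 by case.
by elim: k => //= k [h1 h2]; split => //; rewrite addr_ge0 ?mulr_ge0.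
Qed.

Section Comparison.
Context (R : realType) (d m : nat) (W U : set 'rV[R]_d) (dl t c A r w : R).
Hypothesis d0 : (0 < d)%N.
Hypothesis mW : measurable (W : set (borelRV R d)).
Hypothesis Wfin : (vol W < +oo)%E.
Local Notation C := (configSpace R d).
Local Notation rV := (borelRV R d).
Local Notation rM := (borelRV R m).
Local Notation nu := (window_measure mW Wfin).
Local Notation V := (fine (vol W)).
Local Notation kap := (kappa R d).
Context (Pi : probability C R) (g : R -> 'rV[R]_m).
Hypotheses (t0 : 0 < t) (dl0 : 0 <= dl) (c0 : 0 <= c) (r0 : 0 <= r) (w0 : 0 <= w).
Hypothesis mecke : mecke_equation Pi nu t.
Hypothesis mg : measurable_fun setT (g : R -> rM).
Hypothesis g0 : forall u i, 0 <= g u ord0 i.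
Hypothesis mU : measurable (U : set rV).
Hypothesis WU : forall x y, W x -> near dl x y -> U y.
Hypothesis volU : (vol (U `\` W) <= w%:E)%E.
Hypothesis tA : kap * V * (t ^+ 2 * dl ^+ d) <= A.

Context (dT : measure_display) (T : measurableType dT) (Q : probability T R)
  (X : nat -> {RV Q >-> R}) (N : {RV Q >-> nat}).
Hypothesis X_indep : mutually_independent Q (fun j => g_sigma_algebra_preimage (X j)).
Hypothesis X_unif : forall (c_gt0 : 0 < c) (j : nat) (B : set R), measurable B ->
  distribution Q (X j) B = uniform_prob c_gt0 B.
Hypothesis N_poisson : forall B : set nat,
  distribution Q N B = poisson_law (kap * V * c / 2) B.
Hypothesis NX_indep : independent Q (g_sigma_algebra_preimage N)
  <<s \bigcup_j g_sigma_algebra_preimage (X j) >>.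

Definition pair_mark (x y : 'rV[R]_d) : 'rV[R]_m := g (t ^+ 2 * enorm (x - y) ^+ d).

Lemma pair_markC x y : pair_mark x y = pair_mark y x.
Proof. by rewrite /pair_mark enormC. Qed.

Lemma measurable_pair_mark :
  measurable_fun setT (fun p : rV * rV => pair_mark p.1 p.2 : rM).
Proof.
have mN : measurable_fun setT (fun p : rV * rV =>
    t ^+ 2 * enorm ((p.1 : 'rV[R]_d) - (p.2 : 'rV[R]_d)) ^+ d).
  by apply: measurable_funM => //; apply: measurable_funX; exact: measurable_dist.
exact: (measurableT_comp mg mN).
Qed.

Let b : R := kap * dl ^+ d.
Let b0 : 0 <= b. Proof. by rewrite mulr_ge0 ?kappa_ge0 ?exprn_ge0. Qed.
Let V0 : 0 <= V. Proof. by apply: fine_ge0; exact: vol_ge0. Qed.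
Let s0 : 0 < t ^+ 2. Proof. exact: exprn_gt0. Qed.
Let mass0 : 0 <= kap * V. Proof. by rewrite mulr_ge0 ?kappa_ge0. Qed.
Let nuT : nu setT = V%:E. Proof. exact: window_measureT. Qed.
Let near_le x : (\int[nu]_y (near dl x y)%:R%:E <= b%:E)%E.
Proof. exact: window_near_le. Qed.
Let mark0 x y i : 0 <= pair_mark x y ord0 i. Proof. exact: g0. Qed.

Local Notation pl := (pair_law dl pair_mark Pi).
Local Notation ll := (limit_law X N g).
Implicit Types f : 'rV[R]_m -> R.

(** Besides the error of the recursion, this accounts for the difference between
    t^2 dl^d and c, and for the near points outside of W, whose volume is at most
    w. *)
Definition step_error : R :=
  recursion_error t b V + r * (kap * V * `|t ^+ 2 * dl ^+ d - c| + t ^+ 2 * (kap * dl ^+ d) * w).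

Let tge0 : 0 <= t. Proof. exact: ltW. Qed.

Let rec_err0 : 0 <= recursion_error t b V.
Proof. by rewrite /recursion_error !mulr_ge0 ?exprn_ge0 ?kappa_ge0. Qed.

Lemma step_error_ge0 : 0 <= step_error.
Proof.
by rewrite addr_ge0// mulr_ge0// addr_ge0// !mulr_ge0 ?kappa_ge0 ?exprn_ge0.
Qed.

(** Both recursions express the laws for k + 2 by those for k of shifted test
    functions. So an error that is uniform over test functions propagates, with a
    factor A that bounds the mean number of near pairs. *)
Lemma compare_step k f (D : R) : 0 <= D ->
  (forall f', test_function f' ->
    (pl k%:R f' <= r%:E * ll k f' + D%:E)%E /\ (r%:E * ll k f' <= pl k%:R f' + D%:E)%E) ->
  test_function f ->
  (pl k.+2%:R f <= r%:E * ll k.+2 f + (D * A + step_error)%:E)%E /\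
  (r%:E * ll k.+2 f <= pl k.+2%:R f + (D * A + step_error)%:E)%E.
Proof.
move=> D0 IH tf; have [mf f01] := tf.
pose G (u : R) := ll k (fun z => f (z + g u)).
have mG : measurable_fun setT G by exact: (measurable_limit_law_shift mg c0 mass0 N_poisson NX_indep k tf).
have G01 u : (0 <= G u <= 1)%E.
  by rewrite /G; apply: limit_law_bounds => //; exact: test_function_shift.
have G0 u : (0 <= G u)%E by case/andP: (G01 u).
have G1 u : (G u <= 1)%E by case/andP: (G01 u).
pose s := t ^+ 2.
pose K1 (p : rV * rV) : \bar R := radial_pairs s dl G p.1 p.2.
pose Nr (p : rV * rV) : \bar R := (near dl p.1 p.2)%:R%:E.
pose L (p : rV * rV) : \bar R :=
  ((near dl p.1 p.2)%:R%:E * pl k%:R (fun z => f (z + pair_mark p.1 p.2)%R))%E.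
have mK : measurable_fun setT K1 by exact: measurable_radial_pairs.
have mNr : measurable_fun setT Nr by exact: (measurable_bool_EFin (@measurable_near R d dl)).
have mL : measurable_fun setT L.
  exact: (measurable_added_pair dl measurable_pair_mark mark0 Pi k%:R tf).
have K0 p : (0 <= K1 p)%E by exact: radial_pairs_ge0.
have Nr0 p : (0 <= Nr p)%E by rewrite lee_fin.
have pl0 a f' : test_function f' -> (0 <= pl a f')%E.
  move=> [_ f01']; apply: integral_ge0 => eta _; rewrite lee_fin mulr_ge0//.
  by case/andP: (f01' (near_marks dl pair_mark eta)).
have L0 p : (0 <= L p)%E.
  by rewrite mule_ge0 ?lee_fin//; apply: pl0; exact: test_function_shift.
have LK p : (L p <= r%:E * K1 p + D%:E * Nr p)%E /\ (r%:E * K1 p <= L p + D%:E * Nr p)%E.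
  rewrite /L /K1 /Nr /radial_pairs; case: (near dl p.1 p.2); last first.
    by rewrite !mul0e !mule0 adde0.
  by rewrite !mul1e !mule1; apply: IH; exact: test_function_shift.
pose m2 : {measure set (rV * rV) -> \bar R} := (nu \x nu)%E.
have I2 F : measurable_fun setT F -> (forall p, 0 <= F p)%E ->
    (\int[m2]_p F p = \int[nu]_x \int[nu]_y F (x, y))%E.
  by move=> mF F0; rewrite /m2 (fubini_tonelli1 F).
have [mc1 mc0] : measurable_fun setT (cst 1%E : R -> \bar R) /\ forall u : R, (0 <= cst 1%E u :> \bar R)%E.
  by split => // u; exact: lee01.
have Vfin : V%:E = vol W by rewrite fineK// ge0_fin_numE ?vol_ge0.
have sd0 : 0 <= s * dl ^+ d by rewrite mulr_ge0 ?exprn_ge0 // ltW.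
have prefix a : 0 <= a -> (\int[@lebesgue_measure R]_(u in `[0%R, a]) 1 = a%:E)%E.
  move=> a0; rewrite integral_cst //= mul1e lebesgue_measure_itv /= lte_fin.
  by case: ltP => h; rewrite ?sube0//; congr EFin; apply/eqP; rewrite eq_le h a0.
have prefix_le a : 0 <= a -> (\int[@lebesgue_measure R]_(u in `[0%R, a]) G u <= a%:E)%E.
  move=> a0; rewrite -(prefix a a0); apply: ge0_le_integral => //.
  exact: measurable_funTS.
have toreal (e : \bar R) (B : R) : (0 <= e)%E -> (e <= B%:E)%E -> exists x : R, e = x%:E.
  move=> e0 eB; exists (fine e); rewrite fineK// ge0_fin_numE//.
  by apply: le_lt_trans eB _; rewrite ltry.
have [y yE] : exists y : R, (\int[@lebesgue_measure R]_(u in `[0%R, c]) G u = y%:E)%E.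
  by apply: (toreal _ _ _ (prefix_le c c0)); apply: integral_ge0.
have [z zE] : exists z : R, (\int[@lebesgue_measure R]_(u in `[0%R, (s * dl ^+ d)%R]) G u = z%:E)%E.
  by apply: (toreal _ _ _ (prefix_le _ sd0)); apply: integral_ge0.
have [n [nE sn]] : exists n : R, (\int[m2]_p Nr p = n%:E)%E /\ s * n <= kap * V * (s * dl ^+ d).
  have := @pair_intensity_le R d W d0 mW Wfin s dl (cst 1%E) s0 dl0 mc1 mc0.
  rewrite prefix // -!EFinM.
  rewrite (_ : (\int[nu]_x \int[nu]_y _ = \int[m2]_p Nr p)%E); last first.
    rewrite I2 //; apply: eq_integral => x _; apply: eq_integral => y' _.
    by rewrite /radial_pairs mule1.
  move=> le1; have le2 : (\int[m2]_p Nr p <= (s^-1 * (V * (kap * (s * dl ^+ d))))%:E)%E.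
    by rewrite EFinM lee_pdivlMl.
  have I0 : (0 <= \int[m2]_p Nr p)%E by apply: integral_ge0.
  have [n nE] := toreal _ _ I0 le2; exists n; split => //.
  by move: le1; rewrite nE -EFinM lee_fin; lra.
have I2K : (\int[nu]_x \int[nu]_y radial_pairs s dl G x y = \int[m2]_p K1 p)%E.
  by rewrite I2.
have leK : (s%:E * \int[m2]_p K1 p <= (V * (kap * z))%:E)%E.
  have := @pair_intensity_le R d W d0 mW Wfin s dl G s0 dl0 mG G0.
  by rewrite zE -!EFinM I2K.
have [x xE] : exists x : R, (\int[m2]_p K1 p = x%:E)%E.
  apply: (@toreal _ (s^-1 * (V * (kap * z)))); first by apply: integral_ge0.
  by rewrite EFinM lee_pdivlMl.
have sx1 : s * x <= V * (kap * z) by move: leK; rewrite xE -EFinM lee_fin.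
have sx2 : V * (kap * z) <= s * x + s * (kap * dl ^+ d) * w.
  have := @pair_intensity_ge R d W d0 mW Wfin s dl G s0 dl0 mG G0 G1 U mU WU.
  rewrite zE I2K xE -!EFinM => le1.
  rewrite -lee_fin; apply: (le_trans le1); rewrite !EFinD leeD2l// [X in (_ <= X)%E]EFinM.
  by rewrite lee_wpmul2l ?lee_fin// !mulr_ge0 ?kappa_ge0 ?exprn_ge0.
have zy1 : z <= y + `|s * dl ^+ d - c|.
  have := integral_prefix_le sd0 c0 mG G01.
  by rewrite zE yE -EFinD lee_fin.
have zy2 : y <= z + `|s * dl ^+ d - c|.
  have := integral_prefix_le c0 sd0 mG G01.
  by rewrite zE yE -EFinD lee_fin distrC.
have [/andP[l0 l1]] := limit_law_bounds X N mg k.+2 tf.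
have [l lE] := toreal _ _ l0 l1.
have ly : k.+2%:R * l = kap * V * y.
  have := limit_recursion mg c0 mass0 X_indep X_unif N_poisson NX_indep k tf.
  by rewrite -/(G _) lE yE -!EFinM => -[].
have [rec1 rec2] := recursion measurable_pair_mark pair_markC mark0 tge0 b0 mecke nuT near_le k.+2 tf.
have k2 : k.+2%:R - 2 = k%:R :> R by rewrite -addn2 natrD addrK.
rewrite k2 in rec1 rec2.
have addedE : added_pair dl t pair_mark Pi nu k%:R f = ((t ^+ 2)%:E * \int[m2]_p L p)%E.
  by rewrite I2.
rewrite addedE -/s in rec1 rec2.
have int1 : (\int[m2]_p L p <= r%:E * x%:E + D%:E * n%:E)%E.
  rewrite -xE -nE -!ge0_integralZl_EFin // -ge0_integralD //; last 4 first.
  - by move=> p _; rewrite mule_ge0.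
  - exact: measurable_funeM.
  - by move=> p _; rewrite mule_ge0.
  - exact: measurable_funeM.
  apply: ge0_le_integral => //.
    by apply: emeasurable_funD; apply: measurable_funeM.
  by move=> p _; case: (LK p).
have int2 : (r%:E * x%:E <= \int[m2]_p L p + D%:E * n%:E)%E.
  rewrite -xE -nE -!ge0_integralZl_EFin // -ge0_integralD //; last 2 first.
  - by move=> p _; rewrite mule_ge0.
  - exact: measurable_funeM.
  apply: ge0_le_integral => //.
  - by move=> p _; rewrite mule_ge0.
  - exact: measurable_funeM.
  - by apply: emeasurable_funD => //; apply: measurable_funeM.
  by move=> p _; case: (LK p).
have [a aE] : exists a : R, (\int[m2]_p L p = a%:E)%E.
  apply: (@toreal _ (r * x + D * n)); first by apply: integral_ge0.
  by rewrite EFinD !EFinM.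
rewrite aE -EFinM in rec1 rec2; rewrite aE -!EFinM -!EFinD !lee_fin in int1 int2.
have [p pE] : exists p : R, pl k.+2%:R f = p%:E.
  have k1 : (0 < k.+2%:R :> R) by rewrite ltr0n.
  apply: (@toreal _ (k.+2%:R^-1 * (s * a + recursion_error t b V))); first exact: pl0.
  by rewrite EFinM lee_pdivlMl// EFinD.
rewrite pE -EFinM -!EFinD !lee_fin in rec1 rec2.
rewrite pE lE -!EFinM -!EFinD !lee_fin.
have tA' : kap * V * (s * dl ^+ d) <= A by exact: tA.
have E0 := step_error_ge0; move: E0; rewrite /step_error -/b -/s.
have q1 : 1 <= k.+2%:R :> R by rewrite (ler_nat _ 1).
move: (recursion_error t b V) rec1 rec2 => er rec1 rec2.
have dc0 : 0 <= `|s * dl ^+ d - c| by [].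
move: (`|s * dl ^+ d - c|) zy1 zy2 dc0 => dc zy1 zy2 dc0.
have A0 : 0 <= A by apply: le_trans tA'; rewrite mulr_ge0.
have Vk0 : 0 <= V * kap by rewrite mulrC.
have s1 : 0 <= s by exact: ltW.
rewrite -/b in sx2.
move: (k.+2%:R : R) q1 rec1 rec2 ly => q q1 rec1 rec2 ly E0.
have h1 : D * (s * n) <= D * A by apply: ler_wpM2l => //; exact: le_trans sn tA'.
have h2 := ler_wpM2l s1 int1.
have h2' := ler_wpM2l s1 int2.
have h3 := ler_wpM2l r0 sx1.
have h3' := ler_wpM2l r0 sx2.
have h4 := ler_wpM2l r0 (ler_wpM2l Vk0 zy1).
have h4' := ler_wpM2l r0 (ler_wpM2l Vk0 zy2).
have h5 : r * (q * l) = r * (kap * V * y) by rewrite ly.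
have DA0 : 0 <= D * A by rewrite mulr_ge0.
set Etot := D * A + _.
have Etot0 : 0 <= Etot by rewrite addr_ge0.
have fin (u v : R) : q * u <= q * v + Etot -> u <= v + Etot.
  move=> quv; rewrite -(ler_pM2l (lt_le_trans ltr01 q1)) mulrDr.
  by rewrite (le_trans quv)// lerD2l ler_peMl.
by split; apply: fin; rewrite /Etot; lra.
Qed.

(** The ratio r is the one of the probabilities that there are no near pairs. *)
Definition no_pair_ratio : Prop :=
  pl 0%:R (cst 1%R) = (r%:E * ll 0%N (cst 1%R))%E.
Hypothesis r_base : no_pair_ratio.

Let one_test : test_function (cst 1 : 'rV[R]_m -> R).
Proof. by split => [|z]; [exact: measurable_cst|rewrite ler01 lexx]. Qed.

Let pl_ge0 a f : test_function f -> (0 <= pl a f)%E.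
Proof.
move=> [_ f01]; apply: integral_ge0 => eta _; rewrite lee_fin mulr_ge0//.
by case/andP: (f01 (near_marks dl pair_mark eta)).
Qed.

Let mean_le : t ^+ 2 * V * b <= A.
Proof. by move: tA; rewrite /b; lra. Qed.

Let A0 : 0 <= A.
Proof. exact: le_trans (mulr_ge0 (mulr_ge0 (ltW s0) V0) b0) mean_le. Qed.

(** Without near pairs the mark sum vanishes on both sides, so the two laws are
    proportional there. *)
Let base0 f : test_function f -> pl 0%:R f = (r%:E * ll 0%N f)%E.
Proof.
move=> tf; have [mf f01] := tf.
have f00 : 0 <= f 0 by case/andP: (f01 0).
have mZ : measurable_fun setT (near_marks dl pair_mark : C -> rM).
  exact: measurable_near_marks measurable_pair_mark mark0.
have mM : measurable_fun setT (@near_pairs R d dl) by exact: measurable_near_pairs.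
have -> : pl 0%:R f = ((f 0)%:E * pl 0%:R (cst 1%R))%E.
  rewrite /pair_law -ge0_integralZl_EFin //; last 2 first.
  - by move=> eta _; rewrite lee_fin mul1r.
  - by apply/measurable_EFinP; apply: measurable_funM => //; exact: measurable_eq_cst.
  apply: eq_integral => eta _; rewrite -EFinM mul1r.
  case: eqP => [M0|]; rewrite ?mulr0 ?mulr1 //.
  by rewrite (near_marks_eq0 pair_mark M0).
have -> : ll 0%N f = ((f 0)%:E * ll 0%N (cst 1%R))%E.
  rewrite /limit_law -ge0_integralZl_EFin //; last 2 first.
  - by move=> w' _; rewrite lee_fin mul1r.
  - apply/measurable_EFinP; apply: (eq_measurable_fun (fun w0 : T => ((N w0).*2 == 0%N)%:R : R)).
      by move=> w' _; rewrite mul1r.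
    apply: (measurableT_comp (f := fun n : nat => (n.*2 == 0%N)%:R : R)) => //.
  apply: eq_integral => w' _; rewrite -EFinM mul1r.
  case: eqP => [M0|]; rewrite ?mulr0 ?mulr1 //.
  have N0 : N w' = 0%N by apply/eqP; rewrite -double_eq0 M0.
  by rewrite /compound N0 /mark_sum big_ord0.
by rewrite r_base muleCA.
Qed.

(** The case k = 0 is exact. For k = 1 the limit law vanishes, as 2N is even, and
    the recursion bounds the other one, since the number of near pairs is never
    -1. *)
Lemma compare_laws k f : test_function f ->
  (pl k%:R f <= r%:E * ll k f + (step_error * error_growth A k)%:E)%E /\
  (r%:E * ll k f <= pl k%:R f + (step_error * error_growth A k)%:E)%E.
Proof.
move: f; pose Pk k := forall f, test_function f ->
  (pl k%:R f <= r%:E * ll k f + (step_error * error_growth A k)%:E)%E /\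
  (r%:E * ll k f <= pl k%:R f + (step_error * error_growth A k)%:E)%E.
rewrite -/(Pk k); suff: Pk k /\ Pk k.+1 by case.
elim: k => [|k [IH1 IH2]]; split => //.
- by move=> f tf; rewrite base0 //= mulr0 adde0.
- move=> f tf; rewrite limit_law_odd // mule0 add0e mulr1.
  have [rec _] := recursion measurable_pair_mark pair_markC mark0 tge0 b0 mecke nuT near_le 1 tf.
  split; last by rewrite adde_ge0 ?pl_ge0// lee_fin step_error_ge0.
  have nul a g' : a < 0 -> pl a g' = 0%E.
    move=> a0; apply: integral0_eq => eta _; rewrite gt_eqF ?mulr0//.
    by rewrite (lt_le_trans a0)// near_pairs_ge0.
  move: rec; rewrite mul1e /added_pair.
  rewrite (_ : (\int[nu]_x _ = 0)%E); last first.
    apply: integral0_eq => x _; apply: integral0_eq => y _.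
    by rewrite nul ?mule0// -natrB// ltrN10.
  rewrite mule0 add0e => /le_trans; apply; rewrite lee_fin lerDl mulr_ge0// addr_ge0//.
    by rewrite mulr_ge0.
  by rewrite !mulr_ge0 ?exprn_ge0 ?kappa_ge0.
- move=> f tf; have D0 : 0 <= step_error * error_growth A k.
    by rewrite mulr_ge0 ?step_error_ge0 ?(error_growth_ge0 _ A0).
  have [h1 h2] := compare_step D0 IH1 tf.
  have -> : step_error * error_growth A k.+2 = step_error * error_growth A k * A + step_error.
    by rewrite /=; ring.
  by split.
Qed.

Let toreal (e : \bar R) (B : R) : (0 <= e)%E -> (e <= B%:E)%E -> exists x : R, e = x%:E.
Proof.
move=> e0 eB; exists (fine e); rewrite fineK// ge0_fin_numE//.
by apply: le_lt_trans eB _; rewrite ltry.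
Qed.

Let unit_mean (dO : measure_display) (O : measurableType dO) (P : probability O R)
    (F : O -> R) : measurable_fun setT F -> (forall w, 0 <= F w <= 1) ->
  exists x : R, (\int[P]_w (F w)%:E = x%:E)%E /\ x <= 1.
Proof.
move=> mF F01.
have le1 : (\int[P]_w (F w)%:E <= 1%:E)%E.
  apply: (@le_trans _ _ (\int[P]_w cst 1%E w)%E); last first.
    by rewrite integral_cst //= mul1e; exact: probability_le1.
  apply: ge0_le_integral => //.
  - by move=> v _; rewrite lee_fin; case/andP: (F01 v).
  - exact/measurable_EFinP.
  - by move=> v _; rewrite lee_fin; case/andP: (F01 v).
have ge0 : (0 <= \int[P]_w (F w)%:E)%E.
  by apply: integral_ge0 => v _; rewrite lee_fin; case/andP: (F01 v).
have [x xE] := toreal ge0 le1.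
by exists x; rewrite xE -lee_fin -xE.
Qed.

(** Markov's inequality. *)
Let near_tail K : (0 < K)%N ->
  (Pi [set eta | (K%:R <= near_pairs dl eta)%R] <= (A / K%:R)%:E)%E.
Proof.
move=> K0; have KR : 0 < K%:R :> R by rewrite ltr0n.
have mM : measurable_fun setT (@near_pairs R d dl) by exact: measurable_near_pairs.
have mE : measurable [set eta : C | K%:R <= near_pairs dl eta].
  rewrite (_ : [set eta | _] = near_pairs dl @^-1` `[K%:R, +oo[%classic).
    by rewrite -[X in measurable X]setTI; exact: mM.
  by apply/seteqP; split => eta /=; rewrite in_itv /= andbT.
rewrite mulrC EFinM lee_pdivlMl //.
have mean := mean_near_pairs tge0 mecke nuT near_le.
apply: (le_trans _ (le_trans mean _)); last by rewrite lee_fin.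
rewrite -[X in Pi X]setIT -integral_indic // -ge0_integralZl_EFin //; last first.
  by apply/measurable_EFinP; exact: measurable_indic.
apply: ge0_le_integral => //.
- by apply: measurable_funeM; apply/measurable_EFinP; exact: measurable_indic.
- by apply/measurable_EFinP.
move=> eta _; rewrite -EFinM lee_fin indicE.
have [/set_mem h|_] := boolP (_ \in _); first by rewrite mulr1.
by rewrite mulr0 near_pairs_ge0.
Qed.

Definition summed_error K : R := step_error * \sum_(k < K) error_growth A k.

(** Taking f = 1 in the comparison of the laws shows that the ratio r is itself
    close to 1, and then the comparison for a general f follows by summing over
    the number of pairs. *)
Lemma compare_expectations K (Tl : R) f : (0 < K)%N -> 0 <= Tl ->
  (Q [set w' | (K <= (N w').*2)%N] <= Tl%:E)%E -> test_function f ->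
  let E := (2 * summed_error K + 2 * (A / K%:R) + (r + 1) * Tl)%:E in
  (\int[Pi]_eta (f (near_marks dl pair_mark eta))%:E <=
     \int[Q]_w' (f (compound X N g w'))%:E + E)%E /\
  (\int[Q]_w' (f (compound X N g w'))%:E <=
     \int[Pi]_eta (f (near_marks dl pair_mark eta))%:E + E)%E.
Proof.
move=> K0 Tl0 QT tf; set S := summed_error K; cbv zeta.
have mZ : measurable_fun setT (near_marks dl pair_mark : C -> rM).
  exact: measurable_near_marks measurable_pair_mark mark0.
have mM : measurable_fun setT (@near_pairs R d dl) by exact: measurable_near_pairs.
have mY : measurable_fun setT (compound X N g : T -> rM) by exact: measurable_compound.
have mN : measurable_fun setT (fun w' => (N w').*2%:R : R).
  apply: (measurableT_comp (f := fun n : nat => n.*2%:R : R)) => //.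
have S0 : 0 <= S.
  by rewrite mulr_ge0 ?step_error_ge0 ?sumr_ge0// => k _; exact: (error_growth_ge0 _ A0).
have sums f' : test_function f' -> exists x y p q : R,
    [/\ (\int[Pi]_eta (f' (near_marks dl pair_mark eta))%:E = x%:E)%E,
        (\int[Q]_w' (f' (compound X N g w'))%:E = y%:E)%E,
        [/\ x <= 1, y <= 1, p <= x & x <= p + A / K%:R],
        [/\ 0 <= q, q <= y & y <= q + Tl] &
        p <= r * q + S /\ r * q <= p + S].
  move=> tf'; have [mf' f01'] := tf'.
  have mfZ : measurable_fun setT (fun eta : C => f' (near_marks dl pair_mark eta)).
    exact: (measurableT_comp mf' mZ).
  have mfY : measurable_fun setT (fun w' => f' (compound X N g w')).
    exact: (measurableT_comp mf' mY).
  have [x [xE x1]] := unit_mean Pi mfZ (fun eta => f01' _).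
  have [y [yE y1]] := unit_mean Q mfY (fun eta => f01' _).
  have [p1 p2] := expectation_by_count Pi K mfZ mM (fun eta => f01' _) (near_pairs_nat dl).
  have [q1 q2] := expectation_by_count Q K mfY mN (fun eta => f01' _)
    (fun w' => ex_intro _ (N w').*2 (erefl _)).
  rewrite -/(pl _ _) in p1 p2.
  have llE k : (\int[Q]_w' (f' (compound X N g w') * ((N w').*2%:R == k%:R :> R)%:R)%:E =
      ll k f')%E.
    by apply: eq_integral => w' _; rewrite eqr_nat.
  have llB k : exists z : R, ll k f' = z%:E /\ 0 <= z.
    have /andP[z0 z1] := limit_law_bounds X N mg k tf'.
    by have [z zE] := toreal z0 z1; exists z; rewrite -lee_fin -zE.
  have [qk qkE] := choice llB.
  have plB k : exists z : R, pl k%:R f' = z%:E.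
    have [h1 _] := compare_laws k tf'; have [qE _] := qkE k.
    by apply: (toreal (pl_ge0 k%:R tf') _); rewrite qE -EFinM -EFinD in h1; exact: h1.
  have [pk pkE] := choice plB.
  have QE : (\sum_(k < K) \int[Q]_w' (f' (compound X N g w') * ((N w').*2%:R == k%:R :> R)%:R)%:E
      = (\sum_(k < K) qk k)%:E)%E.
    by rewrite -sumEFin; apply: eq_bigr => k _; rewrite llE; case: (qkE k).
  have PE : (\sum_(k < K) pl k%:R f' = (\sum_(k < K) pk k)%:E)%E.
    by rewrite -sumEFin; apply: eq_bigr => k _; rewrite pkE.
  rewrite QE yE in q1 q2; rewrite PE xE in p1 p2.
  have tailE : [set w' | K%:R <= (N w').*2%:R :> R] = [set w' | (K <= (N w').*2)%N].
    by apply/seteqP; split => w' /=; rewrite ler_nat.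
  rewrite tailE in q2.
  exists x, y, (\sum_(k < K) pk k), (\sum_(k < K) qk k); split => //.
  - split => //; rewrite -lee_fin.
    by apply: (le_trans p2); rewrite EFinD leeD2l// near_tail.
  - split => //; first by apply: sumr_ge0 => k _; case: (qkE k).
    by rewrite -lee_fin; apply: (le_trans q2); rewrite EFinD leeD2l.
  have cmp k : pk k <= r * qk k + step_error * error_growth A k /\
               r * qk k <= pk k + step_error * error_growth A k.
    have := compare_laws k tf'; have [qE _] := qkE k.
    by rewrite qE pkE -!EFinM -!EFinD !lee_fin.
  rewrite /S /summed_error !mulr_sumr -!big_split /=.
  by split; apply: ler_sum => k _; case: (cmp k).
have [x1 [y1 [p1 [q1 [x1E y1E [_ _ px1 xp1] [q10 qy1 yq1] [pq1 qp1]]]]]] := sums _ one_test.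
have [x [y [p [q [xE yE [x1' y1' px xp] [q0 qy yq] [pq qp]]]]]] := sums _ tf.
have cst1 (dO : measure_display) (O : measurableType dO) (P : probability O R) :
    (\int[P]_w' (cst 1 w' : R)%:E = 1%:E)%E.
  by rewrite (eq_integral (cst 1%E)) // integral_cst //= mul1e probability_setT.
have x11 : x1 = 1 by move: x1E; rewrite cst1 => -[].
have y11 : y1 = 1 by move: y1E; rewrite cst1 => -[].
rewrite xE yE -!EFinD !lee_fin.
have r1 : r <= 1 + S + r * Tl.
  have : r * 1 <= r * (q1 + Tl) by apply: ler_wpM2l => //; rewrite -y11.
  by lra.
have r2 : 1 <= r + S + A / K%:R.
  have : r * q1 <= r * 1 by apply: ler_wpM2l => //; rewrite -y11.
  by lra.
have AK0 : 0 <= A / K%:R by rewrite divr_ge0.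
have q1' : q <= 1 by exact: le_trans qy y1'.
have h1 : (r - 1) * q <= (S + r * Tl).
  apply: (@le_trans _ _ ((S + r * Tl) * q)); first by apply: ler_wpM2r => //; lra.
  by rewrite ler_piMr// addr_ge0// mulr_ge0.
have h2 : (1 - r) * q <= (S + A / K%:R).
  apply: (@le_trans _ _ ((S + A / K%:R) * q)); first by apply: ler_wpM2r => //; lra.
  by rewrite ler_piMr// addr_ge0.
have rT0 : 0 <= r * Tl by rewrite mulr_ge0.
split; lra.
Qed.

End Comparison.

(** * The limit *)

(** N is finite, so the events on the left decrease to the empty set. *)
Lemma count_tail (R : realType) (dT : measure_display) (T : measurableType dT)
    (Q : probability T R) (N : {RV Q >-> nat}) (e : R) : 0 < e ->
  exists K0, forall K, (K0 <= K)%N -> (Q [set w | (K <= (N w).*2)%N] <= e%:E)%E.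
Proof.
move=> e0; pose F K : set T := [set w | (K <= (N w).*2)%N].
have mF K : measurable (F K).
  have -> : F K = N @^-1` [set n | (K <= n.*2)%N] by [].
  by rewrite -[X in measurable X]setTI; exact: (measurable_funP N).
have F0 : \bigcap_K F K = set0.
  apply/seteqP; split => // w Fw.
  have : ((N w).*2 < (N w).*2)%N := Fw (N w).*2.+1 I.
  by rewrite ltnn.
have decF : {homo F : n m / (n <= m)%N >-> (m <= n)%O}.
  by move=> n m nm; apply/subsetPset => w /=; exact: leq_trans.
have finF : (Q (F 0%N) < +oo)%E.
  by apply: le_lt_trans (probability_le1 _ (mF 0%N)) _; rewrite ltry.
have := @nonincreasing_cvg_mu _ _ _ Q F finF mF (bigcapT_measurable mF) decF.
rewrite F0 measure0.
move=> /(_ [set y | (y < e%:E)%E]) [].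
  by apply: (open_nbhs_nbhs); split; [exact: open_ereal_lt_ereal|rewrite /= lte_fin].
by move=> K0 _ FK; exists K0 => K /FK /= /ltW.
Qed.

(** The probability that N = 0 is positive, and it bounds the ratio independently
    of the process. *)
Lemma no_pair_ratio_exists (R : realType) (d m : nat) (dl t c mass : R)
    (Pi : probability (configSpace R d) R) (g : R -> 'rV[R]_m)
    (dT : measure_display) (T : measurableType dT) (Q : probability T R)
    (X : nat -> {RV Q >-> R}) (N : {RV Q >-> nat}) :
  measurable_fun setT (g : R -> borelRV R m) -> 0 <= c -> 0 <= mass ->
  (forall B : set nat, distribution Q N B = poisson_law (mass * c / 2) B) ->
  independent Q (g_sigma_algebra_preimage N)
    <<s \bigcup_j g_sigma_algebra_preimage (X j) >> ->
  exists r, 0 <= r <= expR (mass * c / 2) /\ no_pair_ratio dl t r Pi g X N.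
Proof.
move=> mg c0 mass0 N_poisson NX_indep; pose C := configSpace R d.
have one_test : test_function (cst 1 : 'rV[R]_m -> R).
  by split => [|z]; [exact: measurable_cst|rewrite ler01 lexx].
rewrite /no_pair_ratio.
have -> : limit_law X N g 0%N (cst 1) = (expR (- (mass * c / 2)))%:E.
  have := limit_law_double mg c0 mass0 N_poisson NX_indep 0%N one_test.
  rewrite double0 => ->; rewrite expr0 fact0 divr1 mul1r /sum_law (eq_integral (cst 1%E)) //.
  by rewrite integral_cst //= probability_setT !mule1.
set p := pair_law _ _ _ _ _.
have p0 : (0 <= p)%E by apply: integral_ge0 => eta _; rewrite lee_fin mul1r.
have p1 : (p <= 1)%E.
  apply: (@le_trans _ _ (\int[Pi]_eta cst 1%E eta)%E); last first.
    by rewrite integral_cst //= probability_setT mule1.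
  apply: ge0_le_integral => //.
  - by move=> eta _; rewrite lee_fin mul1r.
  - apply/measurable_EFinP; apply: measurable_funM => //.
    by apply: measurable_eq_cst; exact: measurable_near_pairs.
  - by move=> eta _; rewrite lee_fin mul1r lern1 leq_b1.
have pE : p = (fine p)%:E.
  by rewrite fineK// ge0_fin_numE// (le_lt_trans p1)// ltry.
rewrite pE in p0 p1 *; rewrite !lee_fin in p0 p1.
exists (fine p * expR (mass * c / 2)); split.
  by rewrite mulr_ge0 ?expR_ge0//= ler_piMl ?expR_ge0.
by rewrite -EFinM -(mulrA (fine p)) -expRD subrr expR0 mulr1.
Qed.

Section Limit.
Context (R : realType) (d : nat) (d0 : (0 < d)%N) (W : set 'rV[R]_d)
  (Wcompact : compact W) (dT : R -> measure_display)
  (T : forall t, measurableType (dT t)) (P : forall t, probability (T t) R)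
  (eta : forall t, T t -> {fset 'rV[R]_d}).
Arguments eta : clear implicits.
Hypothesis eta_poisson : forall t : R, 0 < t -> poisson_process (P t) W t (eta t).
Variable delta : R -> R.
Hypothesis delta_gt0 : forall t : R, 0 < t -> 0 < delta t.
Hypothesis delta_cvg0 : delta t @[t --> +oo] --> (0 : R).
Variable c : R.
Hypothesis c_ge0 : 0 <= c.
Hypothesis cvg_c : t ^+ 2 * delta t ^+ d @[t --> +oo] --> c.
Context (dT' : measure_display) (T' : measurableType dT') (Q : probability T' R)
  (X : nat -> {RV Q >-> R}) (N : {RV Q >-> nat}).
Hypothesis X_indep : mutually_independent Q (fun j => g_sigma_algebra_preimage (X j)).
Hypothesis X_unif : forall (c_gt0 : 0 < c) (j : nat) (B : set R), measurable B ->
  distribution Q (X j) B = uniform_prob c_gt0 B.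
Hypothesis N_poisson : forall B : set nat,
  distribution Q N B = poisson_law (kappa R d * fine (vol W) * c / 2) B.
Hypothesis NX_indep : independent Q (g_sigma_algebra_preimage N)
  <<s \bigcup_j g_sigma_algebra_preimage (X j) >>.
Context (m : nat) (g : R -> 'rV[R]_m).
Hypothesis mg : measurable_fun setT (g : R -> borelRV R m).
Hypothesis g0 : forall u i, 0 <= g u ord0 i.
Local Notation C := (configSpace R d).
Local Notation rM := (borelRV R m).
Local Notation V := (fine (vol W)).
Local Notation mass := (kappa R d * V).

Definition process_marks (t : R) (w : T t) : 'rV[R]_m :=
  near_marks (delta t) (pair_mark t g) (eta t w).

Let mark_ge0 (t : R) (x y : 'rV[R]_d) i : 0 <= pair_mark t g x y ord0 i.
Proof. exact: g0. Qed.

Let mZ (t : R) : measurable_fun setT (near_marks (delta t) (pair_mark t g) : C -> rM).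
Proof. exact: measurable_near_marks (measurable_pair_mark t mg) (@mark_ge0 t). Qed.

Let mW := window_measurable Wcompact.
Let Wfin := window_finite Wcompact.

Lemma measurable_process_marks (t : R) : 0 < t ->
  measurable_fun setT (process_marks (t := t) : T t -> rM).
Proof.
move=> t0; have [M [_ WM]] := window_box Wcompact.
exact: (measurableT_comp (mZ t) (measurable_eta mW WM (eta_poisson t0))).
Qed.

Let V0 : 0 <= V. Proof. by apply: fine_ge0; exact: vol_ge0. Qed.
Let mass0 : 0 <= mass. Proof. by rewrite mulr_ge0 ?kappa_ge0. Qed.

Lemma near_neighborhood (dl rho : R) (x y : 'rV[R]_d) : dl < rho -> W x -> near dl x y ->
  neighborhood W rho y.
Proof.
move=> dlr Wx xy; exists x => //=; split=> [|i j].
  exact: le_lt_trans (le_trans (enorm_ge0 (x - y)) xy) dlr.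
rewrite ord1; have := le_lt_trans (le_trans (coord_le_enorm (x - y) j) xy) dlr.
by rewrite !mxE.
Qed.

(** The three error terms tend to 0 separately: the first one is bounded by a
    constant times (t^2 dl^d)^2 / t, and the neighbourhood U of W is chosen before
    t, with an excess volume w that makes the last term small. *)
Let eventually_step_error (e : R) : 0 < e ->
  \forall t \near +oo, 0 < t /\ t ^+ 2 * delta t ^+ d <= c + 1 /\
    exists w U, [/\ 0 <= w, measurable (U : set (borelRV R d)),
      (forall x y, W x -> near (delta t) x y -> U y), (vol (U `\` W) <= w%:E)%E &
      forall r, 0 <= r <= expR (mass * c / 2) -> step_error W (delta t) t c r w <= e].
Proof.
move=> e0; set Rm := expR _.
have Rm0 : 0 <= Rm by exact: expR_ge0.
have k0 : 0 <= kappa R d by exact: kappa_ge0.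
have c1 : 0 <= c + 1 by rewrite addr_ge0.
(* The factors of 1 / t, of |t^2 dl^d - c| and of w in the bounds of the three
   terms; r is at most Rm, and t^2 dl^d at most c + 1. *)
pose B1 := 2 * V * kappa R d ^+ 2 * (c + 1) ^+ 2.
pose B2 := Rm * mass.
pose B3 := Rm * (kappa R d * (c + 1)).
have B10 : 0 <= B1 by rewrite /B1 !mulr_ge0 ?exprn_ge0.
have B20 : 0 <= B2 by rewrite /B2 !mulr_ge0.
have B30 : 0 <= B3 by rewrite /B3 !mulr_ge0.
pose w := e / (3 * (B3 + 1)).
have w0 : 0 < w by rewrite divr_gt0 // mulr_gt0 // ltr_wpDl.
have [rho rho0 exc] := neighborhood_excess Wcompact w0.
have dd0 : 0 < e / (3 * (B2 + 1)) by rewrite divr_gt0 // mulr_gt0 // ltr_wpDl.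
near=> t.
have t0 : 0 < t by near: t; apply: nbhs_pinfty_gt; rewrite num_real.
have tB : 3 * B1 / e < t by near: t; apply: nbhs_pinfty_gt; rewrite num_real.
have dr : delta t < rho.
  by near: t; apply: (cvgr_lt (0 : R)) rho0.
have u1 : `|c - t ^+ 2 * delta t ^+ d| < 1.
  by near: t; move/cvgrPdist_lt: cvg_c; apply.
have u2 : `|c - t ^+ 2 * delta t ^+ d| < e / (3 * (B2 + 1)).
  by near: t; move/cvgrPdist_lt: cvg_c; apply.
have dt0 : 0 <= delta t by rewrite ltW// delta_gt0.
set u := t ^+ 2 * delta t ^+ d in u1 u2 *.
have u0 : 0 <= u by rewrite mulr_ge0 ?exprn_ge0 // ltW.
have uc : u <= c + 1 by move: u1; rewrite distrC ltr_norml => /andP[_ h]; lra.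
split => //; split => //; exists w, (neighborhood W rho); split => //.
- exact: ltW.
- exact: measurable_neighborhood.
- by move=> x y Wx; exact: near_neighborhood.
move=> r /andP[r0 rR]; rewrite /step_error /recursion_error.
have -> : 2 * t ^+ 3 * V * (kappa R d * delta t ^+ d) ^+ 2 =
    2 * V * kappa R d ^+ 2 * u ^+ 2 / t.
  by rewrite /u; field; rewrite gt_eqF.
have -> : t ^+ 2 * (kappa R d * delta t ^+ d) * w = kappa R d * u * w.
  by rewrite /u; ring.
rewrite -/u distrC.
have b1 : 2 * V * kappa R d ^+ 2 * u ^+ 2 / t <= e / 3.
  apply: (@le_trans _ _ (B1 / t)).
    rewrite ler_pM2r ?invr_gt0// /B1 ler_wpM2l ?mulr_ge0 ?exprn_ge0//.
    by rewrite lerXn2r// nnegrE.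
  by rewrite ler_pdivrMr//; move: tB; rewrite ltr_pdivrMr// => h; lra.
have b2 : r * (mass * `|c - u|) <= e / 3.
  apply: (@le_trans _ _ (B2 * `|c - u|)).
    by rewrite /B2 -(mulrA Rm); apply: ler_wpM2r => //; exact: mulr_ge0.
  apply: (@le_trans _ _ ((B2 + 1) * (e / (3 * (B2 + 1))))).
    by apply: ler_pM => //; [lra|exact: ltW].
  by rewrite le_eqVlt; apply/orP; left; apply/eqP; field; rewrite gt_eqF// ltr_wpDl.
have b3 : r * (kappa R d * u * w) <= e / 3.
  apply: (@le_trans _ _ (B3 * w)).
    rewrite mulrA ler_wpM2r ?(ltW w0)//; apply: ler_pM => //; first by rewrite mulr_ge0.
    by rewrite ler_wpM2l.
  apply: (@le_trans _ _ ((B3 + 1) * w)); first by rewrite ler_wpM2r ?(ltW w0)//; lra.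
  by rewrite /w le_eqVlt; apply/orP; left; apply/eqP; field; rewrite gt_eqF// ltr_wpDl.
rewrite mulrDr; lra.
Unshelve. all: by end_near. Qed.

(** The convergence is uniform over all measurable test functions with values in
    the unit interval, that is, it holds in total variation. *)
Lemma uniform_convergence (e : R) : 0 < e ->
  \forall t \near +oo, forall f : 'rV[R]_m -> R, test_function f ->
    (\int[P t]_w (f (process_marks w))%:E <=
       \int[Q]_w (f (compound X N g w))%:E + e%:E)%E /\
    (\int[Q]_w (f (compound X N g w))%:E <=
       \int[P t]_w (f (process_marks w))%:E + e%:E)%E.
Proof.
move=> e0; set Rm := expR (mass * c / 2).
have Rm0 : 0 <= Rm by exact: expR_ge0.
pose A := mass * (c + 1).
have A0 : 0 <= A by rewrite mulr_ge0// addr_ge0.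
pose Tl := e / (3 * (Rm + 1)).
have Tl0 : 0 < Tl by rewrite divr_gt0 // mulr_gt0 // ltr_wpDl.
have [K0 tail] := count_tail N Tl0.
(* K is large enough for the tails of both counts. *)
pose K := (K0 + (Num.truncn (6 * A / e)).+1)%N.
have K_gt0 : (0 < K)%N by rewrite /K addnS.
have AK : 2 * (A / K%:R) <= e / 3.
  have KR : 0 < K%:R :> R by rewrite ltr0n.
  have h : 6 * A / e < K%:R.
    apply: (lt_le_trans (truncnS_gt _)).
    by rewrite ler_nat leq_addl.
  rewrite mulrA ler_pdivrMr// mulrAC ler_pdivlMr//.
  move: h; rewrite ltr_pdivrMr// => h; lra.
pose G := \sum_(k < K) error_growth A k.
have G0 : 0 <= G by apply: sumr_ge0 => k _; exact: error_growth_ge0.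
have eta0 : 0 < e / (6 * (G + 1)) by rewrite divr_gt0 // mulr_gt0 // ltr_wpDl.
near=> t.
have [t0 [uc [w [U [w0 mU WU volU err]]]]] : 0 < t /\ t ^+ 2 * delta t ^+ d <= c + 1 /\
    exists w U, [/\ 0 <= w, measurable (U : set (borelRV R d)),
      (forall x y, W x -> near (delta t) x y -> U y), (vol (U `\` W) <= w%:E)%E &
      forall r, 0 <= r <= Rm -> step_error W (delta t) t c r w <= e / (6 * (G + 1))].
  by near: t; exact: eventually_step_error.
move=> f tf; have [mf f01] := tf; have [M [_ WM]] := window_box Wcompact.
have Peta := eta_poisson t0; pose Pi := config_prob mW WM Peta.
have PiE : (\int[Pi]_x (f (near_marks (delta t) (pair_mark t g) x))%:E =
            \int[P t]_w (f (process_marks w))%:E)%E.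
  rewrite (ge0_integral_pushforward (measurable_eta mW WM Peta) (P t)) ?preimage_setT //.
    by apply/measurable_EFinP; exact: (measurableT_comp mf (mZ t)).
  by move=> x _; rewrite lee_fin; case/andP: (f01 (near_marks (delta t) (pair_mark t g) x)).
have [r [/andP[r0 rR] ratio]] :=
  no_pair_ratio_exists (delta t) t Pi mg c_ge0 mass0 N_poisson NX_indep.
have tA : mass * (t ^+ 2 * delta t ^+ d) <= A by rewrite ler_wpM2l.
have dt0 : 0 <= delta t by rewrite ltW// delta_gt0.
have [h1 h2] := compare_expectations d0 t0 dt0 c_ge0 r0 w0
  (mecke_poisson mW WM Wfin t0 Peta) mg g0 mU WU volU tA X_indep X_unif N_poisson
  NX_indep ratio K_gt0 (ltW Tl0) (tail K (leq_addr _ _)) tf.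
rewrite -PiE; set E := _ + _ + _ in h1 h2.
suff Ee : E <= e.
  by split; [apply: (le_trans h1)|apply: (le_trans h2)]; rewrite leeD2l// lee_fin.
have S1 : 2 * summed_error W (delta t) t c A r w K <= e / 3.
  rewrite /summed_error -/G.
  have := err r; rewrite r0 rR => /(_ isT) h.
  have : step_error W (delta t) t c r w * G <= e / (6 * (G + 1)) * (G + 1).
    apply: (@le_trans _ _ (e / (6 * (G + 1)) * G)); first exact: ler_wpM2r.
    by apply: ler_wpM2l; [exact: ltW|lra].
  have -> : e / (6 * (G + 1)) * (G + 1) = e / 6.
    by field; rewrite gt_eqF// ltr_wpDl.
  lra.
have S2 : (r + 1) * Tl <= e / 3.
  apply: (@le_trans _ _ ((Rm + 1) * Tl)); first by rewrite ler_wpM2r ?(ltW Tl0)// lerD2r.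
  by rewrite /Tl le_eqVlt; apply/orP; left; apply/eqP; field; rewrite gt_eqF// ltr_wpDl.
by rewrite /E; lra.
Unshelve. all: by end_near. Qed.

End Limit.

(** * Edge power sums as mark sums *)

Lemma powR_rescaled (R : realType) (t e s : R) (d : nat) : (0 < d)%N -> 0 < t -> 0 <= e ->
  (t ^+ 2 * e ^+ d) `^ (s / d%:R) = t `^ (2 * s / d%:R) * e `^ s.
Proof.
move=> d0 t0 e0; have t1 := ltW t0.
rewrite powRM ?exprn_ge0 // -!powR_mulrn // -!powRrM; congr (_ `^ _ * _ `^ _).
  by rewrite mulrA.
by rewrite mulrC divfK // pnatr_eq0 -lt0n.
Qed.

Definition power_marks (R : realType) (d m : nat) (tau : 'I_m -> R) (u : R) : 'rV[R]_m :=
  \row_i u `^ (tau i / d%:R).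

Lemma measurable_power_marks (R : realType) (d m : nat) (tau : 'I_m -> R) :
  measurable_fun setT (power_marks d tau : R -> borelRV R m).
Proof.
apply: measurable_fun_row => i.
apply: (eq_measurable_fun (fun u : R => u `^ (tau i / d%:R))).
  by move=> u _; rewrite !mxE.
exact: measurable_powR.
Qed.

Lemma edge_power_sums_marks (R : realType) (d m : nat) (tau : 'I_m -> R) (dl t : R)
    (A : {fset 'rV[R]_d}) : (0 < d)%N -> 0 < t ->
  \row_(i < m) (t `^ (2 * tau i / d%:R) * edge_power_sum dl (tau i) A) =
  near_marks dl (pair_mark t (power_marks d tau)) A.
Proof.
move=> d0 t0; apply/rowP => i; rewrite !mxE /edge_power_sum /pair_sum mulrCA; congr (_ * _).
rewrite mulr_sumr summxE big_seq [RHS]big_seq; apply: eq_bigr => x xA.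
rewrite mulr_sumr summxE big_mkcond (big_fsetD1 x) //= eqxx add0r.
rewrite big_seq [RHS]big_seq; apply: eq_bigr => y; rewrite in_fsetD1 => /andP[yx _].
rewrite !mxE eq_sym yx /= -/(near dl x y) powR_rescaled ?enorm_ge0 //.
by case: (near dl x y); rewrite ?mul1r ?mul0r.
Qed.

(** Convergence of means against a bounded continuous f follows from that for the
    test function [(f + M) / (2 M)], where M bounds f. *)
Lemma bounded_fun_test (R : realType) (m : nat) (f : 'rV[R]_m -> R) :
  continuous f -> bounded_fun f ->
  exists M : R, 0 < M /\ test_function (fun z => (f z + M) / (2 * M)).
Proof.
move=> cf [B [_ fB]]; pose M := `|B| + 1.
have M0 : 0 < M by rewrite ltr_wpDl.
have fM z : `|f z| <= M.
  by apply: fB => //; rewrite /M (le_lt_trans (ler_norm B))// ltrDl.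
exists M; split => //; split.
  have mf : measurable_fun setT (f : borelRV R m -> R) by exact: continuous_measurable_rV.
  by apply: measurable_funM => //; apply: measurable_funD.
move=> z; have M2 : 0 < 2 * M by rewrite mulr_gt0.
rewrite ler_pdivrMr// mul1r divr_ge0 ?(ltW M2)//=.
  by move: (fM z); rewrite ler_norml => /andP[_ h]; lra.
by move: (fM z); rewrite ler_norml => /andP[h _]; lra.
Qed.

Lemma expectation_affine (R : realType) (m : nat) (dT : measure_display)
    (T : measurableType dT) (P : probability T R) (Z : T -> 'rV[R]_m)
    (f : 'rV[R]_m -> R) (M : R) :
  measurable_fun setT (Z : T -> borelRV R m) -> 0 < M ->
  test_function (fun z => (f z + M) / (2 * M)) ->
  exists x : R, (\int[P]_w ((f (Z w) + M) / (2 * M))%:E = x%:E)%E /\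
                ('E_P[f \o Z] = (2 * M * x - M)%:E)%E.
Proof.
move=> mZ M0 [mf f01]; pose F w := (f (Z w) + M) / (2 * M).
have mF : measurable_fun setT F by exact: (measurableT_comp mf mZ).
have iF : P.-integrable setT (EFin \o F).
  apply: (@le_integrable _ _ _ P setT measurableT _ (cst 1%E)) => //.
  - exact/measurable_EFinP.
  - by move=> w _ /=; rewrite normr1 lee_fin ger0_norm; case/andP: (f01 (Z w)).
  - by apply: finite_measure_integrable_cst.
have [x xE] : exists x : R, (\int[P]_w (F w)%:E = x%:E)%E.
  by exists (fine (\int[P]_w (F w)%:E)); rewrite fineK // integrable_fin_num.
exists x; split => //; rewrite unlock.
have -> : (\int[P]_w ((f \o Z) w)%:E = \int[P]_w ((2 * M)%:E * (F w)%:E - M%:E))%E.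
  apply: eq_integral => w _; rewrite -EFinM -EFinB /F /=; congr EFin.
  by field; rewrite gt_eqF.
rewrite integralB //; last 2 first.
- exact: integrableZl.
- exact: finite_measure_integrable_cst.
rewrite integralZl // xE integral_cst //= probability_setT mule1.
by rewrite -EFinM -EFinB.
Qed.

Theorem theorem5p8 (R : realType) (d : nat) (hd : (1 <= d)%N)
    (W : set 'rV[R]_d) (Wcompact : compact W)
    (Wconvex : convex_set (W : set (convex_lmodType 'rV[R]_d)))
    (Wpos : (0 < vol W)%E)
    (dT : R -> measure_display) (T : forall t, measurableType (dT t))
    (P : forall t, probability (T t) R)
    (eta : forall t, T t -> {fset 'rV[R]_d})
    (eta_poisson : forall t, 0 < t -> poisson_process (P t) W t (eta t))
    (delta : R -> R) (delta_gt0 : forall t, 0 < t -> 0 < delta t)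
    (delta_cvg0 : delta t @[t --> +oo] --> (0 : R))
    (c : R) (c_ge0 : 0 <= c)
    (cvg_c : t ^+ 2 * delta t ^+ d @[t --> +oo] --> c)
    (dT' : measure_display) (T' : measurableType dT') (Q : probability T' R)
    (X : nat -> {RV Q >-> R}) (N : {RV Q >-> nat})
    (X_indep : mutually_independent Q (fun j => g_sigma_algebra_preimage (X j)))
    (X_unif : forall (c_gt0 : 0 < c) (j : nat) (B : set R), measurable B ->
       distribution Q (X j) B = uniform_prob c_gt0 B)
    (N_poisson : forall B : set nat,
       distribution Q N B = poisson_law (kappa R d * fine (vol W) * c / 2) B)
    (NX_indep : independent Q (g_sigma_algebra_preimage N)
       <<s \bigcup_j g_sigma_algebra_preimage (X j) >>)
    (m : nat) (tau : 'I_m -> R) :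
  cvg_in_distribution (pinfty_nbhs R) P
    (fun t w => \row_(i < m)
       (t `^ (2 * tau i / d%:R) * edge_power_sum (delta t) (tau i) (eta t w)))
    Q
    (fun w => \row_(i < m) \sum_(j < N w) X j w `^ (tau i / d%:R)).
Proof.
pose g := power_marks d tau.
have mg : measurable_fun setT (g : R -> borelRV R m) by exact: measurable_power_marks.
have g0 u i : 0 <= g u ord0 i by rewrite mxE powR_ge0.
have YE : (fun w => \row_(i < m) \sum_(j < N w) X j w `^ (tau i / d%:R)) = compound X N g.
  apply/funext => w; apply/rowP => i; rewrite /compound /mark_sum summxE mxE.
  by apply: eq_bigr => j _; rewrite mxE.
have ZE (t : R) : 0 < t -> (fun w => \row_(i < m)
    (t `^ (2 * tau i / d%:R) * edge_power_sum (delta t) (tau i) (eta t w))) =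
    process_marks eta delta g (t := t).
  by move=> t0; apply/funext => w; exact: edge_power_sums_marks.
have mZ (t : R) (t0 : 0 < t) := measurable_process_marks Wcompact eta_poisson delta mg g0 t0.
have mY := measurable_compound X N mg.
have tpos : \forall t \near +oo, (0 : R) < t.
  by apply: nbhs_pinfty_gt; rewrite num_real.
rewrite YE; split => //.
  by near=> t; rewrite ZE; [apply: mZ|]; near: t.
move=> f cf bf; have [M [M0 tf]] := bounded_fun_test cf bf.
have [y [yE EY]] := expectation_affine Q mY M0 tf.
have EX (t : R) : 0 < t -> exists x : R,
    (\int[P t]_w ((f (process_marks eta delta g w) + M) / (2 * M))%:E = x%:E)%E /\
    ('E_(P t)[f \o (fun w => \row_(i < m)
      (t `^ (2 * tau i / d%:R) * edge_power_sum (delta t) (tau i) (eta t w))%R)] =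
     (2 * M * x - M)%:E)%E.
  by move=> t0; rewrite ZE //; exact: (expectation_affine (P t) (mZ t t0) M0 tf).
rewrite EY; apply/fine_cvgP; split.
  near=> t; have [|x [_ ->]] := EX t; last by [].
  by near: t.
apply/cvgrPdist_le => e e0.
have eM : 0 < e / (2 * M) by rewrite divr_gt0// mulr_gt0.
have unif := uniform_convergence hd Wcompact eta_poisson delta_gt0 delta_cvg0 c_ge0
  cvg_c X_indep X_unif N_poisson NX_indep mg g0 eM.
near=> t.
have t0 : 0 < t by near: t.
have [x [xE xE']] := EX t t0; rewrite /comp xE'.
(* The uniform bound, with the rest of the goal kept out of the filter. *)
have close : forall f' : 'rV[R]_m -> R, test_function f' ->
    (\int[P t]_w (f' (process_marks eta delta g w))%:E <=
       \int[Q]_w (f' (compound X N g w))%:E + (e / (2 * M))%:E)%E /\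
    (\int[Q]_w (f' (compound X N g w))%:E <=
       \int[P t]_w (f' (process_marks eta delta g w))%:E + (e / (2 * M))%:E)%E.
  by near: t.
have := close _ tf; rewrite xE yE -!EFinD !lee_fin => -[h1 h2] /=.
have -> : 2 * M * y - M - (2 * M * x - M) = 2 * M * (y - x) by ring.
rewrite normrM ger0_norm; last by rewrite mulr_ge0// ltW.
rewrite mulrC -ler_pdivlMr ?mulr_gt0// ler_norml; apply/andP; split; lra.
Unshelve. all: by end_near. Qed.
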